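(* Let $n,d\ge 1$ be integers, let $\Omega\subset \mathbb{C}^n\subset\mathbb{C}\mathbb{P}^n$ be a nonempty connected open set, let $f\colon\Omega\to \mathbb{C}^d\subset \mathbb{C}\mathbb{P}^d$ be a minimally embedded holomorphic mapping, and let $\omega_{n,f}=\omega_n+f^*\omega_d$ be the $1$-modification of the Fubini-Study metric $\omega_n$ induced by $f$. Then there are an integer $m$ and a minimally embedded holomorphic mapping $h\colon \Omega\to \mathbb{C}^m\subset \mathbb{C}\mathbb{P}^m$ such that $\omega_{n,f}=h^*\omega_m$ on $\Omega$ or, equivalently, $$\omega_{n}=h^*\omega_m-f^*\omega_d .$$ With the normalization $0\in\Omega$, $f(0)=0$, $h(0)=0$, such a mapping $h$ exists and is unique up to multiplication by a unitary $m\times m$ matrix. Moreover, for every such minimally embedded $h$, the dimension $m$ satisfies the following: (i) If $d\leq n$, then $$n+\sum_{l=0}^{d-1} (n-l)=n(d+1)-\frac{d(d-1)}{2}\leq m\leq dn+n+d=n(d+1)+d.$$ (ii) If $d\geq n$, then $m\geq \max\left(\frac{n(n+3)}{2},d\right)$.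
   Context: $\omega_N$ denotes the $(1,1)$-form associated with the Fubini-Study metric on $\mathbb{C}\mathbb{P}^N$; in affine coordinates $w=(w_1,\ldots,w_N)\in\mathbb{C}^N\subset\mathbb{C}\mathbb{P}^N$ (the affine chart $w\mapsto[1:w]$), $$\omega_N=\frac{\sqrt{-1}}{2\pi}\,\partial\bar\partial\log\Big(1+\sum_{i=1}^N|w_i|^2\Big).$$ For a holomorphic mapping $\phi=(\phi_1,\ldots,\phi_N)\colon\Omega\to\mathbb{C}^N\subset\mathbb{C}\mathbb{P}^N$ on an open set $\Omega\subset\mathbb{C}^n$, $\phi^*\omega_N=\frac{\sqrt{-1}}{2\pi}\partial\bar\partial\log(1+\sum_{i=1}^N|\phi_i(z)|^2)$. The mapping $\phi$ is called minimally embedded if its image $\phi(\Omega)$ is not contained in a proper projective linear subspace of $\mathbb{C}\mathbb{P}^N$; equivalently, $1,\phi_1,\ldots,\phi_N$ are linearly independent over $\mathbb{C}$ (when $0\in\Omega$ and $\phi(0)=0$, this means that $\phi_1,\ldots,\phi_N$ are linearly independent). *)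

(* Defs.v *)
From HB Require Import structures.
From mathcomp Require Import all_boot all_order all_algebra.
From mathcomp Require Import all_classical all_reals all_analysis.
From mathcomp Require Import complex.

Set Implicit Arguments.
Unset Strict Implicit.
Unset Printing Implicit Defensive.

Import Order.TTheory GRing.Theory Num.Theory.
Import numFieldNormedType.Exports.

Local Open Scope classical_set_scope.
Local Open Scope ring_scope.
Local Open Scope complex_scope.

(* MathComp-Analysis puts the topology of the modulus on abstract numFieldTypes
   only, so R[i] needs its own instance before [open] and [connected] can be
   used on sets of row vectors over R[i]. *)
#[warnings="-redundant-canonical-projection"]
HB.instance Definition _ (R : realType) := NormedModule.copy R[i] R[i]^o.

Section Wirtinger.
Variables (R : realType) (n : nat).
Implicit Types (u : 'rV[R[i]]_n -> R[i]) (z v w : 'rV[R[i]]_n) (j : 'I_n).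

(* Derivative along v for a REAL parameter: the library's 'D_v takes the limit
   over complex parameters and would not exist for functions such as |z|^2. *)
Definition rderive u v z : R[i] :=
  derive1 (fun t : R => complex.Re (u (z + t%:C *: v))) 0
    +i* derive1 (fun t : R => complex.Im (u (z + t%:C *: v))) 0.

(* With z_j = x_j + i y_j, the coordinate vector fields d/dx_j and d/dy_j point
   along e_j and i e_j. *)
Definition dz j u z : R[i] :=
  (rderive u (delta_mx 0 j) z - 'i%C * rderive u ('i%C *: delta_mx 0 j) z) / 2.

Definition dzbar j u z : R[i] :=
  (rderive u (delta_mx 0 j) z + 'i%C * rderive u ('i%C *: delta_mx 0 j) z) / 2.

(* A complex-valued 2-form: base point, then two tangent vectors. *)
Definition form2 := 'rV[R[i]]_n -> 'rV[R[i]]_n -> 'rV[R[i]]_n -> R[i].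

(* \sum_(j, k) (d^2 u / dz_j dzbar_k) dz_j /\ dzbar_k, where
   (dz_j /\ dzbar_k) (v, w) = v_j conj(w_k) - w_j conj(v_k). *)
Definition ddbar u : form2 := fun z v w =>
  \sum_(j < n) \sum_(k < n)
    dz j (dzbar k u) z * (v 0 j * (w 0 k)^*%C - w 0 j * (v 0 k)^*%C).

Definition eq_form_on (Omega : set 'rV[R[i]]_n) (a b : form2) :=
  forall z, Omega z -> forall v w, a z v w = b z v w.

End Wirtinger.

Section FubiniStudy.
Variable R : realType.

Definition sqnorm N (w : 'rV[R[i]]_N) : R :=
  \sum_(i < N) (complex.Re (w 0 i) ^+ 2 + complex.Im (w 0 i) ^+ 2).

Definition fubini_study N : form2 R N := fun w u v =>
  'i%C / (2 * pi)%:C * ddbar (fun x => (ln (1 + sqnorm x))%:C) w u v.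
Arguments fubini_study : clear implicits.

Definition pullback n N (phi : 'rV[R[i]]_n -> 'rV[R[i]]_N) (a : form2 R N) :
    form2 R n :=
  fun z u v => a (phi z) ('d phi z u) ('d phi z v).

Definition add_form n (a b : form2 R n) : form2 R n :=
  fun z u v => a z u v + b z u v.

Definition sub_form n (a b : form2 R n) : form2 R n :=
  fun z u v => a z u v - b z u v.

Definition modification n d (f : 'rV[R[i]]_n -> 'rV[R[i]]_d) : form2 R n :=
  add_form (fubini_study n) (pullback f (fubini_study d)).

(* [differentiable] is Frechet differentiability over the base field of the
   normed modules, here R[i]. *)
Definition holomorphic n N (Omega : set 'rV[R[i]]_n)
    (phi : 'rV[R[i]]_n -> 'rV[R[i]]_N) :=
  forall z, Omega z -> differentiable phi z.

(* The projective linear subspaces of CP^N are the P(V) for V a linear subspace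
   of C^(1 + N); [1 : phi z] lies in P(V) iff the row (1, phi z) lies in V. *)
Definition minimally_embedded n N (Omega : set 'rV[R[i]]_n)
    (phi : 'rV[R[i]]_n -> 'rV[R[i]]_N) :=
  forall V : {vspace 'rV[R[i]]_(1 + N)},
    (forall z, Omega z -> row_mx (const_mx 1) (phi z) \in V) -> V = fullv.

Definition induces_modification n d m (Omega : set 'rV[R[i]]_n)
    (f : 'rV[R[i]]_n -> 'rV[R[i]]_d) (h : 'rV[R[i]]_n -> 'rV[R[i]]_m) :=
  [/\ holomorphic Omega h, minimally_embedded Omega h &
      eq_form_on Omega (modification f) (pullback h (fubini_study m))].

End FubiniStudy.

Arguments fubini_study : clear implicits.

(* Main.v *)
(* Composing (z, f z) with the Segre map gives a holomorphic map G whose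
   coordinates are the products of those of (1, z) and (1, f z), and
   omega_n + f^* omega_d is the pullback of the Fubini-Study form by G. Restricting
   G to the linear span of its values, and rotating by a unitary matrix so that
   one coordinate becomes constant, yields h.

   Calabi's rigidity: if H and K induce the same form, then log |H|^2 - log |K|^2
   is pluriharmonic, so by polarization <H z, H w> and <K z, K w> agree up to a
   function of z times a function of w, near any point. Hence the Gram matrices of
   H and K have equal ranks, which shows that 1 + m is the dimension of the span of
   the values of G, and when h 0 = 0 the kernels agree exactly, which gives the
   unitary matrix.

   This dimension is at most (1 + n)(1 + d). For the lower bounds pick k of the
   independent functions 1, f_1, ..., f_d, where k = 1 + min (n, d). The linear
   relations between the products of these with 1, z_1, ..., z_n are the affine
   syzygies of the k functions, and they form a space of dimension at most
   k (k - 1) / 2. *)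
Require Import Defs.
From HB Require Import structures.
From mathcomp Require Import all_boot all_order all_algebra.
From mathcomp Require Import all_classical all_reals all_analysis.
From mathcomp Require Import complex ring lra zify.

Set Implicit Arguments.
Unset Strict Implicit.
Unset Printing Implicit Defensive.

Import Order.TTheory GRing.Theory Num.Theory.
Import numFieldNormedType.Exports.

Local Open Scope classical_set_scope.
Local Open Scope ring_scope.
Local Open Scope complex_scope.

(** * Complex derivatives and the Cauchy formula on a square *)

(** Holomorphy is given as bare complex differentiability, while rigidity compares forms built from
    first derivatives and must continue them analytically. So the derivatives have to be shown
    holomorphic, which is what Goursat's theorem and a Cauchy formula are for. A square replaces the
    disc because its boundary integral consists of four integrals over intervals. Statements in
    several variables are reduced to complex lines, or to planes with two complex parameters, so
    that one-variable theory suffices; each passage costs a constant factor of the radius, whence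
    constants such as 3, 6, 8 and 64. Rigidity avoids logarithms: the equality of mixed derivatives
    of log is cleared of denominators, and the resulting separation of variables is the equality of
    two products of four kernel values, normalized at a base point. The map [h] comes from a
    similarity rather than an isometry: the scale is the freedom that makes the constant coordinate
    equal to 1, and the Fubini-Study form does not see it. *)

Section ComplexBasics.
Variable R : realType.
Local Notation C := (R[i]).
(* The modulus as a real number: the library's norm of z : R[i] lies in R[i]. *)
Local Notation nm := (@Normc.normc R).
Implicit Types (z w : C) (g : C -> C) (e r : R).

Lemma normcE z : `|z| = (nm z)%:C. Proof. by []. Qed.
Lemma nm_ge0 z : 0 <= nm z. Proof. by rewrite -ler0c -normcE. Qed.
Lemma nm0 : nm 0 = 0. Proof. exact: Normc.normc0. Qed.
Lemma nmM z w : nm (z * w) = nm z * nm w. Proof. exact: Normc.normcM. Qed.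
Lemma nmV z : nm z^-1 = (nm z)^-1. Proof. exact: Normc.normcV. Qed.
Lemma nmN z : nm (- z) = nm z. Proof. exact: normcN. Qed.
Lemma nmD z w : nm (z + w) <= nm z + nm w. Proof. exact: le_normcD. Qed.
Lemma nmB z w : nm (z - w) = nm (w - z). Proof. by rewrite -nmN opprB. Qed.
Lemma nmC e : nm e%:C = `|e|.
Proof. by rewrite /= expr0n addr0 sqrtr_sqr. Qed.
Lemma nmi : nm 'i%C = 1.
Proof. by rewrite /= expr0n expr1n add0r sqrtr1. Qed.
Lemma nm_eq0 z : (nm z == 0) = (z == 0).
Proof. by rewrite -[RHS]normr_eq0 normcE -(inj_eq (@complexI R)). Qed.
Lemma nm_gt0 z : (0 < nm z) = (z != 0).
Proof. by rewrite lt_def nm_ge0 andbT nm_eq0. Qed.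
Lemma nm_Re z : `|complex.Re z| <= nm z.
Proof. by rewrite -lecR; exact: normc_ge_Re. Qed.
Lemma nm_Im z : `|complex.Im z| <= nm z.
Proof.
rewrite -[leLHS]normrN -ReiNIm; apply: le_trans (nm_Re _) _.
by rewrite nmM nmi mulr1.
Qed.
Lemma nm_le z : nm z <= `|complex.Re z| + `|complex.Im z|.
Proof.
rewrite {1}(complexE z); apply: le_trans (nmD _ _) _.
by rewrite nmM nmi mul1r !nmC.
Qed.
Lemma nm_conj z : nm z^*%C = nm z.
Proof. by apply: (@complexI R); rewrite -!normcE normcJ. Qed.

(** Used to trade the [R[i]]-valued radii of the norm topology for real ones; the order of [R[i]]
    only compares numbers with equal imaginary parts. *)
Lemma posCP (e : C) : 0 < e -> exists2 r, 0 < r & e = r%:C.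
Proof.
case: e => a b; rewrite ltcE /= => /andP[/eqP-> a0]; by exists a.
Qed.

Lemma nm_near z (P : C -> Prop) :
  (\forall w \near z, P w) <->
  exists2 d : R, 0 < d & forall w, nm (w - z) < d -> P w.
Proof.
split.
  move/nbhs_ballP => -[e /= /posCP[d d0 ->] dP]; exists d => // w wz.
  by apply: dP; rewrite /ball /= -normrN opprB normcE ltcR.
move=> [d d0 dP]; apply/nbhs_ballP; exists d%:C => /=; first by rewrite ltcR.
by move=> w; rewrite /ball /= -normrN opprB normcE ltcR => /dP.
Qed.

(** An explicit first-order estimate with real constants. The inequality is not strict, so [w = z]
    needs no exclusion. *)
Definition cder g z (l : C) := forall e, 0 < e -> exists2 d, 0 < d &
  forall w, nm (w - z) < d -> nm (g w - g z - l * (w - z)) <= e * nm (w - z).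

Lemma is_derive_cder g z l : is_derive (z : C) 1 g l -> cder g z l.
Proof.
move=> [dg <-] e e0.
have eC0 : 0 < e%:C by rewrite ltcR.
have /eqaddoP /(_ _ eC0) := derivable_nbhs dg.
rewrite near_simpl => /nm_near[d d0 dP]; exists d => // w wz.
have := dP (w - z); rewrite subr0 => /(_ wz).
rewrite /= !fctE /= [_%:A]mulr1 subrK !normcE -rmorphM lecR.
by rewrite opprD addrA [_ *: _]mulrC.
Qed.

Lemma cder_is_derive g z l : cder g z l -> is_derive (z : C) 1 g l.
Proof.
move=> H.
have cv : (fun h => h^-1 *: ((g \o shift z) (h *: 1) - g z)) @ 0^' --> (l : C).
  apply/cvgrPdist_le => e /posCP[r r0 ->].
  have [d d0 dP] := H _ r0.
  rewrite near_withinE; apply/nm_near; exists d => // h; rewrite subr0 => hd h0.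
  rewrite normcE lecR /= [_%:A]mulr1 -nmN.
  have nh : 0 < nm h by rewrite nm_gt0.
  have := dP (h + z); rewrite addrK => /(_ hd).
  rewrite -ler_pdivrMr // -nmV -nmM => /(le_trans _); apply.
  rewrite le_eqVlt; apply/orP; left; apply/eqP; congr nm.
  by rewrite opprB mulrBl mulfK // mulrC [_ *: _]mulrC mulrC.
by apply: DeriveDef; [apply/cvg_ex; exists l | apply/cvg_lim].
Qed.

Lemma cont_nm g z : {for z, continuous g} <->
  forall e, 0 < e -> exists2 d, 0 < d & forall w, nm (w - z) < d -> nm (g w - g z) < e.
Proof.
split=> H.
  move=> e e0; have eC0 : 0 < e%:C by rewrite ltcR.
  have /cvgrPdist_lt /(_ _ eC0) /nm_near[d d0 dP] := H.
  by exists d => // w /dP; rewrite normcE ltcR nmB.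
apply/(@cvgrPdist_lt _ _ _ _ (nbhs_filter z)) => e /posCP[r r0 ->].
have [d d0 dP] := H _ r0; apply/nm_near; exists d => // w /dP.
by rewrite normcE ltcR nmB.
Qed.

Lemma cder_cont g z l : cder g z l -> {for z, continuous g}.
Proof.
move=> /cder_is_derive[+ _].
by move=> /derivable1_diffP /differentiable_continuous.
Qed.

Lemma cder_unique g z l l' : cder g z l -> cder g z l' -> l = l'.
Proof.
move=> /cder_is_derive H /cder_is_derive H'.
by rewrite -(@derive_val _ _ _ _ _ _ _ H) (@derive_val _ _ _ _ _ _ _ H').
Qed.

Lemma cder_cst (c z : C) : cder (fun=> c) z 0.
Proof. exact: (is_derive_cder (is_derive_cst _ _ _)). Qed.

Lemma cder_id z : cder id z 1.
Proof. exact: (is_derive_cder (is_derive_id _ _)). Qed.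

Lemma cderD g h z a b : cder g z a -> cder h z b -> cder (fun x => g x + h x) z (a + b).
Proof.
move=> /cder_is_derive H /cder_is_derive H'.
exact: (is_derive_cder (@is_deriveD _ _ _ _ _ _ _ _ _ H H')).
Qed.

Lemma cderN g z a : cder g z a -> cder (fun x => - g x) z (- a).
Proof. move=> /cder_is_derive H.
exact: (is_derive_cder (@is_deriveN _ _ _ _ _ _ _ H)).
Qed.

Lemma cderB g h z a b : cder g z a -> cder h z b -> cder (fun x => g x - h x) z (a - b).
Proof. by move=> H H'; apply: cderD H _; apply: cderN. Qed.

Lemma cderM g h z a b : cder g z a -> cder h z b ->
  cder (fun x => g x * h x) z (a * h z + g z * b).
Proof.
move=> /cder_is_derive H /cder_is_derive H'.
have := is_derive_cder (@is_deriveM _ _ _ _ _ _ _ _ H H').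
by rewrite addrC /GRing.scale /= [h z * a]mulrC.
Qed.

Lemma cderZ (c : C) g z a : cder g z a -> cder (fun x => c * g x) z (c * a).
Proof.
by move=> H; have := cderM (cder_cst c z) H; rewrite mul0r add0r.
Qed.

Lemma cderV g z a : g z != 0 -> cder g z a -> cder (fun x => (g x)^-1) z (- a / g z ^+ 2).
Proof.
move=> g0 /cder_is_derive H; apply: is_derive_cder.
have [d1 d2] := H.
apply: DeriveDef; first exact: derivableV.
by rewrite deriveV // d2 [_ *: _]mulrC !mulNr mulrN.
Qed.

Lemma cder_div g h z a b : h z != 0 -> cder g z a -> cder h z b ->
  cder (fun x => g x / h x) z ((a * h z - g z * b) / h z ^+ 2).
Proof.
move=> h0 G H; have := cderM G (cderV h0 H); congr cder.
by field.
Qed.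

Lemma cder_comp g h z a b : cder g (h z) a -> cder h z b -> cder (g \o h) z (a * b).
Proof.
move=> G H e e0.
have a0 : 0 < nm a + 1 by rewrite ltr_wpDl ?nm_ge0.
have b0 : 0 < nm b + 1 by rewrite ltr_wpDl ?nm_ge0.
have [d1 d10 G1] := G (e / (2 * (nm b + 1))) ltac:(by rewrite divr_gt0 ?mulr_gt0).
(* The cap 1 makes [h] Lipschitz near [z] with constant [nm b + 1]; the other bound absorbs the
   factor [a]. *)
pose e2 := Num.min 1 (e / (2 * (nm a + 1))).
have e20 : 0 < e2 by rewrite lt_min ltr01 divr_gt0 ?mulr_gt0.
have [d2 d20 H2] := H _ e20.
exists (Num.min d2 (d1 / (nm b + 1))); first by rewrite lt_min d20 divr_gt0.
move=> w; rewrite lt_min => /andP[wd2 wd1].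
have {}H2 := H2 w wd2.
have hh : nm (h w - h z) <= (nm b + 1) * nm (w - z).
  rewrite -[h w - h z](subrK (b * (w - z))).
  apply: le_trans (nmD _ _) _; rewrite mulrDl mul1r addrC nmM lerD2l.
  apply: le_trans H2 _; rewrite -[leRHS]mul1r ler_wpM2r ?nm_ge0 //.
  by rewrite ge_min lexx.
have -> : (g \o h) w - (g \o h) z - a * b * (w - z) =
   (g (h w) - g (h z) - a * (h w - h z)) + a * (h w - h z - b * (w - z)).
  by rewrite /=; ring.
apply: le_trans (nmD _ _) _; rewrite nmM.
have H1 : nm (g (h w) - g (h z) - a * (h w - h z)) <= e / 2 * nm (w - z).
  apply: le_trans (G1 _ _) _.
    by apply: le_lt_trans hh _; rewrite mulrC -ltr_pdivlMr.
  apply: le_trans (ler_wpM2l _ hh) _; first by rewrite divr_ge0 ?mulr_ge0 ?ltW.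
  rewrite le_eqVlt; apply/orP; left; apply/eqP.
  by field; rewrite gt_eqF.
have H3 : nm a * nm (h w - h z - b * (w - z)) <= e / 2 * nm (w - z).
  apply: le_trans (_ : (nm a + 1) * (e2 * nm (w - z)) <= _).
    by apply: ler_pM; rewrite ?nm_ge0 // lerDl.
  rewrite mulrA ler_wpM2r ?nm_ge0 // mulrC -ler_pdivlMr //.
  by rewrite ge_min; apply/orP; right; rewrite invfM mulrA.
by apply: le_trans (lerD H1 H3) _; rewrite -mulrDl -splitr.
Qed.

Lemma cder_line g (p v z : C) a : cder g (p + z * v) a -> cder (fun t => g (p + t * v)) z (a * v).
Proof.
move=> G; apply: (@cder_comp g (fun t => p + t * v)) => //.
have := cderD (cder_cst p z) (cderM (cder_id z) (cder_cst v z)).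
by congr cder; rewrite mul1r mulr0 addr0 add0r.
Qed.

Lemma cder_near g h z a : (exists2 d, 0 < d & forall w, nm (w - z) < d -> g w = h w) ->
  cder g z a -> cder h z a.
Proof.
move=> [d d0 dP] G e e0; have [d' d'0 G'] := G e e0.
exists (Num.min d d'); first by rewrite lt_min d0.
move=> w; rewrite lt_min => /andP[/dP <- /G'].
by rewrite (dP z) // subrr nm0.
Qed.

Lemma contB g h z : {for z, continuous g} -> {for z, continuous h} ->
  {for z, continuous (fun w => g w - h w)}.
Proof. by move=> cg ch; exact: (cvgB cg ch). Qed.

Lemma contM g h z : {for z, continuous g} -> {for z, continuous h} ->
  {for z, continuous (fun w => g w * h w)}.
Proof. by move=> cg ch; exact: (cvgM cg ch). Qed.

End ComplexBasics.

(** * Integrals of complex functions over intervals and rectangle boundaries *)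

Section ComplexIntegral.
Variable R : realType.
Local Notation C := (R[i]).
Local Notation nm := (@Normc.normc R).
Local Notation mu := (@lebesgue_measure R).
Implicit Types (a b c d e : R) (u v : R -> C).

Definition ccont a b u := forall t, a <= t <= b -> forall e, 0 < e ->
  exists2 d, 0 < d & forall s, a <= s <= b -> `|s - t| < d -> nm (u s - u t) < e.

Definition cint a b u : C :=
  (\int[mu]_(t in `[a, b]) complex.Re (u t)) +i* (\int[mu]_(t in `[a, b]) complex.Im (u t)).

Lemma ccont_integrable a b u : ccont a b u ->
  mu.-integrable `[a, b] (EFin \o (fun t => complex.Re (u t))) /\
  mu.-integrable `[a, b] (EFin \o (fun t => complex.Im (u t))).
Proof.
move=> cu; split; apply: continuous_compact_integrable; try exact: segment_compact.
  apply/subspace_continuousP => t /=; rewrite in_itv /= => tab.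
  apply/cvgrPdist_lt => e e0; have [d d0 dP] := cu t tab e e0.
  rewrite near_withinE; near=> s => /=; rewrite in_itv /= => sab.
  rewrite distrC -raddfB /=; apply: le_lt_trans (nm_Re _) _; apply: dP => //.
apply/subspace_continuousP => t /=; rewrite in_itv /= => tab.
apply/cvgrPdist_lt => e e0; have [d d0 dP] := cu t tab e e0.
rewrite near_withinE; near=> s => /=; rewrite in_itv /= => sab.
rewrite distrC -raddfB /=; apply: le_lt_trans (nm_Im _) _; apply: dP => //.
Unshelve. all: by end_near. Qed.

Lemma ccont_cst a b (k : C) : ccont a b (fun=> k).
Proof. by move=> t _ e e0; exists 1 => // s _ _; rewrite subrr nm0. Qed.

Lemma ccontD a b u v : ccont a b u -> ccont a b v -> ccont a b (fun t => u t + v t).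
Proof.
move=> cu cv t tab e e0; have e20 : 0 < e / 2 by rewrite divr_gt0.
have [d1 d10 h1] := cu t tab _ e20; have [d2 d20 h2] := cv t tab _ e20.
exists (Num.min d1 d2); first by rewrite lt_min d10.
move=> s sab; rewrite lt_min => /andP[s1 s2].
rewrite [e]splitr opprD addrACA; apply: le_lt_trans (nmD _ _) _.
by apply: ltrD; [exact: h1|exact: h2].
Qed.

Lemma ccontZ a b (k : C) u : ccont a b u -> ccont a b (fun t => k * u t).
Proof.
move=> cu t tab e e0.
have k0 : 0 < nm k + 1 by rewrite ltr_wpDl ?nm_ge0.
have [d d0 h] := cu t tab (e / (nm k + 1)) ltac:(by rewrite divr_gt0).
exists d => // s sab sd; rewrite -mulrBr nmM.
have := h s sab sd; rewrite ltr_pdivlMr // => /(le_lt_trans _); apply.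
by rewrite mulrC ler_wpM2l ?nm_ge0 // lerDl.
Qed.

Lemma ccontN a b u : ccont a b u -> ccont a b (fun t => - u t).
Proof.
move=> /(ccontZ (-1)) h t /h {}h e /h[d d0 H]; exists d => // s + /H {}H.
by move=> /H; rewrite !mulN1r.
Qed.

Lemma ccontB a b u v : ccont a b u -> ccont a b v -> ccont a b (fun t => u t - v t).
Proof. by move=> cu /ccontN; exact: ccontD. Qed.

Lemma cintD a b u v : ccont a b u -> ccont a b v ->
  cint a b (fun t => u t + v t) = cint a b u + cint a b v.
Proof.
move=> /ccont_integrable[ur ui] /ccont_integrable[vr vi]; rewrite /cint.
rewrite -[RHS]/((_ + _) +i* (_ + _)) -!RintegralD //.
by congr Complex; apply: eq_Rintegral => t _; case: (u t) (v t) => ? ? [].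
Qed.

Lemma cintZ a b (k : C) u : ccont a b u -> cint a b (fun t => k * u t) = k * cint a b u.
Proof.
move=> /ccont_integrable[ur ui]; rewrite /cint.
case: k => x y; rewrite -[RHS]/((_ - _) +i* (_ + _)) -!RintegralZl //.
rewrite -RintegralB -?RintegralD //; first last.
- exact: (integrableZl _ y ui).
- exact: (integrableZl _ x ur).
- exact: (integrableZl _ y ur).
- exact: (integrableZl _ x ui).
by congr Complex; apply: eq_Rintegral => t _; case: (u t).
Qed.

Lemma cintN a b u : ccont a b u -> cint a b (fun t => - u t) = - cint a b u.
Proof.
by move=> /(cintZ (-1)) h; rewrite -mulN1r -h; congr cint; apply/funext => t; rewrite mulN1r.
Qed.

Lemma cintB a b u v : ccont a b u -> ccont a b v ->
  cint a b (fun t => u t - v t) = cint a b u - cint a b v.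
Proof. by move=> cu cv; rewrite cintD ?cintN //; exact: ccontN. Qed.

Lemma eq_cint a b u v : (forall t, a <= t <= b -> u t = v t) -> cint a b u = cint a b v.
Proof.
move=> uv; congr Complex; apply: eq_Rintegral => t;
  by rewrite inE /= in_itv /= => /uv ->.
Qed.

Lemma cint_cst a b (k : C) : a <= b -> cint a b (fun=> k) = k * (b - a)%:C.
Proof.
move=> ab; rewrite /cint !Rintegral_cst //= lebesgue_measure_itv /= lte_fin.
case: k => x y /=; rewrite -[RHS]/((_ - _) +i* (_ + _)) !mulr0 subr0 add0r.
case: ltP => [//|ba]; have -> : b = a by apply/eqP; rewrite eq_le ab ba.
by rewrite subrr.
Qed.

Lemma cint_split a b c u : a <= b -> b <= c -> ccont a c u ->
  cint a c u = cint a b u + cint b c u.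
Proof.
move=> ab bc /ccont_integrable[ur ui]; rewrite /cint -[RHS]/((_ + _) +i* (_ + _)).
have E f : mu.-integrable `[a, c] (EFin \o f) ->
    \int[mu]_(t in `[a, c]) f t = \int[mu]_(t in `[a, b]) f t + \int[mu]_(t in `[b, c]) f t.
  move=> fi; have := Rintegral_itvB fi (x := b); rewrite !bnd_simp => /(_ ab bc).
  rewrite Rintegral_itv_obnd_cbnd; last first.
    by apply: integrableS fi => //; apply: subset_itvr; rewrite bnd_simp.
  by move=> <-; rewrite addrC subrK.
by rewrite !E.
Qed.

(** Multiplication by [i] carries this over to real parts, so the modulus bound and the positivity
    of the winding integral both rest on this one estimate. *)
Lemma Im_cint_ge a b u m : a <= b -> ccont a b u ->
  (forall t, a <= t <= b -> m <= complex.Im (u t)) -> m * (b - a) <= complex.Im (cint a b u).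
Proof.
move=> ab cu h.
have := cint_cst (0 +i* m) ab; rewrite /cint /= => -[_].
rewrite mul0r add0r => <-; apply: le_Rintegral => //.
- by have [] := ccont_integrable (@ccont_cst a b (0 +i* m)).
- by have [] := ccont_integrable cu.
Qed.

(** The factor 2 is lost by bounding the real and imaginary parts separately; later uses tolerate
    any constant. *)
Lemma cint_le a b u M : a <= b -> ccont a b u ->
  (forall t, a <= t <= b -> nm (u t) <= M) -> nm (cint a b u) <= 2 * M * (b - a).
Proof.
move=> ab cu h; apply: le_trans (nm_le _) _.
have H m v : (forall t, a <= t <= b -> `|complex.Im (v t)| <= m) -> ccont a b v ->
    `|complex.Im (cint a b v)| <= m * (b - a).
  move=> mv cv; rewrite ler_norml; apply/andP; split.
    rewrite -mulNr; apply: Im_cint_ge => // t /mv.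
    by rewrite ler_norml => /andP[].
  rewrite -lerN2 -raddfN -cintN //.
  rewrite -mulNr; apply: Im_cint_ge => //; first exact: ccontN.
  by move=> t /mv; rewrite raddfN lerN2 ler_norml => /andP[].
rewrite -mulrA mulr_natl mulr2n; apply: lerD.
  rewrite -[complex.Re _]ImiRe mulrC -cintZ //.
  apply: H; last exact: ccontZ.
  by move=> t tab; rewrite mulrC ImiRe (le_trans (nm_Re _)) ?h.
by apply: H => // t tab; rewrite (le_trans (nm_Im _)) ?h.
Qed.

End ComplexIntegral.

Section RectangleIntegral.
Variable R : realType.
Local Notation C := (R[i]).
Local Notation nm := (@Normc.normc R).
Implicit Types (a b c d e x y : R) (q : C -> C).

(* The integral of q dz along the counterclockwise boundary of [a, b] x [c, d]. *)
Definition rI q a b c d : C :=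
  cint a b (fun x => q (x +i* c) - q (x +i* d)) +
  'i%C * cint c d (fun y => q (b +i* y) - q (a +i* y)).

Definition bdry (P : C -> Prop) a b c d :=
  (forall x, a <= x <= b -> P (x +i* c) /\ P (x +i* d)) /\
  (forall y, c <= y <= d -> P (a +i* y) /\ P (b +i* y)).

Lemma bdry_imp (P Q : C -> Prop) a b c d : (forall z, P z -> Q z) ->
  bdry P a b c d -> bdry Q a b c d.
Proof.
by move=> PQ [hx hy]; split=> x xab; [have [] := hx x xab | have [] := hy x xab];
  split; apply: PQ.
Qed.

Lemma bdry_and (P Q : C -> Prop) a b c d :
  bdry P a b c d -> bdry Q a b c d -> bdry (fun z => P z /\ Q z) a b c d.
Proof.
move=> [hx hy] [kx ky]; split=> x xab.
  by have [] := hx x xab; have [] := kx x xab.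
by have [] := hy x xab; have [] := ky x xab.
Qed.

Local Notation conto q := (fun z : C => {for z, continuous q}).

Lemma conto_nm q z : {for z, continuous q} ->
  forall e, 0 < e -> exists2 d, 0 < d & forall w, nm (w - z) < d -> nm (q w - q z) < e.
Proof. by move=> /cont_nm. Qed.

Lemma ccont_h q a b c : (forall x, a <= x <= b -> {for x +i* c, continuous q}) ->
  ccont a b (fun x => q (x +i* c)).
Proof.
move=> h t /h /conto_nm H e /H[d d0 dP]; exists d => // s _ st; apply: dP.
by rewrite -[_ - _]/((_ - _) +i* (_ - _)) subrr nmC.
Qed.

Lemma ccont_v q a b c : (forall x, a <= x <= b -> {for c +i* x, continuous q}) ->
  ccont a b (fun x => q (c +i* x)).
Proof.
move=> h t /h /conto_nm H e /H[d d0 dP]; exists d => // s _ st; apply: dP.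
rewrite -[_ - _]/((_ - _) +i* (_ - _)) subrr.
by rewrite /= expr0n add0r sqrtr_sqr.
Qed.

Lemma bdry_ccont q a b c d : bdry (conto q) a b c d ->
  [/\ ccont a b (fun x => q (x +i* c)), ccont a b (fun x => q (x +i* d)),
      ccont c d (fun x => q (a +i* x)) & ccont c d (fun x => q (b +i* x))].
Proof.
move=> [hx hy]; split.
- by apply: ccont_h => x /hx[].
- by apply: ccont_h => x /hx[].
- by apply: ccont_v => x /hy[].
- by apply: ccont_v => x /hy[].
Qed.

Lemma rID q r a b c d : bdry (conto q) a b c d -> bdry (conto r) a b c d ->
  rI (fun z => q z + r z) a b c d = rI q a b c d + rI r a b c d.
Proof.
move=> /bdry_ccont[q1 q2 q3 q4] /bdry_ccont[r1 r2 r3 r4].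
by rewrite /rI !(cintB,cintD) //; try (exact: ccontD); ring.
Qed.

Lemma rIZ q k a b c d : bdry (conto q) a b c d ->
  rI (fun z => k * q z) a b c d = k * rI q a b c d.
Proof.
move=> /bdry_ccont[q1 q2 q3 q4].
by rewrite /rI !(cintB,cintZ) //; try (exact: ccontZ); ring.
Qed.

Lemma rIB q r a b c d : bdry (conto q) a b c d -> bdry (conto r) a b c d ->
  rI (fun z => q z - r z) a b c d = rI q a b c d - rI r a b c d.
Proof.
move=> /bdry_ccont[q1 q2 q3 q4] /bdry_ccont[r1 r2 r3 r4].
by rewrite /rI !(cintB) //; try (exact: ccontB); ring.
Qed.

Lemma eq_rI q r a b c d : bdry (fun z => q z = r z) a b c d ->
  rI q a b c d = rI r a b c d.
Proof.
move=> [hx hy]; congr (_ + _ * _); apply: eq_cint => t tab.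
  by have [-> ->] := hx t tab.
by have [-> ->] := hy t tab.
Qed.

(** On each pair of opposite sides the difference of values is constant, and the two contributions
    [l * i * (c - d) * (b - a)] and [i * l * (b - a) * (d - c)] cancel. *)
Lemma rI_affine (k l : C) a b c d : a <= b -> c <= d ->
  rI (fun z => k + l * z) a b c d = 0.
Proof.
move=> ab cd; rewrite /rI.
rewrite (@eq_cint _ a b _ (fun=> l * (0 +i* (c - d)))); last first.
  move=> x _; rewrite opprD addrACA subrr add0r -mulrBr; congr (_ * _).
  by rewrite -[LHS]/((_ - _) +i* (_ - _)) subrr.
rewrite (@eq_cint _ c d _ (fun=> l * (b - a)%:C)); last first.
  move=> x _; rewrite opprD addrACA subrr add0r -mulrBr; congr (_ * _).
  by rewrite -[LHS]/((_ - _) +i* (_ - _)) subrr.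
rewrite !cint_cst //; have -> : 0 +i* (c - d) = 'i%C * (c - d)%:C.
  by rewrite -[RHS]/((_ - _) +i* (_ + _)) !mul0r mulr0 mul1r subrr add0r.
by rewrite !rmorphB /=; ring.
Qed.

Lemma rI_le q a b c d M : a <= b -> c <= d -> bdry (conto q) a b c d ->
  bdry (fun z => nm (q z) <= M) a b c d ->
  nm (rI q a b c d) <= 4 * M * ((b - a) + (d - c)).
Proof.
move=> ab cd /bdry_ccont[q1 q2 q3 q4] [hx hy].
apply: le_trans (nmD _ _) _; rewrite nmM nmi mul1r mulrDr.
have -> : 4 * M = 2 * (M + M) by ring.
apply: lerD; apply: cint_le => //; try exact: ccontB.
  by move=> t /hx[h1 h2]; apply: le_trans (nmD _ _) _; rewrite nmN lerD.
by move=> t /hy[h1 h2]; apply: le_trans (nmD _ _) _; rewrite nmN lerD.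
Qed.

Lemma rI_splitx q a b c d e : a <= e -> e <= b ->
  bdry (conto q) a e c d -> bdry (conto q) e b c d ->
  rI q a b c d = rI q a e c d + rI q e b c d.
Proof.
move=> ae eb B1 B2.
have [p1 p2 p3 p4] := bdry_ccont B1; have [r1 r2 r3 r4] := bdry_ccont B2.
have J x : a <= x <= b -> {for x +i* c, continuous q} /\ {for x +i* d, continuous q}.
  move=> /andP[ax xb]; have [xe|/ltW ex] := leP x e.
    by case: B1 => + _; apply; rewrite ax.
  by case: B2 => + _; apply; rewrite ex.
have c1 : ccont a b (fun x => q (x +i* c)) by apply: ccont_h => x /J[].
have c2 : ccont a b (fun x => q (x +i* d)) by apply: ccont_h => x /J[].
rewrite /rI (cint_split (b := e)) //; last exact: ccontB.
by rewrite !cintB //; ring.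
Qed.

Lemma rI_splity q a b c d e : c <= e -> e <= d ->
  bdry (conto q) a b c e -> bdry (conto q) a b e d ->
  rI q a b c d = rI q a b c e + rI q a b e d.
Proof.
move=> ce ed B1 B2.
have [p1 p2 p3 p4] := bdry_ccont B1; have [r1 r2 r3 r4] := bdry_ccont B2.
have J x : c <= x <= d -> {for a +i* x, continuous q} /\ {for b +i* x, continuous q}.
  move=> /andP[cx xd]; have [xe|/ltW ex] := leP x e.
    by case: B1 => _; apply; rewrite cx.
  by case: B2 => _; apply; rewrite ex.
have c1 : ccont c d (fun x => q (a +i* x)) by apply: ccont_v => x /J[].
have c2 : ccont c d (fun x => q (b +i* x)) by apply: ccont_v => x /J[].
rewrite /rI (cint_split (b := e) (a := c)) //; last exact: ccontB.
by rewrite !cintB //; ring.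
Qed.

Definition rect a b c d (z : C) :=
  [/\ a <= complex.Re z, complex.Re z <= b, c <= complex.Im z & complex.Im z <= d].

Lemma rect_bdry (P : C -> Prop) a b c d : a <= b -> c <= d ->
  (forall z, rect a b c d z -> P z) -> bdry P a b c d.
Proof.
move=> ab cd h; split=> x /andP[x1 x2]; split; apply: h;
  by split=> //=; rewrite ?(le_trans x1).
Qed.

Lemma rect_sub a b c d a' b' c' d' z : a' <= a -> b <= b' -> c' <= c -> d <= d' ->
  rect a b c d z -> rect a' b' c' d' z.
Proof.
move=> h1 h2 h3 h4 [z1 z2 z3 z4]; split; by
  [exact: le_trans z1|exact: le_trans h2|exact: le_trans z3|exact: le_trans h4].
Qed.

Lemma rect_nm a b c d z w : rect a b c d z -> rect a b c d w ->
  nm (z - w) <= (b - a) + (d - c).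
Proof.
move=> [z1 z2 z3 z4] [w1 w2 w3 w4]; apply: le_trans (nm_le _) _.
by apply: lerD; rewrite raddfB /= ler_norml; apply/andP; split; lra.
Qed.

End RectangleIntegral.

Section NestedIntervals.
Variable R : realType.

(** The hypothesis says that the intervals from [x n] to [x n + l / 2 ^+ n] decrease; the supremum
    of the left ends lies in all of them. *)
Lemma nested_point (x : nat -> R) (l : R) : 0 <= l ->
  (forall n, x n <= x n.+1 /\ x n.+1 + l / 2 ^+ n.+1 <= x n + l / 2 ^+ n) ->
  exists y, forall n, x n <= y <= x n + l / 2 ^+ n.
Proof.
move=> l0 h.
have inc m k : x m <= x (m + k)%N.
  elim: k => [|k IH]; first by rewrite addn0.
  by rewrite addnS (le_trans IH) //; have [] := h (m + k)%N.
have dec m k : x (m + k)%N + l / 2 ^+ (m + k) <= x m + l / 2 ^+ m.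
  elim: k => [|k IH]; first by rewrite addn0.
  by rewrite addnS; apply: le_trans IH; have [] := h (m + k)%N.
have ub m k : x k <= x m + l / 2 ^+ m.
  have P j : 0 <= l / 2 ^+ j by rewrite divr_ge0 ?exprn_ge0.
  have [mk|/ltnW km] := leqP m k.
    rewrite -(subnKC mk); apply: le_trans (dec m (k - m)%N).
    by rewrite lerDl.
  rewrite -(subnKC km); apply: le_trans (inc k (m - k)%N) _.
  by rewrite lerDl.
have hs : has_sup (range x).
  split; first by exists (x 0%N); exists 0%N.
  by exists (x 0%N + l / 2 ^+ 0) => _ [k _ <-].
exists (sup (range x)) => n; apply/andP; split.
  by apply: (ub_le_sup hs.2); exists n.
by apply: ge_sup; [case: hs | move=> _ [k _ <-]].
Qed.

End NestedIntervals.

(** * Goursat's theorem by repeated quartering *)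

Section Goursat.
Variable R : realType.
Local Notation C := (R[i]).
Local Notation nm := (@Normc.normc R).
Implicit Types (a b c d e x y : R) (q : C -> C).

Lemma rect_cont q a b c d : a <= b -> c <= d ->
  (forall z, rect a b c d z -> exists l, cder q z l) ->
  bdry (fun z => {for z, continuous q}) a b c d.
Proof. by move=> ab cd h; apply: rect_bdry => // z /h[l /cder_cont]. Qed.

(** The integral is the sum over the four quarters, so one of them carries at least a fourth of its
    modulus. *)
Lemma quarter q a c l m : 0 <= l -> 0 <= m ->
  (forall z, rect a (a + l) c (c + m) z -> exists k, cder q z k) ->
  exists a' c', [/\ (a' = a \/ a' = a + l / 2), (c' = c \/ c' = c + m / 2) &
    nm (rI q a (a + l) c (c + m)) <= 4 * nm (rI q a' (a' + l / 2) c' (c' + m / 2))].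
Proof.
move=> l0 m0 h.
have B a1 b1 c1 d1 : a <= a1 -> a1 <= b1 -> b1 <= a + l -> c <= c1 -> c1 <= d1 -> d1 <= c + m ->
    bdry (fun z => {for z, continuous q}) a1 b1 c1 d1.
  move=> *; apply: rect_cont => // z zr; apply: h; exact: rect_sub zr.
rewrite (rI_splitx (e := a + l / 2)); try apply: B; try lra.
rewrite !(rI_splity (e := c + m / 2) (c := c) (d := c + m)); try apply: B; try lra.
set A1 := rI _ _ _ _ _; set A2 := rI _ _ _ _ _.
set A3 := rI _ _ _ _ _; set A4 := rI _ _ _ _ _.
have E1 : a + l = a + l / 2 + l / 2 by lra.
have E2 : c + m = c + m / 2 + m / 2 by lra.
have T : nm (A1 + A2 + (A3 + A4)) <= nm A1 + nm A2 + (nm A3 + nm A4).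
  by apply: le_trans (nmD _ _) _; apply: lerD; apply: nmD.
have [H1|H1] := leP (nm (A1 + A2 + (A3 + A4))) (4 * nm A1).
  by exists a, c; split; [left|left|].
have [H2|H2] := leP (nm (A1 + A2 + (A3 + A4))) (4 * nm A2).
  by exists a, (c + m / 2); split; [left|right|rewrite -E2].
have [H3|H3] := leP (nm (A1 + A2 + (A3 + A4))) (4 * nm A3).
  by exists (a + l / 2), c; split; [right|left|rewrite -E1].
have [H4|H4] := leP (nm (A1 + A2 + (A3 + A4))) (4 * nm A4).
  by exists (a + l / 2), (c + m / 2); split; [right|right|rewrite -E1 -E2].
exfalso; move: T H1 H2 H3 H4.
by move: (nm _) (nm A1) (nm A2) (nm A3) (nm A4); clear => *; lra.
Qed.

(** Subtracting the affine part of [q] at [z] leaves the integral unchanged and makes the integrand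
    at most [e] times the size of the rectangle. Size and perimeter both shrink like [1 / 2 ^+ n],
    whence [4 ^+ n]. *)
Lemma goursat_pinch q z k (x y : nat -> R) (l m e : R) :
  0 <= l -> 0 <= m -> 0 < e -> cder q z k ->
  (forall n, rect (x n) (x n + l / 2 ^+ n) (y n) (y n + m / 2 ^+ n) z) ->
  (forall n w, rect (x n) (x n + l / 2 ^+ n) (y n) (y n + m / 2 ^+ n) w -> {for w, continuous q}) ->
  exists n, nm (rI q (x n) (x n + l / 2 ^+ n) (y n) (y n + m / 2 ^+ n)) <=
     4 * e * (l + m) ^+ 2 / 4 ^+ n.
Proof.
move=> l0 m0 e0 qz zr qc.
have [d d0 dP] := qz e e0.
have p2 n : 0 < 2 ^+ n :> R by rewrite exprn_gt0.
have [n nP] : exists n, (l + m) / 2 ^+ n < d.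
  exists (Num.bound ((l + m) / d)); rewrite ltr_pdivrMr // mulrC -ltr_pdivrMr //.
  exact: upper_nthrootP.
exists n; set L := l / 2 ^+ n; set M := m / 2 ^+ n.
have L0 : 0 <= L by rewrite divr_ge0 // ltW.
have M0 : 0 <= M by rewrite divr_ge0 // ltW.
have LM : L + M = (l + m) / 2 ^+ n by rewrite mulrDl.
have xL : x n <= x n + L by rewrite lerDl.
have yM : y n <= y n + M by rewrite lerDl.
have B1 : bdry (fun w => {for w, continuous q}) (x n) (x n + L) (y n) (y n + M).
  by apply: rect_bdry => // w; apply: qc.
have ka w : cder (fun w => (q z - k * z) + k * w) w k.
  have := cderD (cder_cst (q z - k * z) w) (cderZ k (cder_id w)).
  by rewrite add0r mulr1.
have B2 : bdry (fun w => {for w, continuous (fun w => (q z - k * z) + k * w)})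
    (x n) (x n + L) (y n) (y n + M).
  by apply: rect_bdry => // w _; apply: cder_cont (ka w).
have B3 : bdry (fun w => {for w, continuous (fun w => q w - ((q z - k * z) + k * w))})
    (x n) (x n + L) (y n) (y n + M).
  by apply: bdry_imp (bdry_and B1 B2) => w [h1 h2]; apply: contB.
have := rIB B1 B2; rewrite rI_affine // subr0 => <-.
apply: le_trans (rI_le (M := e * (L + M)) xL yM B3 _) _.
  apply: rect_bdry => // w wr.
  have nwz : nm (w - z) <= L + M.
    have e1 (u v : R) : u + v - u = v by ring.
    by have := rect_nm wr (zr n); rewrite !e1.
  have -> : q w - (q z - k * z + k * w) = q w - q z - k * (w - z) by ring.
  apply: le_trans (dP _ _) _; first by rewrite (le_lt_trans nwz) // LM.
  by rewrite ler_wpM2l // ltW.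
have -> : 4 ^+ n = 2 ^+ n * 2 ^+ n :> R by rewrite -exprMn; congr (_ ^+ _); ring.
have -> : x n + L - x n + (y n + M - y n) = (l + m) / 2 ^+ n by rewrite -LM; ring.
rewrite LM le_eqVlt; apply/orP; left; apply/eqP; field.
by rewrite gt_eqF.
Qed.

Lemma goursat q a b c d : a <= b -> c <= d ->
  (forall z, rect a b c d z -> exists l, cder q z l) -> rI q a b c d = 0.
Proof.
move=> ab cd qd.
have [l lE] : exists l, b = a + l by exists (b - a); ring.
have [m mE] : exists m, d = c + m by exists (d - c); ring.
subst b d; have l0 : 0 <= l by move: ab; rewrite lerDl.
have m0 : 0 <= m by move: cd; rewrite lerDl.
have p2 n : 0 < 2 ^+ n :> R by rewrite exprn_gt0.
have L0 n : 0 <= l / 2 ^+ n by rewrite divr_ge0 // ltW.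
have M0 n : 0 <= m / 2 ^+ n by rewrite divr_ge0 // ltW.
have half (u : R) n : u / 2 ^+ n / 2 = u / 2 ^+ n.+1 by rewrite exprSr invfM mulrA.
have H (u u' v lo hi : R) : 0 <= v -> u' = u \/ u' = u + v / 2 -> lo <= u -> u + v <= hi ->
    [/\ lo <= u', u' + v / 2 <= hi, u <= u' & u' + v / 2 <= u + v].
  by clear => v0 uu lou hiu; case: uu => ->; split; lra.
pose good n (s : R * R) := [/\ a <= s.1, s.1 + l / 2 ^+ n <= a + l, c <= s.2 &
  s.2 + m / 2 ^+ n <= c + m].
pose I n (s : R * R) := nm (rI q s.1 (s.1 + l / 2 ^+ n) s.2 (s.2 + m / 2 ^+ n)).
(* Choice needs a total relation, so the subdivision is conditional on [good], with an arbitrary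
   value otherwise. *)
have step (p : nat * (R * R)) : exists s : R * R, good p.1 p.2 ->
    [/\ s.1 = p.2.1 \/ s.1 = p.2.1 + l / 2 ^+ p.1.+1,
        s.2 = p.2.2 \/ s.2 = p.2.2 + m / 2 ^+ p.1.+1 & I p.1 p.2 <= 4 * I p.1.+1 s].
  have [[g1 g2 g3 g4]|] := pselect (good p.1 p.2); last by exists p.2.
  have [|a' [c' [h1 h2 h3]]] := @quarter q p.2.1 p.2.2 _ _ (L0 p.1) (M0 p.1).
    by move=> z zr; apply: qd; apply: rect_sub zr.
  by exists (a', c') => _; rewrite /I /= -!half.
have [f fP] := choice step.
pose s := fix s n := if n is k.+1 then f (k, s k) else (a, c).
have gs n : good n (s n) /\ I 0%N (s 0%N) <= 4 ^+ n * I n (s n).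
  elim: n => [|n [IH1 IH2]].
    by split; [rewrite /good /= expr0 !divr1; split|rewrite expr0 mul1r].
  have [h1 h2 h3] := fP (n, s n) IH1; move: IH1 => [g1 g2 g3 g4].
  rewrite /= -/s -!half in h1 h2 *.
  have [? ? _ _] := H _ _ _ _ _ (L0 n) h1 g1 g2.
  have [? ? _ _] := H _ _ _ _ _ (M0 n) h2 g3 g4.
  split; first by rewrite /good -!half.
  apply: le_trans IH2 _; rewrite exprSr -mulrA ler_wpM2l ?exprn_ge0 //.
have hx n : (s n).1 <= (s n.+1).1 /\ (s n.+1).1 + l / 2 ^+ n.+1 <= (s n).1 + l / 2 ^+ n.
  have [h1 _ _] := fP (n, s n) (gs n).1; rewrite /= -!half in h1 *.
  by have [] := H _ _ _ _ _ (L0 n) h1 (lexx _) (lexx _).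
have hy n : (s n).2 <= (s n.+1).2 /\ (s n.+1).2 + m / 2 ^+ n.+1 <= (s n).2 + m / 2 ^+ n.
  have [_ h1 _] := fP (n, s n) (gs n).1; rewrite /= -!half in h1 *.
  by have [] := H _ _ _ _ _ (M0 n) h1 (lexx _) (lexx _).
have [x xP] := nested_point l0 hx; have [y yP] := nested_point m0 hy.
have zr n : rect (s n).1 ((s n).1 + l / 2 ^+ n) (s n).2 ((s n).2 + m / 2 ^+ n) (x +i* y).
  by have /andP[? ?] := xP n; have /andP[? ?] := yP n.
have rs n w : rect (s n).1 ((s n).1 + l / 2 ^+ n) (s n).2 ((s n).2 + m / 2 ^+ n) w ->
    rect a (a + l) c (c + m) w.
  by have [g1 g2 g3 g4] := (gs n).1; apply: rect_sub.
have [k kP] := qd _ (rs 0%N _ (zr 0%N)).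
apply/eqP; rewrite -nm_eq0 eq_le nm_ge0 andbT; apply/ler_addgt0Pl => e e0.
rewrite addr0.
(* The summand 1 keeps the divisor of [e] nonzero for a degenerate rectangle. *)
have K0 : 0 < 4 * ((l + m) ^+ 2 + 1) by rewrite mulr_gt0 // ltr_wpDl ?sqr_ge0.
have [|n nP] := @goursat_pinch q _ k (fun n => (s n).1) (fun n => (s n).2) l m
    (e / (4 * ((l + m) ^+ 2 + 1))) l0 m0 (divr_gt0 e0 K0) kP zr.
  by move=> n w /rs /qd[l' /cder_cont].
have [_] := gs n; rewrite {1}/I /= expr0 !divr1 => /le_trans; apply.
apply: le_trans (ler_wpM2l _ nP) _; first by rewrite exprn_ge0.
rewrite mulrCA divff ?expf_neq0 // mulr1.
have -> : 4 * (e / (4 * ((l + m) ^+ 2 + 1))) * (l + m) ^+ 2 =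
   e * ((l + m) ^+ 2 / ((l + m) ^+ 2 + 1)).
  by field; rewrite gt_eqF //; move: K0; rewrite pmulr_rgt0.
rewrite ger_pMr // ler_pdivrMr ?mul1r ?lerDl //.
by move: K0; rewrite pmulr_rgt0.
Qed.

End Goursat.

(** * Removable singularities and Cauchy's formula on a square *)

Section CauchyFormula.
Variable R : realType.
Local Notation C := (R[i]).
Local Notation nm := (@Normc.normc R).
Implicit Types (a b c d e x y : R) (q g mu : C -> C) (z w : C).
Local Notation conto q := (fun z : C => {for z, continuous q}).

(** Cut out a small square around [w]. The four surrounding rectangles avoid [w] and contribute 0,
    and the small one contributes at most a multiple of [M] times its perimeter. *)
Lemma goursat_except q w a b c d M d0 :
  a < complex.Re w < b -> c < complex.Im w < d -> 0 < d0 ->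
  (forall z, rect a b c d z -> z != w -> exists l, cder q z l) ->
  (forall z, z != w -> nm (z - w) < d0 -> nm (q z) <= M) -> rI q a b c d = 0.
Proof.
case: w => w1 w2 /= /andP[aw wb] /andP[cw wd] d00 qd qM.
have small x0 x1 y0 y1 : a <= x0 -> x0 < w1 -> w1 < x1 -> x1 <= b ->
    c <= y0 -> y0 < w2 -> w2 < y1 -> y1 <= d -> x1 - x0 + (y1 - y0) < d0 ->
    nm (rI q a b c d) <= 4 * M * (x1 - x0 + (y1 - y0)).
  move=> ax0 x0w wx1 x1b cy0 y0w wy1 y1d xyd.
  have x01 := ltW (lt_trans x0w wx1); have y01 := ltW (lt_trans y0w wy1).
  have ax1 := le_trans ax0 x01; have x0b := le_trans x01 x1b.
  have cy1 := le_trans cy0 y01; have y0d := le_trans y01 y1d.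
  have cd := le_trans cy0 y0d; have ab := le_trans ax0 x0b.
  have G a1 b1 c1 d1 : a <= a1 -> a1 <= b1 -> b1 <= b -> c <= c1 -> c1 <= d1 -> d1 <= d ->
      (b1 < w1 \/ w1 < a1 \/ d1 < w2 \/ w2 < c1) ->
      bdry (conto q) a1 b1 c1 d1 /\ rI q a1 b1 c1 d1 = 0.
    move=> h1 h2 h3 h4 h5 h6 h7.
    have Q z : rect a1 b1 c1 d1 z -> exists l, cder q z l.
      move=> zr; apply: qd; first exact: rect_sub zr.
      apply/eqP => E; move: zr; rewrite E => -[/= k1 k2 k3 k4].
      by case: h7 => [|[|[]]]; rewrite ltNge ?k1 ?k2 ?k3 ?k4.
    by split; [exact: rect_cont|exact: goursat].
  have B a1 b1 c1 d1 : a <= a1 -> a1 <= b1 -> b1 <= b -> c <= c1 -> c1 <= d1 -> d1 <= d ->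
      a1 < w1 < b1 -> c1 < w2 < d1 -> bdry (conto q) a1 b1 c1 d1.
    move=> h1 h2 h3 h4 h5 h6 /andP[h7 h8] /andP[h9 h10].
    have Q z : rect a1 b1 c1 d1 z -> z != w1 +i* w2 -> {for z, continuous q}.
      move=> zr zw; have [|l] := qd z _ zw; first exact: rect_sub zr.
      exact: cder_cont.
    split=> x /andP[x1' x2']; split; apply: Q;
      try (by split=> //=; rewrite ?(le_trans h1) ?(le_trans h4) ?(le_trans x1') ?(le_trans x2'));
      by rewrite eq_complex /= negb_and ?(lt_eqF h7) ?(gt_eqF h8) ?(lt_eqF h9) ?(gt_eqF h10) ?orbT.
  have [b1 z1] := G _ _ _ _ (lexx a) ax0 x0b (lexx c) cd (lexx d) (or_introl x0w).
  have [b2 z2] := G _ _ _ _ ax1 x1b (lexx b) (lexx c) cd (lexx d) (or_intror (or_introl wx1)).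
  have [b3 z3] := G _ _ _ _ ax0 x01 x1b (lexx c) cy0 y0d
    (or_intror (or_intror (or_introl y0w))).
  have [b4 z4] := G _ _ _ _ ax0 x01 x1b cy1 y1d (lexx d)
    (or_intror (or_intror (or_intror wy1))).
  have I1 : x0 < w1 < x1 by rewrite x0w.
  have I2 : y0 < w2 < y1 by rewrite y0w.
  have I3 : x0 < w1 < b by rewrite x0w.
  have I4 : c < w2 < d by rewrite cw.
  have I5 : y0 < w2 < d by rewrite y0w.
  have B1 := B _ _ _ _ ax0 x0b (lexx b) (lexx c) cd (lexx d) I3 I4.
  have B2 := B _ _ _ _ ax0 x01 x1b (lexx c) cd (lexx d) I1 I4.
  have B3 := B _ _ _ _ ax0 x01 x1b cy0 y0d (lexx d) I1 I5.
  have B4 := B _ _ _ _ ax0 x01 x1b cy0 y01 y1d I1 I2.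
  rewrite (rI_splitx ax0 x0b b1 B1) z1 add0r (rI_splitx x01 x1b B2 b2) z2 addr0.
  rewrite (rI_splity cy0 y0d b3 B3) z3 add0r (rI_splity y01 y1d B4 b4) z4 addr0.
  apply: (rI_le x01 y01 B4).
  have rw : rect x0 x1 y0 y1 (w1 +i* w2) by split; apply: ltW.
  have Q z : rect x0 x1 y0 y1 z -> z != w1 +i* w2 -> nm (q z) <= M.
    by move=> zr zw; apply: qM => //; apply: le_lt_trans (rect_nm zr rw) _.
  split=> x /andP[xx xx']; split; apply: Q; try (by split=> /=);
    by rewrite eq_complex /= negb_and ?(lt_eqF x0w) ?(gt_eqF wx1) ?(lt_eqF y0w) ?(gt_eqF wy1) ?orbT.
have [m m0 [m1 m2 m3 m4]] : exists2 m, 0 < m &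
    [/\ m <= w1 - a, m <= b - w1, m <= w2 - c & m <= d - w2].
  exists (Num.min (Num.min (w1 - a) (b - w1)) (Num.min (w2 - c) (d - w2))).
    by rewrite !lt_min !subr_gt0 aw wb cw wd.
  by split; rewrite !ge_min lexx ?orbT.
apply/eqP; rewrite -nm_eq0 eq_le nm_ge0 andbT; apply/ler_addgt0Pl => e e0.
rewrite addr0.
(* With half side [t] the square stays in the rectangle and in the disc where [q] is bounded, and
   the estimate [16 * t * M] is at most [e]. *)
pose t := Num.min m (Num.min (d0 / 8) (e / (16 * (`|M| + 1)))).
have M1 : 0 < `|M| + 1 by rewrite ltr_wpDl.
have t0 : 0 < t by rewrite lt_min m0 lt_min !divr_gt0 // mulr_gt0.
have [tm td te] : [/\ t <= m, t <= d0 / 8 & t <= e / (16 * (`|M| + 1))].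
  by split; rewrite /t ge_min ?lexx ?orbT //; rewrite ge_min lexx ?orbT.
have E : w1 + t - (w1 - t) + (w2 + t - (w2 - t)) = 4 * t by ring.
apply: le_trans (small (w1 - t) (w1 + t) (w2 - t) (w2 + t) _ _ _ _ _ _ _ _ _) _;
  rewrite ?E; try by [clear - t0 tm m1 m2 m3 m4; lra].
- by clear - t0 td d00; lra.
move: te; rewrite ler_pdivlMr ?mulr_gt0 // => /(le_trans _); apply.
have -> : 4 * M * (4 * t) = 16 * t * M by ring.
rewrite mulrA [t * 16]mulrC; apply: ler_wpM2l; first by rewrite mulr_ge0 // ltW.
by rewrite (le_trans (ler_norm M)) // lerDl.
Qed.

Local Notation L u := (rI u (-1) 1 (-1) 1).
Local Notation onS P := (bdry P (-1) 1 (-1) 1).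
Local Notation sq := (rect (-1 : R) 1 (-1) 1).

Lemma N11 : (-1 : R) <= 1. Proof. lra. Qed.

Lemma nm_lt_sq z : nm z < 1 -> sq z.
Proof.
move=> z1; have := nm_Re z; have := nm_Im z; rewrite !ler_norml.
by move=> /andP[? ?] /andP[? ?]; split; lra.
Qed.

Lemma sq_nm z : sq z -> nm z <= 2.
Proof.
move=> [z1 z2 z3 z4]; apply: le_trans (nm_le _) _.
have -> : 2 = 1 + 1 :> R by ring.
by rewrite lerD // ler_norml; apply/andP.
Qed.

Lemma onS_nm : onS (fun z => 1 <= nm z).
Proof.
split=> x _; split.
- by apply: le_trans (nm_Im _); rewrite /= normrN1.
- by apply: le_trans (nm_Im _); rewrite /= normr1.
- by apply: le_trans (nm_Re _); rewrite /= normrN1.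
- by apply: le_trans (nm_Re _); rewrite /= normr1.
Qed.

Lemma onS_imp (P : C -> Prop) : (forall z, sq z -> 1 <= nm z -> P z) -> onS P.
Proof.
move=> H; have B : onS sq by apply: rect_bdry; rewrite ?N11.
by apply: bdry_imp (bdry_and B onS_nm) => z [/H]; apply.
Qed.

Lemma cont_inv z w : z != w -> {for z, continuous (fun u : C => (u - w)^-1)}.
Proof.
move=> zw; apply: (@cder_cont _ _ _ (- (1 - 0) / (z - w) ^+ 2)).
by apply: cderV; [rewrite subr_eq0|apply: cderB; [exact: cder_id|exact: cder_cst]].
Qed.

Lemma onS_cont_inv w : nm w < 1 -> onS (conto (fun u : C => (u - w)^-1)).
Proof.
move=> w1; apply: onS_imp => z _ z1; apply: cont_inv.
by apply/eqP => E; move: w1; rewrite -E ltNge z1.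
Qed.

Lemma onS_contM q g : onS (conto q) -> onS (conto g) -> onS (conto (fun z => q z * g z)).
Proof. by move=> h1 h2; apply: bdry_imp (bdry_and h1 h2) => z [? ?]; apply: contM. Qed.

Lemma ImD z w : complex.Im (z + w) = complex.Im z + complex.Im w.
Proof. exact: raddfD. Qed.
Lemma ImB z w : complex.Im (z - w) = complex.Im z - complex.Im w.
Proof. exact: raddfB. Qed.
Lemma ReB z w : complex.Re (z - w) = complex.Re z - complex.Re w.
Proof. exact: raddfB. Qed.
Lemma ImiM z : complex.Im ('i%C * z) = complex.Re z.
Proof. by rewrite mulrC ImiRe. Qed.

Lemma onS_cst (k : C) : onS (conto (fun=> k)).
Proof. by apply: onS_imp => z _ _; apply: cder_cont (cder_cst k z). Qed.

Lemma Im_inv z : complex.Im z^-1 = - complex.Im z / (complex.Re z ^+ 2 + complex.Im z ^+ 2).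
Proof. by case: z => a b /=; rewrite mulNr. Qed.

Lemma Re_inv z : complex.Re z^-1 = complex.Re z / (complex.Re z ^+ 2 + complex.Im z ^+ 2).
Proof. by case: z. Qed.

(* Cauchy's formula only needs a nonzero value here, not 2 pi i: all four sides
   contribute a positive imaginary part. *)
Lemma winding_neq0 w : nm w < 1 -> L (fun z => (z - w)^-1) != 0.
Proof.
move=> w1; have ci := onS_cont_inv w1.
have [c1 c2 c3 c4] := bdry_ccont ci.
suff : 0 < complex.Im (L (fun z => (z - w)^-1)).
  by move=> H; apply/eqP => E; move: H; rewrite E ltxx.
have [wr wi] : `|complex.Re w| < 1 /\ `|complex.Im w| < 1.
  by split; apply: le_lt_trans w1; [exact: nm_Re|exact: nm_Im].
move: wr wi; rewrite !ltr_norml => /andP[r1 r2] /andP[i1 i2].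
(* A side at distance [y] from [w] contributes an integrand at least [y / 8]. Opposite sides have
   distances [1 + u] and [1 - u], so each pair gives the bound 1/4 used below. *)
have B (x y : R) : `|x| <= 2 -> 0 < y <= 2 -> y / (x ^+ 2 + y ^+ 2) >= y / 8.
  move=> hx /andP[y0 y2]; apply: ler_wpM2l; first exact: ltW.
  have y2p : 0 < y ^+ 2 by rewrite exprn_gt0.
  have x4 : x ^+ 2 <= 4.
    rewrite -real_normK ?num_real // (_ : 4 = 2 ^+ 2); last by rewrite expr2; ring.
    by rewrite lerXn2r ?nnegrE.
  have y4 : y ^+ 2 <= 4.
    rewrite (_ : 4 = 2 ^+ 2); last by rewrite expr2; ring.
    by rewrite lerXn2r ?nnegrE // ltW.
  rewrite lef_pV2 ?posrE //; first by clear -x4 y4; lra.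
  by rewrite ltr_wpDl ?sqr_ge0.
have [cA cB] : ccont (-1) 1 (fun x => (x +i* -1 - w)^-1 - (x +i* 1 - w)^-1) /\
    ccont (-1) 1 (fun x => (1 +i* x - w)^-1 - (-1 +i* x - w)^-1).
  by split; apply: ccontB.
rewrite /rI ImD ImiM.
have hx x : -1 <= x <= 1 -> `|x - complex.Re w| <= 2 /\ `|x - complex.Im w| <= 2.
  by move=> /andP[x1 x2]; split; rewrite ler_norml; apply/andP; split;
    clear -x1 x2 r1 r2 i1 i2; lra.
have hw (u : R) : -1 < u -> u < 1 -> 0 < 1 + u <= 2 /\ 0 < 1 - u <= 2.
  by move=> u1 u2; split; apply/andP; split; clear -u1 u2; lra.
have [hr1 hr2] := hw _ r1 r2; have [hi1 hi2] := hw _ i1 i2.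
have sqN (u v : R) : (- u - v) ^+ 2 = (u + v) ^+ 2 by ring.
have A1 : 1 / 4 * (1 - -1) <=
    complex.Im (cint (-1) 1 (fun x => (x +i* -1 - w)^-1 - (x +i* 1 - w)^-1)).
  apply: (Im_cint_ge N11 cA) => x /hx[xw _].
  rewrite ImB !Im_inv !ReB !ImB /= opprB opprK sqN [_ + 1]addrC.
  have := B _ _ xw hi1; have := B _ _ xw hi2.
  rewrite mulNr opprK.
  by move: ((1 - complex.Im w) / (_ ^+ 2 + _)) ((1 + complex.Im w) / (_ ^+ 2 + _)) => u v *; lra.
have A2 : 1 / 4 * (1 - -1) <=
    complex.Re (cint (-1) 1 (fun x => (1 +i* x - w)^-1 - (-1 +i* x - w)^-1)).
  rewrite -ImiM -cintZ //.
  apply: (Im_cint_ge N11) => [|x /hx[_ xw]]; first exact: ccontZ.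
  rewrite ImiM ReB !Re_inv !ReB !ImB /= sqN.
  have := B _ _ xw hr1; have := B _ _ xw hr2.
  have -> : -1 - complex.Re w = - (1 + complex.Re w) by ring.
  rewrite mulNr opprK ![_ + (x - complex.Im w) ^+ 2]addrC.
  by move: ((1 - complex.Re w) / (_ ^+ 2 + _)) ((1 + complex.Re w) / (_ ^+ 2 + _)) => u v *; lra.
by clear - A1 A2; lra.
Qed.

(** The quotient [(g z - g w) / (z - w)] is bounded near [w] because [g] is differentiable there, so
    [goursat_except] kills its integral. *)
Lemma cauchy_square g w : (forall z, sq z -> exists l, cder g z l) -> nm w < 1 ->
  L (fun z => g z * (z - w)^-1) = g w * L (fun z => (z - w)^-1).
Proof.
move=> gd w1.
have sw := nm_lt_sq w1.
have ci := onS_cont_inv w1.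
have cg : onS (conto g) by apply: rect_cont => //; exact: N11.
have [l gl] := gd w sw.
have [d d0 dP] := gl _ ltr01.
have cd z k : z != w -> cder g z k -> cder (fun u => (g u - g w) * (u - w)^-1) z
    (k * (z - w)^-1 + (g z - g w) * (- 1 / (z - w) ^+ 2)).
  move=> zw gk; apply: cderM.
    by have := cderB gk (cder_cst (g w) z); rewrite subr0.
  have := cderB (cder_id z) (cder_cst w z); rewrite subr0.
  by apply: cderV; rewrite subr_eq0.
have E : L (fun z => (g z - g w) * (z - w)^-1) = 0.
  have [r1 r2 i1 i2] : [/\ -1 < complex.Re w, complex.Re w < 1,
      -1 < complex.Im w & complex.Im w < 1].
    have := le_lt_trans (nm_Re w) w1; have := le_lt_trans (nm_Im w) w1.
    by rewrite !ltr_norml => /andP[-> ->] /andP[-> ->].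
  apply: (@goursat_except _ w _ _ _ _ (1 + nm l) d); rewrite ?r1 ?r2 ?i1 ?i2 //.
    by move=> z sz zw; have [k gk] := gd z sz; eexists; exact: cd gk.
  move=> z zw zd; rewrite nmM nmV ler_pdivrMr ?nm_gt0 ?subr_eq0 //.
  rewrite -[g z - g w](subrK (l * (z - w))); apply: le_trans (nmD _ _) _.
  by rewrite nmM mulrDl mul1r lerD2r -[leRHS]mul1r dP.
have cgw : onS (conto (fun z => g z * (z - w)^-1)) by exact: (onS_contM cg ci).
have cww : onS (conto (fun z => g w * (z - w)^-1)).
  exact: (onS_contM (onS_cst _) ci).
rewrite -(rIZ _ ci); apply/eqP; rewrite -subr_eq0 -(rIB cgw cww) -E; apply/eqP.
by apply: eq_rI; apply: onS_imp => z _ _; rewrite mulrBl.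
Qed.

Lemma cder_quadratic g w l K d : 0 < d ->
  (forall z, nm (z - w) < d -> nm (g z - g w - l * (z - w)) <= K * nm (z - w) ^+ 2) ->
  cder g w l.
Proof.
move=> d0 H e e0.
have K1 : 0 < `|K| + 1 by rewrite ltr_wpDl.
exists (Num.min d (e / (`|K| + 1))); first by rewrite lt_min d0 divr_gt0.
move=> z; rewrite lt_min => /andP[/H zd ze]; apply: le_trans zd _.
rewrite expr2 mulrA ler_wpM2r ?nm_ge0 //.
move: (ltW ze); rewrite ler_pdivlMr // => /(le_trans _); apply.
rewrite mulrC ler_wpM2l ?nm_ge0 //.
by rewrite (le_trans (ler_norm K)) // lerDl.
Qed.

Lemma ccont_bounded a b (u : R -> C) : ccont a b u ->
  exists M, forall t, a <= t <= b -> nm (u t) <= M.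
Proof.
move=> cu; have [ab|ba] := leP a b; last first.
  by exists 0 => t /andP[at1 tb]; have := le_trans at1 tb; rewrite leNgt ba.
have c : {within `[a, b], continuous (fun t => nm (u t))}.
  apply/subspace_continuousP => t /=; rewrite in_itv /= => tab.
  apply/cvgrPdist_lt => e e0; have [d d0 dP] := cu t tab e e0.
  rewrite near_withinE; near=> s => /=; rewrite in_itv /= => sab.
  have D (z w : C) : nm z - nm w <= nm (z - w).
    by rewrite lerBlDr; apply: le_trans (nmD _ _); rewrite subrK.
  have : nm (u s - u t) < e by apply: dP => //.
  apply: le_lt_trans; rewrite ler_norml; apply/andP; split.
    by rewrite lerNl opprB; exact: D.
  by rewrite nmB; exact: D.
have [m _ mP] := EVT_max ab c.
by exists (nm (u m)) => t tab; apply: mP; rewrite in_itv.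
Unshelve. all: by end_near. Qed.

Lemma onS_bounded g : onS (conto g) -> exists2 M, 0 < M & onS (fun z => nm (g z) <= M).
Proof.
move=> /bdry_ccont[/ccont_bounded[M1 h1] /ccont_bounded[M2 h2]
  /ccont_bounded[M3 h3] /ccont_bounded[M4 h4]].
exists (`|M1| + `|M2| + `|M3| + `|M4| + 1).
  by rewrite ltr_wpDl // !addr_ge0.
have [n1 n2 n3 n4] : [/\ M1 <= `|M1|, M2 <= `|M2|, M3 <= `|M3| & M4 <= `|M4|].
  by rewrite !ler_norm.
have [p1 p2 p3 p4] : [/\ 0 <= `|M1|, 0 <= `|M2|, 0 <= `|M3| & 0 <= `|M4|].
  by rewrite !normr_ge0.
move: h1 h2 h3 h4 n1 n2 n3 n4 p1 p2 p3 p4.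
move: `|M1| `|M2| `|M3| `|M4| => m1 m2 m3 m4 h1 h2 h3 h4 *.
split=> x xx; split.
- by apply: le_trans (h1 _ xx) _; clear h1 h2 h3 h4; lra.
- by apply: le_trans (h2 _ xx) _; clear h1 h2 h3 h4; lra.
- by apply: le_trans (h3 _ xx) _; clear h1 h2 h3 h4; lra.
- by apply: le_trans (h4 _ xx) _; clear h1 h2 h3 h4; lra.
Qed.

(** Here 16 is [4 * (2 + 2)], both sides of the square having length 2. *)
Lemma L_le q M : onS (conto q) -> onS (fun z => nm (q z) <= M) -> nm (L q) <= 16 * M.
Proof.
move=> cq qM; apply: le_trans (rI_le N11 N11 cq qM) _.
by rewrite le_eqVlt; apply/orP; left; apply/eqP; ring.
Qed.

End CauchyFormula.

(** * Cauchy transforms, regularity of derivatives and the identity theorem *)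

Section CauchyTransform.
Variable R : realType.
Local Notation C := (R[i]).
Local Notation nm := (@Normc.normc R).
Implicit Types (q g mu : C -> C) (z w : C).
Local Notation conto q := (fun z : C => {for z, continuous q}).
Local Notation L u := (rI u (-1) 1 (-1) 1).
Local Notation onS P := (bdry P (-1) 1 (-1) 1).
Local Notation sq := (rect (-1 : R) 1 (-1) 1).

Lemma onS_sub_nm w : nm w < 1 / 2 -> onS (fun z => 1 / 2 <= nm (z - w)).
Proof.
move=> w1; apply: bdry_imp (onS_nm R) => z z1.
have := nmD (z - w) w; rewrite subrK => h.
by clear -h z1 w1; lra.
Qed.

Lemma nm_inv_le z (r : R) : 0 < r -> r <= nm z -> nm z^-1 <= r^-1.
Proof.
move=> r0 rz; rewrite nmV lef_pV2 ?posrE //.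
exact: lt_le_trans rz.
Qed.

(** Differentiation under the integral turns order [k] into [k] times order [k + 1], so that
    holomorphy of a derivative becomes a statement about orders 1, 2 and 3. *)
Definition cauchyT mu k w : C := L (fun z => mu z * (z - w)^-1 ^+ k).

Lemma onS_cont_pow mu k w : nm w < 1 -> onS (conto mu) ->
  onS (conto (fun z => mu z * (z - w)^-1 ^+ k)).
Proof.
move=> w1 cmu; elim: k => [|k IH].
  by apply: (onS_contM cmu); apply: onS_cst.
have -> : (fun z => mu z * (z - w)^-1 ^+ k.+1) =
    (fun z => mu z * (z - w)^-1 ^+ k * (z - w)^-1).
  by apply/funext => z; rewrite exprSr mulrA.
exact: (onS_contM IH (onS_cont_inv w1)).
Qed.

(** Taylor remainder of the Cauchy kernel, with [v = 1 / (z - w)], [v' = 1 / (z - w')] and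
    [h = w' - w]; the factor [h ^+ 2] is exhibited so that the rest only has to be bounded. *)
Lemma pow_diff (x v v' h : C) k : v' - v = h * v * v' -> (k = 1 \/ k = 2)%N ->
  x * v' ^+ k - x * v ^+ k - k%:R * (x * v ^+ k.+1) * h =
  h ^+ 2 * (x * (if k == 1%N then v ^+ 2 * v' else v ^+ 2 * v' * (v' + 2 * v))).
Proof.
move=> E; have E' : v' = v + h * v * v' by rewrite -E; ring.
case=> -> /=.
  have -> : x * v' ^+ 1 - x * v ^+ 1 - 1%:R * (x * v ^+ 2) * h =
    x * (v' - v - v ^+ 2 * h) by ring.
  rewrite E; have -> : h * v * v' - v ^+ 2 * h = h * v * (v' - v) by ring.
  by rewrite E; ring.
have -> : x * v' ^+ 2 - x * v ^+ 2 - 2%:R * (x * v ^+ 3) * h =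
    x * ((v' - v) * (v' + v) - 2 * v ^+ 3 * h) by ring.
rewrite E.
have -> : h * v * v' * (v' + v) - 2 * v ^+ 3 * h = h * v * ((v' - v) * (v' + 2 * v)) by ring.
by rewrite E; ring.
Qed.

Lemma onS_contB q g : onS (conto q) -> onS (conto g) -> onS (conto (fun z => q z - g z)).
Proof. by move=> h1 h2; apply: bdry_imp (bdry_and h1 h2) => z [? ?]; apply: contB. Qed.

Lemma cder_cauchyT mu k w : onS (conto mu) -> (k = 1 \/ k = 2)%N -> nm w < 1 / 2 ->
  cder (cauchyT mu k) w (k%:R * cauchyT mu k.+1 w).
Proof.
move=> cmu k12 w2; have w1 : nm w < 1 by clear -w2; lra.
have [M M0 MP] := onS_bounded cmu.
(* The 16 is that of [L_le]. Since [nm v <= 2] and [nm v' <= 4], the remainder factor is at most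
   [2 * 2 * 4] times [4 + 2 * 2], which is 128. *)
apply: (@cder_quadratic _ _ _ _ (16 * (M * 128)) (1 / 4)); first by lra.
move=> w' ww'.
have w'2 : nm w' < 3 / 4.
  have := nmD (w' - w) w; rewrite subrK => h.
  by clear -h w2 ww'; lra.
have w'1 : nm w' < 1 by clear -w'2; lra.
have c1 := onS_cont_pow k w1 cmu; have c2 := onS_cont_pow k w'1 cmu.
have c3 := onS_cont_pow k.+1 w1 cmu.
have c4 : onS (conto (fun z => k%:R * (mu z * (z - w)^-1 ^+ k.+1))).
  exact: (onS_contM (onS_cst _) c3).
have c5 : onS (conto (fun z => k%:R * (mu z * (z - w)^-1 ^+ k.+1) * (w' - w))).
  exact: (onS_contM c4 (onS_cst _)).
have c6 := onS_contB c2 c1.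
rewrite /cauchyT -(rIB c2 c1) -(rIZ _ c3) [X in _ - X]mulrC -(rIZ _ c4).
have -> : (fun z => (w' - w) * (k%:R * (mu z * (z - w)^-1 ^+ k.+1))) =
  (fun z => k%:R * (mu z * (z - w)^-1 ^+ k.+1) * (w' - w)).
  by apply/funext => z; rewrite mulrC.
rewrite -(rIB c6 c5).
apply: le_trans (L_le (onS_contB c6 c5) (M := M * 128 * nm (w' - w) ^+ 2) _) _; last first.
  by rewrite !mulrA.
have := bdry_and MP (bdry_and (onS_sub_nm w2) (@onS_nm R)).
apply: bdry_imp => z [zM [zw z1]].
have zw' : 1 / 4 <= nm (z - w').
  have := nmD (z - w') w'; rewrite subrK => h.
  by clear -h z1 w'2; lra.
have zw0 : z - w != 0 by rewrite -nm_gt0; clear -zw; lra.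
have zw'0 : z - w' != 0 by rewrite -nm_gt0; clear -zw'; lra.
have v2 : nm (z - w)^-1 <= 2.
  by apply: le_trans (nm_inv_le _ zw) _; [lra|rewrite invf_div divr1].
have v4 : nm (z - w')^-1 <= 4.
  by apply: le_trans (nm_inv_le _ zw') _; [lra|rewrite invf_div divr1].
rewrite (@pow_diff _ _ _ (w' - w)) //; last by field; rewrite zw0 zw'0.
move: v2 v4; set v := (z - w)^-1; set v' := (z - w')^-1 => v2 v4.
rewrite nmM expr2 nmM -expr2 mulrC ler_wpM2r ?sqr_ge0 // nmM.
have n0 := nm_ge0.
apply: ler_pM => //.
have A : nm (v ^+ 2 * v') <= 16.
  rewrite expr2 !nmM (_ : 16 = 2 * 2 * 4); last by ring.
  by rewrite !ler_pM ?mulr_ge0.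
case: ifP => _; first by apply: le_trans A _; clear; lra.
rewrite nmM (_ : 128 = 16 * 8); last by ring.
rewrite ler_pM // (le_trans (nmD _ _)) // nmM (_ : 8 = 4 + 2 * 2); last by ring.
have n2 : nm (2 : C) = 2 by rewrite -[2 : C](rmorph_nat (real_complex R)) nmC normr_nat.
by rewrite n2 lerD // ler_pM.
Qed.

Lemma cauchyT1 g w : cauchyT g 1 w = L (fun z => g z * (z - w)^-1).
Proof. by []. Qed.

Lemma cauchyT11 w : cauchyT (fun=> 1) 1 w = L (fun z => (z - w)^-1).
Proof.
rewrite cauchyT1; have -> // : (fun z : C => 1 * (z - w)^-1) = (fun z => (z - w)^-1).
by apply/funext => z; rewrite mul1r.
Qed.

Lemma cauchyT_one_neq0 w : nm w < 1 -> cauchyT (fun=> 1) 1 w != 0.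
Proof. by rewrite cauchyT11; exact: winding_neq0. Qed.

Lemma cauchyT_formula g w : (forall z, sq z -> exists l, cder g z l) -> nm w < 1 ->
  g w = cauchyT g 1 w / cauchyT (fun=> 1) 1 w.
Proof.
move=> gd w1; apply/(canRL (mulfK (cauchyT_one_neq0 w1))).
by rewrite (cauchyT1 g) (cauchy_square gd w1) cauchyT11.
Qed.

(* By Cauchy's formula, rescaled to the square, g is a quotient of two Cauchy
   transforms, and these can be differentiated twice. *)
Lemma cder_regular g (g' : C -> C) p (r : R) : (forall w, nm (w - p) < r -> cder g w (g' w)) ->
  forall w, nm (w - p) < r -> exists l, cder g' w l.
Proof.
move=> H w wr.
(* The square has points of modulus up to 2, and scaling by [s] moves them by at most half the
   distance from [w] to the edge of the disc. *)
pose s : R := (r - nm (w - p)) / 4.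
have s0 : 0 < s by rewrite divr_gt0 // subr_gt0.
have sC0 : s%:C != 0 by rewrite -nm_gt0 nmC normr_gt0 gt_eqF.
pose G (z : C) := g (w + z * s%:C).
have inb z : nm z <= 2 -> nm (w + z * s%:C - p) < r.
  move=> z2; rewrite addrAC; apply: le_lt_trans (nmD _ _) _.
  rewrite nmM nmC gtr0_norm //.
  have : nm z * s <= 2 * s by rewrite ler_wpM2r // ltW.
  by move: s0; rewrite /s; clear; lra.
have Gd z : nm z <= 2 -> cder G z (g' (w + z * s%:C) * s%:C).
  by move=> z2; apply: cder_line; apply/H/inb.
have Gsq z : sq z -> exists l, cder G z l.
  by move=> /sq_nm /Gd; eexists; eassumption.
have cG : onS (conto G) by apply: rect_cont => //; exact: N11.
have c1 : onS (conto (fun=> (1 : C))) by exact: onS_cst.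
have k1 : (1 = 1 \/ 1 = 2)%N by left.
have k2 : (2 = 1 \/ 2 = 2)%N by right.
pose E z := (1%:R * cauchyT G 2 z * cauchyT (fun=> 1) 1 z -
   cauchyT G 1 z * (1%:R * cauchyT (fun=> 1) 2 z)) / cauchyT (fun=> 1) 1 z ^+ 2.
(* By uniqueness of derivatives, [g'] near [w] is the quotient-rule expression in transforms of
   orders 1 and 2, each of which can be differentiated once more. *)
have gE z : nm z < 1 / 2 -> g' (w + z * s%:C) = E z / s%:C.
  move=> z2; have z1 : nm z < 1 by clear -z2; lra.
  apply/(canRL (mulfK sC0)); apply: (cder_unique (Gd z _)); first by clear -z1; lra.
  have := cder_div (cauchyT_one_neq0 z1) (cder_cauchyT cG k1 z2) (cder_cauchyT c1 k1 z2).
  apply: cder_near; exists (1 / 2 - nm z); first by rewrite subr_gt0.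
  move=> u uz; rewrite (@cauchyT_formula G) //.
  have := nmD (u - z) z; rewrite subrK => h.
  by clear -h uz z2; lra.
have z0 : nm 0 < 1 / 2 :> R by rewrite nm0; lra.
have z01 : nm 0 < 1 :> R by rewrite nm0.
have [e Ee] : exists e, cder E 0 e.
  eexists; apply: cder_div.
  - by rewrite expf_neq0 // cauchyT_one_neq0.
  - apply: cderB; apply: cderM.
    + by apply: cderZ; exact: (cder_cauchyT cG k2 z0).
    + exact: (cder_cauchyT c1 k1 z0).
    + exact: (cder_cauchyT cG k1 z0).
    + by apply: cderZ; exact: (cder_cauchyT c1 k2 z0).
  - under [X in cder X]funext do rewrite expr2.
    by apply: cderM; exact: (cder_cauchyT c1 k1 z0).
(* The point 0 is rewritten as the value at [w] of the map sending [u] to [(u - w) / s], so that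
   [cder_line] applies. *)
have Ee' : cder E (- w / s%:C + w * s%:C^-1) e by rewrite mulNr addNr.
have := cderZ (s%:C^-1) (cder_line Ee').
set l := (X in cder _ _ X) => EL; exists l; apply: cder_near EL.
exists (s / 2); first by rewrite divr_gt0.
move=> u us.
have ns : nm (- w / s%:C + u * s%:C^-1) < 1 / 2.
  have -> : - w / s%:C + u * s%:C^-1 = (u - w) / s%:C by rewrite mulNr addrC mulrBl.
  by rewrite nmM nmV nmC gtr0_norm // ltr_pdivrMr // mulrC mulrA mulr1.
rewrite [LHS]mulrC -(gE _ ns); congr g'.
by rewrite mulrDl !divfK // addrA subrr add0r.
Qed.

Lemma real_small_zero (c K eta : R) : 0 <= c -> 0 < eta ->
  (forall t, 0 < t < eta -> c <= t * K) -> c = 0.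
Proof.
move=> c0 eta0 H; apply/eqP; rewrite eq_le c0 andbT; apply/ler_addgt0Pl => e e0.
rewrite addr0; have K1 : 0 < `|K| + 1 by rewrite ltr_wpDl.
pose t := Num.min (eta / 2) (e / (`|K| + 1)).
have t0 : 0 < t by rewrite lt_min !divr_gt0.
have te : t * (`|K| + 1) <= e by rewrite -ler_pdivlMr // ge_min lexx orbT.
have teta : t < eta by rewrite gt_min; apply/orP; left; clear -eta0; lra.
apply: le_trans (H t _) _; first by rewrite t0.
apply: le_trans te; apply: ler_wpM2l; first exact: ltW.
by rewrite (le_trans (ler_norm K)) // lerDl.
Qed.

(* With Phi k w = L (g z / (z ^ k (z - w))) one has
   Phi k w = L (g z / z ^ (k + 1)) + w Phi (k + 1) w. Real zeros of g close to 0
   make all the constant terms vanish, whence Phi 0 w = w ^ k Phi k w for all k. *)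
Lemma identity_square g (eta : R) : (forall z, sq z -> exists l, cder g z l) -> 0 < eta ->
  (forall t : R, 0 < t < eta -> g t%:C = 0) -> forall w, nm w < 1 -> g w = 0.
Proof.
move=> gd eta0 g0 w w1.
have cg : onS (conto g) by apply: rect_cont => //; exact: N11.
pose m k z := g z * (z - 0)^-1 ^+ k.
have z01 : nm 0 < 1 :> R by rewrite nm0.
have cm k : onS (conto (m k)) by exact: onS_cont_pow.
have cmw k v : nm v < 1 -> onS (conto (fun z => m k z * (z - v)^-1)).
  by move=> v1; exact: (onS_contM (cm k) (onS_cont_inv v1)).
pose Phi k v := L (fun z => m k z * (z - v)^-1).
have rec k v : nm v < 1 -> Phi k v = L (m k.+1) + v * Phi k.+1 v.
  move=> v1; have h2 := onS_contM (onS_cst v) (cmw k.+1 v v1).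
  rewrite /Phi -(rIZ v (cmw k.+1 v v1)) -(rID (cm k.+1) h2).
  apply: eq_rI; apply: onS_imp => z _ z1.
  have z0 : z != 0 by rewrite -nm_gt0; apply: lt_le_trans z1.
  have zv : z - v != 0.
    by rewrite subr_eq0; apply/eqP => E; move: v1; rewrite -E ltNge z1.
  rewrite /m subr0 exprSr; move: (_ ^+ k) => x; field.
  by rewrite z0 zv.
have [M M0 MP] := onS_bounded cg.
(* The bound is uniform in [k] because [1 <= nm z] on the boundary; this is what makes
   [w ^+ k * Phi k w] tend to 0. *)
have bd k v : nm v < 1 -> nm (Phi k v) <= 16 * (M / (1 - nm v)).
  move=> v1; have v10 : 0 < 1 - nm v by rewrite subr_gt0.
  apply: (L_le (cmw k v v1)).
  apply: bdry_imp (bdry_and MP (@onS_nm R)) => z [zM z1].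
  have zv : 1 - nm v <= nm (z - v).
    have := nmD (z - v) v; rewrite subrK => h.
    by clear -h z1; lra.
  rewrite nmM; apply: ler_pM; rewrite ?nm_ge0 //; last exact: nm_inv_le.
  rewrite /m subr0 nmM -[leRHS]mulr1; apply: ler_pM; rewrite ?nm_ge0 //.
  elim: k => [|k IH]; first by rewrite expr0 -[1]/((1:R)%:C) nmC normr1.
  rewrite exprSr nmM -[leRHS]mulr1; apply: ler_pM; rewrite ?nm_ge0 //.
  by apply: le_trans (nm_inv_le _ z1) _; rewrite ?invr1.
pose eta' := Num.min eta (1 / 2).
have eta'0 : 0 < eta' by rewrite lt_min eta0; apply/andP; split => //; lra.
have real0 k : forall t : R, 0 < t < eta' -> Phi k t%:C = 0.
  elim: k => [|k IH] t /andP[t0 te]; have := te; rewrite lt_min => /andP[te1 te2].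
    have t1 : nm t%:C < 1 by rewrite nmC gtr0_norm //; clear -te2; lra.
    have := cauchy_square gd t1; rewrite g0 ?t0 // mul0r => <-.
    by apply: eq_rI; apply: onS_imp => z _ _; rewrite /m expr0 mulr1.
  (* At a small real zero [x] of [Phi k] the recursion gives [L (m k.+1) = - x * Phi k.+1 x], which
     tends to 0 with [x]. *)
  have c0 : L (m k.+1) = 0.
    apply/eqP; rewrite -nm_eq0; apply/eqP.
    apply: (@real_small_zero _ (16 * (M * 2)) eta') => //; first exact: nm_ge0.
    move=> x /andP[x0 xe]; have := xe; rewrite lt_min => /andP[xe1 xe2].
    have nx : nm x%:C = x by rewrite nmC gtr0_norm.
    have x1 : nm x%:C < 1 by rewrite nx; clear -xe2; lra.
    have := IH x; rewrite x0 xe => /(_ isT); rewrite rec // => /eqP.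
    rewrite addr_eq0 => /eqP ->; rewrite nmN nmM nx.
    apply: ler_wpM2l; first exact: ltW.
    apply: le_trans (bd _ _ x1) _; rewrite nx ler_pM2l // ler_pM2l //.
    have p : 0 < 1 - x by clear -xe2; lra.
    by rewrite -div1r ler_pdivrMr //; clear -xe2; lra.
  have := IH t; rewrite t0 te => /(_ isT); rewrite rec ?c0 ?add0r; last first.
    by rewrite nmC gtr0_norm //; clear -te2; lra.
  move/eqP; rewrite mulf_eq0 => /orP[/eqP[E]|/eqP //].
  by move: t0; rewrite E ltxx.
have c0 k : L (m k.+1) = 0.
  have t1 : 0 < eta' / 2 < eta' by clear -eta'0; apply/andP; split; lra.
  have t2 : nm (eta' / 2)%:C < 1.
    rewrite nmC gtr0_norm; last by case/andP: t1.
    by have : eta' <= 1 / 2 by [rewrite ge_min lexx orbT]; clear; lra.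
  by have := rec k _ t2; rewrite !real0 // mulr0 addr0.
have Pw k : Phi 0%N w = w ^+ k * Phi k w.
  elim: k => [|k IH]; first by rewrite expr0 mul1r.
  by rewrite IH rec // c0 add0r mulrA -exprSr.
pose B := 16 * (M / (1 - nm w)).
have B0 : 0 < B by rewrite mulr_gt0 // divr_gt0 // subr_gt0.
have P0 : Phi 0%N w = 0.
  have bN N : nm (Phi 0%N w) <= nm w ^+ N * B.
    rewrite (Pw N) nmM.
    have -> : nm (w ^+ N) = nm w ^+ N.
      elim: N => [|n IH]; first by rewrite !expr0 -[1]/((1:R)%:C) nmC normr1.
      by rewrite !exprS nmM IH.
    by rewrite ler_wpM2l ?exprn_ge0 ?nm_ge0 // bd.
  apply/eqP; rewrite -nm_eq0 eq_le nm_ge0 andbT leNgt; apply/negP => c.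
  have w1' : `|nm w| < 1 by rewrite ger0_norm ?nm_ge0.
  move: (nm (Phi _ _)) c bN => y y0 bN.
  have /cvgrPdist_lt /(_ (y / B)) := cvg_expr w1'.
  rewrite divr_gt0 // => /(_ isT)[N _ /(_ N (leqnn N))] /=.
  rewrite sub0r normrN ger0_norm ?exprn_ge0 ?nm_ge0 // ltr_pdivlMr // ltNge.
  by rewrite bN.
have := cauchy_square gd w1.
have -> : L (fun z => g z / (z - w)) = Phi 0%N w.
  by apply: eq_rI; apply: onS_imp => z _ _; rewrite /m expr0 mulr1.
rewrite P0 => /esym/eqP; rewrite mulf_eq0 => /orP[/eqP //|].
by rewrite (negbTE (winding_neq0 w1)).
Qed.

(** The square of half side [r / 3] lies in the disc of radius [r], since its points have modulus at
    most [2 * r / 3]; its inscribed disc is where the conclusion holds. *)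
Lemma identity_disc g (r eta : R) : 0 < eta ->
  (forall z, nm z < r -> exists l, cder g z l) ->
  (forall t : R, 0 < t < eta -> g t%:C = 0) -> forall w, nm w < r / 3 -> g w = 0.
Proof.
move=> eta0 gd g0 w wr.
have r0 : 0 < r by have := le_lt_trans (nm_ge0 w) wr; clear; lra.
pose s := r / 3; have s0 : 0 < s by rewrite divr_gt0.
have sC0 : s%:C != 0 by rewrite -nm_gt0 nmC normr_gt0 gt_eqF.
have -> : w = 0 + w / s%:C * s%:C by rewrite add0r divfK.
apply: (@identity_square (fun z => g (0 + z * s%:C)) (eta / s)).
- move=> z /sq_nm z2; have [|l gl] := gd (0 + z * s%:C).
    rewrite add0r nmM nmC gtr0_norm //.
    have : nm z * s <= 2 * s by rewrite ler_wpM2r // ltW.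
    by move: r0; rewrite /s; clear; lra.
  by eexists; apply: cder_line gl.
- by rewrite divr_gt0.
- move=> t /andP[t0 te]; rewrite add0r -rmorphM g0 // mulr_gt0 //=.
  by rewrite -ltr_pdivlMr.
- by rewrite nmM nmV nmC gtr0_norm // ltr_pdivrMr // mul1r.
Qed.

End CauchyTransform.

(** * Polarization and Calabi's rigidity *)

Section Polarization.
Variable R : realType.
Local Notation C := (R[i]).
Local Notation nm := (@Normc.normc R).
Implicit Types (f g : C -> C) (z w s t : C).

Lemma conjCB z w : (z - w)^*%C = z^*%C - w^*%C. Proof. exact: rmorphB. Qed.
Lemma conjCD z w : (z + w)^*%C = z^*%C + w^*%C. Proof. exact: rmorphD. Qed.
Lemma conjCM z w : (z * w)^*%C = z^*%C * w^*%C. Proof. exact: rmorphM. Qed.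

Lemma conjCi : ('i%C)^*%C = - 'i%C :> C.
Proof. by rewrite -[RHS]/((- 0) +i* (- 1)) oppr0. Qed.

Definition hol1 f z := exists l, cder f z l.

Lemma hol1_cst (c : C) z : hol1 (fun=> c) z.
Proof. by exists 0; exact: cder_cst. Qed.
Lemma hol1B f g z : hol1 f z -> hol1 g z -> hol1 (fun x => f x - g x) z.
Proof. by move=> [a fa] [b gb]; exists (a - b); exact: cderB. Qed.
Lemma hol1M f g z : hol1 f z -> hol1 g z -> hol1 (fun x => f x * g x) z.
Proof. by move=> [a fa] [b gb]; eexists; apply: cderM; eassumption. Qed.
Lemma hol1X f k z : hol1 f z -> hol1 (fun x => f x ^+ k) z.
Proof.
move=> hf; elim: k => [|k IH]; first exact: hol1_cst.
by under [X in hol1 X]funext do rewrite exprS; exact: hol1M.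
Qed.
Lemma hol1_line f p v z : hol1 f (p + z * v) -> hol1 (fun t => f (p + t * v)) z.
Proof. by move=> [l fl]; eexists; apply: cder_line fl. Qed.

Lemma cder_sum N (f : 'I_N -> C -> C) (f' : 'I_N -> C) z :
  (forall j, cder (f j) z (f' j)) -> cder (fun x => \sum_j f j x) z (\sum_j f' j).
Proof.
elim: N f f' => [|N IH] f f' H.
  under [X in cder X]funext do rewrite big_ord0; rewrite big_ord0.
  exact: cder_cst.
under [X in cder X]funext do rewrite big_ord_recr /=; rewrite big_ord_recr /=.
by apply: cderD => //; apply: IH.
Qed.

(* Holomorphic in z when f is, unlike the conjugate of f z. *)
Definition rev f z := (f z^*%C)^*%C.

Lemma cder_rev f z l : cder f z^*%C l -> cder (rev f) z l^*%C.
Proof.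
move=> H e /H[d d0 dP]; exists d => // w wz.
have := dP w^*%C; rewrite -conjCB nm_conj => /(_ wz).
by rewrite -nm_conj !conjCB conjCM conjCB !conjcK.
Qed.

(** The mean value theorem is real, so it is applied to the real and imaginary parts of [f] along
    the segment from 0 to [z]; [pr] stands for either part. *)
Lemma disc_const f (r : R) : (forall z, nm z < r -> cder f z 0) ->
  forall z, nm z < r -> f z = f 0.
Proof.
move=> H z zr.
suff K (pr : C -> R) : (forall w, `|pr w| <= nm w) -> (forall u v, pr (u - v) = pr u - pr v) ->
    pr (f z) = pr (f 0).
  have E1 := K _ (@nm_Re R) (@ReB R); have E2 := K _ (@nm_Im R) (@ImB R).
  by move: E1 E2; case: (f z) (f 0) => a b [c d] /= -> ->.
move=> prn prB.
pose u (t : R) := pr (f (t%:C * z)).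
have ud (t : R) : 0 <= t <= 1 -> is_derive t (1 : R) u 0.
  move=> /andP[t0 t1].
  have tz : nm (t%:C * z) < r.
    rewrite nmM nmC ger0_norm //; apply: le_lt_trans zr.
    by rewrite ler_piMl ?nm_ge0.
  have cv : (fun h => h^-1 *: ((u \o shift t) (h *: 1) - u t)) @ 0^' --> (0 : R).
    apply/cvgrPdist_le => e e0.
    have z1 : 0 < nm z + 1 by rewrite ltr_wpDl ?nm_ge0.
    have [d d0 dP] := H _ tz (e / (nm z + 1)) (divr_gt0 e0 z1).
    rewrite near_withinE.
    have dz : 0 < d / (nm z + 1) by rewrite divr_gt0.
    apply/nbhs_ballP; exists (d / (nm z + 1)) => //= h.
    rewrite /ball /= sub0r normrN => hd h0.
    rewrite sub0r normrN normrM normfV /= [h *: 1]mulr1 /u -prB.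
    rewrite ler_pdivrMl ?normr_gt0 //; apply: le_trans (prn _) _.
    have E : (h + t)%:C * z - t%:C * z = h%:C * z by rewrite rmorphD /= mulrDl addrK.
    have nh : nm (h%:C * z) <= `|h| * (nm z + 1).
      by rewrite nmM nmC ler_wpM2l // lerDl.
    have := dP ((h + t)%:C * z); rewrite E mul0r subr0 => /(_ _)/le_trans; apply.
      by apply: le_lt_trans nh _; rewrite -ltr_pdivlMr.
    apply: le_trans (ler_wpM2l _ nh) _; first by rewrite divr_ge0 // ltW.
    by rewrite mulrCA divfK ?gt_eqF // mulrC.
  by apply: DeriveDef; [apply/cvg_ex; exists (0 : R) | apply/cvg_lim].
have [c _] : exists2 c, c \in `[(0:R), 1] & u 1 - u 0 = 0 * (1 - 0).
  apply: (@MVT_segment _ u (fun=> 0)) => //.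
    by move=> x; rewrite in_itv /= => /andP[? ?]; apply: ud; rewrite !ltW.
  apply: derivable_within_continuous => x; rewrite in_itv /= => x01.
  by have [] := ud x x01.
by rewrite mul0r /u mul1r mul0r => /eqP; rewrite subr_eq0 => /eqP.
Qed.

(** Two uses of [identity_disc]: in the first variable at a small real second one, then in the
    second variable. The nested use costs only one factor 3. *)
Lemma polar (Q : C -> C -> C) (r eta : R) : 0 < eta ->
  (forall s t, nm s < r -> nm t < r -> hol1 (fun x => Q x t) s) ->
  (forall s t, nm s < r -> nm t < r -> hol1 (fun x => Q s x) t) ->
  (forall x y : R, 0 < x < eta -> 0 < y < eta -> Q x%:C y%:C = 0) ->
  forall s t, nm s < r / 3 -> nm t < r / 3 -> Q s t = 0.
Proof.
move=> eta0 h1 h2 h0 s t sr tr.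
have r0 : 0 < r by have := le_lt_trans (nm_ge0 s) sr; clear; lra.
pose eta' := Num.min eta r.
have eta'0 : 0 < eta' by rewrite lt_min eta0.
have sr' : nm s < r by apply: lt_trans sr _; clear -r0; lra.
apply: (@identity_disc _ (Q s) r eta') => // [z zr|y].
  exact: h2.
rewrite lt_min => /andP[y0 /andP[ye yr]].
apply: (@identity_disc _ (fun x => Q x y%:C) r eta) => // [z zr|x x01].
  by apply: h1 => //; rewrite nmC gtr0_norm.
by apply: h0 => //; rewrite y0.
Qed.

End Polarization.

(** * Calabi's rigidity for families of functions on a disc *)

Section Calabi.
Variable R : realType.
Local Notation C := (R[i]).
Local Notation nm := (@Normc.normc R).
Implicit Types (s t z : C).

(** The hermitian product with its conjugated variable made independent: it is holomorphic in [s]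
    and [t], and equals the product of [u s] and [v s] when [t] is the conjugate of [s]. *)
Definition dot N (u v : 'I_N -> C -> C) s t : C := \sum_j u j s * rev (v j) t.

Lemma cder_dotl N (u u' v : 'I_N -> C -> C) s t :
  (forall j, cder (u j) s (u' j s)) -> cder (fun x => dot u v x t) s (dot u' v s t).
Proof.
move=> H; apply: (@cder_sum _ _ (fun j x => u j x * rev (v j) t)) => j.
by have := cderM (H j) (cder_cst (rev (v j) t) s); rewrite mulr0 addr0.
Qed.

Lemma cder_dotr N (u v v' : 'I_N -> C -> C) s t :
  (forall j, cder (v j) t^*%C (v' j t^*%C)) -> cder (dot u v s) t (dot u v' s t).
Proof.
move=> H; apply: (@cder_sum _ _ (fun j x => u j s * rev (v j) x)) => j.
by have := cderM (cder_cst (u j s) t) (cder_rev (H j)); rewrite mul0r add0r.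
Qed.

Lemma hol1_dot_lines N (u v : 'I_N -> C -> C) (p c q d z : C) :
  (forall j, hol1 (u j) (p + z * c)) -> (forall j, hol1 (v j) (q + z * d)^*%C) ->
  hol1 (fun x => dot u v (p + x * c) (q + x * d)) z.
Proof.
move=> hu hv.
have H j : hol1 (fun x => u j (p + x * c) * rev (v j) (q + x * d)) z.
  apply: hol1M; first exact: hol1_line.
  have [l hl] := hv j; apply: hol1_line; exists l^*%C.
  exact: cder_rev.
have [f' fP] := choice H.
by eexists; apply: (@cder_sum _ _ (fun j x => u j (p + x * c) * rev (v j) (q + x * d))).
Qed.

Variables (N M : nat) (u u' : 'I_N -> C -> C) (v v' : 'I_M -> C -> C) (r : R).
Hypothesis hu : forall j z, nm z < r -> cder (u j) z (u' j z).
Hypothesis hv : forall j z, nm z < r -> cder (v j) z (v' j z).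

Let a := dot u u.
Let b := dot v v.
(** The quotient [la / a ^+ 2] is the mixed derivative of log [a] in [s] and [t]; likewise for [lb]
    and [b]. *)
Let la s t := a s t * dot u' u' s t - dot u' u s t * dot u u' s t.
Let lb s t := b s t * dot v' v' s t - dot v' v s t * dot v v' s t.

Hypothesis diag : forall z, nm z < r -> la z z^*%C * b z z^*%C ^+ 2 = lb z z^*%C * a z z^*%C ^+ 2.

Let P s t := la s t * b s t ^+ 2 - lb s t * a s t ^+ 2.

(** In the coordinates [x], [y] with [s = x + i y] and [t = x - i y], the diagonal hypothesis
    concerns real [x] and [y], so [polar] applies. Passing to [x], [y] halves the radius and [polar]
    divides it by 3. *)
Lemma calabi_polarized s t : nm s < r / 6 -> nm t < r / 6 -> P s t = 0.
Proof.
move=> sr tr.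
(* [P] contains the derivatives [u'] and [v']; this is where their own holomorphy is needed. *)
have hu' j z : nm z < r -> hol1 (u' j) z.
  move=> zr; apply: (@cder_regular _ (u j) (u' j) 0 r); last by rewrite subr0.
  by move=> w; rewrite subr0; exact: hu.
have hv' j z : nm z < r -> hol1 (v' j) z.
  move=> zr; apply: (@cder_regular _ (v j) (v' j) 0 r); last by rewrite subr0.
  by move=> w; rewrite subr0; exact: hv.
have Hu j z : nm z < r -> hol1 (u j) z by move=> /(hu j); eexists; eassumption.
have Hv j z : nm z < r -> hol1 (v j) z by move=> /(hv j); eexists; eassumption.
have Pl p c q d z : nm (p + z * c) < r -> nm (q + z * d) < r ->
    hol1 (fun x => P (p + x * c) (q + x * d)) z.
  rewrite -(nm_conj (q + _)) => pr qr; apply: hol1B; apply: hol1M;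
    do ?[apply: hol1X | apply: hol1B | apply: hol1M]; apply: hol1_dot_lines => j; auto.
pose Q x y := P (x + y * 'i%C) (x + y * - 'i%C).
have r0 : 0 < r by have := le_lt_trans (nm_ge0 s) sr; rewrite pmulr_lgt0.
have small x y (k : C) : nm x < r / 2 -> nm y < r / 2 -> nm k = 1 -> nm (x + y * k) < r.
  move=> xr yr k1; apply: le_lt_trans (nmD _ _) _; rewrite nmM k1 mulr1.
  by rewrite [r]splitr ltrD.
have n1 := @nmi R; have n2 : nm (- 'i%C) = 1 :> R by rewrite nmN.
have r6 : r / 2 / 3 = r / 6 by field.
have Q0 : forall x y, nm x < r / 2 / 3 -> nm y < r / 2 / 3 -> Q x y = 0.
  apply: (@polar _ Q (r / 2) (r / 2)) => [|x y xr yr|x y xr yr|x y /andP[x0 xr] /andP[y0 yr]].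
  - by rewrite divr_gt0.
  - have -> : Q^~ y = (fun x => P (y * 'i%C + x * 1) (y * - 'i%C + x * 1)).
      by apply/funext => z; rewrite /Q !mulr1 ![_ + z]addrC.
    by apply: Pl; rewrite mulr1 addrC small.
  - by apply: Pl; rewrite small.
  - rewrite /Q; have -> : x%:C + y%:C * - 'i%C = (x%:C + y%:C * 'i%C)^*%C.
      by rewrite conjCD conjCM !conjc_real conjCi.
    apply/eqP; rewrite subr_eq0; apply/eqP; apply: diag.
    by apply: small => //; rewrite nmC gtr0_norm.
have i2 : 'i%C * 'i%C = -1 :> C by rewrite -expr2 sqr_i.
have i0 : 'i%C != 0 :> C by rewrite -nm_gt0 n1.
have C2 : nm (2 : C) = 2 by rewrite -[2 : C](rmorph_nat (real_complex R)) nmC normr_nat.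
have := Q0 ((s + t) / 2) ((s - t) / 2 * - 'i%C).
have -> : Q ((s + t) / 2) ((s - t) / 2 * - 'i%C) = P s t.
  rewrite /Q; congr P.
    have -> : (s + t) / 2 + (s - t) / 2 * - 'i%C * 'i%C =
        (s + t) / 2 - (s - t) / 2 * ('i%C * 'i%C) by ring.
    by rewrite i2; field.
  have -> : (s + t) / 2 + (s - t) / 2 * - 'i%C * - 'i%C =
      (s + t) / 2 + (s - t) / 2 * ('i%C * 'i%C) by ring.
  by rewrite i2; field.
rewrite r6; apply.
  rewrite nmM nmV C2 ltr_pdivrMr //; apply: le_lt_trans (nmD _ _) _.
  by rewrite mulr_natr mulr2n ltrD.
rewrite !nmM n2 mulr1 nmV C2 ltr_pdivrMr //; apply: le_lt_trans (nmD _ _) _.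
by rewrite nmN mulr_natr mulr2n ltrD.
Qed.

Hypothesis na : forall s t, nm s < r -> nm t < r -> a s t != 0.
Hypothesis nb : forall s t, nm s < r -> nm t < r -> b s t != 0.

(* P = 0 means that log (a / b) has no mixed derivative, so that a / b is a
   function of s times a function of t. *)
Lemma calabi_disc s t : nm s < r / 6 -> nm t < r / 6 ->
  a s t * b 0 t * b s 0 * a 0 0 = b s t * a 0 t * a s 0 * b 0 0.
Proof.
move=> sr tr.
have r0 : 0 < r by have := le_lt_trans (nm_ge0 s) sr; rewrite pmulr_lgt0.
have r6 : r / 6 < r by rewrite ltr_pdivrMr // ltr_pMr // ltr1n.
have lt6 x : nm x < r / 6 -> nm x < r by move=> /lt_trans; apply.
have z6 : nm (0 : C) < r / 6 by rewrite nm0 divr_gt0.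
have ltc x : nm x < r -> nm x^*%C < r by rewrite nm_conj.
(* The [t]-derivative of log [(a / b)] does not depend on [s]: its derivative in [s] is
   [P / (a ^+ 2 * b ^+ 2)]. *)
have S1 y x : nm x < r / 6 -> nm y < r / 6 ->
    dot u u' x y / a x y - dot v v' x y / b x y = dot u u' 0 y / a 0 y - dot v v' 0 y / b 0 y.
  move=> xr yr;
    apply: (@disc_const _ (fun x => dot u u' x y / a x y - dot v v' x y / b x y) (r / 6)) => //.
  move=> z zr; have zr' := lt6 _ zr; have yr' := lt6 _ yr.
  have A1 : cder (fun x => dot u u' x y) z (dot u' u' z y) by apply: cder_dotl => j; apply: hu.
  have A2 : cder (fun x => a x y) z (dot u' u z y) by apply: cder_dotl => j; apply: hu.
  have B1 : cder (fun x => dot v v' x y) z (dot v' v' z y) by apply: cder_dotl => j; apply: hv.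
  have B2 : cder (fun x => b x y) z (dot v' v z y) by apply: cder_dotl => j; apply: hv.
  have := cderB (@cder_div _ _ (fun x => a x y) _ _ _ (na zr' yr') A1 A2)
    (@cder_div _ _ (fun x => b x y) _ _ _ (nb zr' yr') B1 B2).
  congr cder.
  have := calabi_polarized zr yr; rewrite /P /la /lb => E.
  have a0 := na zr' yr'; have b0 := nb zr' yr'.
  move: a0 b0 E; move: (a z y) (b z y) => a0 b0 na0 nb0 E.
  have -> : forall p1 p2 : C, p1 / a0 ^+ 2 - p2 / b0 ^+ 2 =
      (p1 * b0 ^+ 2 - p2 * a0 ^+ 2) / (a0 ^+ 2 * b0 ^+ 2).
    by move=> p1 p2; field; rewrite na0 nb0.
  rewrite [X in X / _](_ : _ = 0) ?mul0r // -[RHS]E; ring.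
have sr' := lt6 _ sr; have tr' := lt6 _ tr; have z' := lt6 _ z6.
(* By [S1] this quotient has zero logarithmic derivative in [t], so it equals its value at 0. *)
have S2 : a s t * b 0 t / (b s t * a 0 t) = a s 0 * b 0 0 / (b s 0 * a 0 0).
  apply: (@disc_const _ (fun y => a s y * b 0 y / (b s y * a 0 y)) (r / 6)) => // y yr.
  have yr' := lt6 _ yr; have yc := ltc _ yr'.
  have A1 x : cder (a x) y (dot u u' x y) by apply: cder_dotr => j; apply: hu.
  have B1 x : cder (b x) y (dot v v' x y) by apply: cder_dotr => j; apply: hv.
  have n0 : b s y * a 0 y != 0 by rewrite mulf_neq0 ?na ?nb.
  have := @cder_div _ _ (fun y => b s y * a 0 y) _ _ _ n0
    (cderM (A1 s) (B1 0)) (cderM (B1 s) (A1 0)).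
  congr cder.
  have := S1 _ _ sr yr.
  have := na sr' yr'; have := nb sr' yr'; have := na z' yr'; have := nb z' yr'.
  move: (a s y) (b s y) (a 0 y) (b 0 y) (dot u u' s y) (dot v v' s y) (dot u u' 0 y) (dot v v' 0 y).
  move=> a1 b1 a0 b0 a1' b1' a0' b0' nb0 na0 nb1 na1 /eqP.
  rewrite -subr_eq0 => /eqP E.
  suff -> : (a1' * b0 + a1 * b0') * (b1 * a0) - a1 * b0 * (b1' * a0 + b1 * a0') =
     (a1' / a1 - b1' / b1 - (a0' / a0 - b0' / b0)) * (a1 * b0 * b1 * a0).
    by rewrite E !mul0r.
  by field; rewrite na0 na1 nb0 nb1.
move/eqP: S2; rewrite eqr_div ?mulf_neq0 ?na ?nb // => /eqP S2.
rewrite -[LHS]mulrA S2; ring.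
Qed.

End Calabi.

Section PolarPoints.
Variables (F : numFieldType) (V : lmodType F) (i : F) (x y : V).
Hypothesis i2 : i * i = -1.

Let half_double (u : V) : 2^-1 *: (u + u) = u.
Proof. by rewrite -[u + u](scaler_nat 2 u) scalerA mulVf ?pnatr_eq0 // scale1r. Qed.

(** Any two points [x], [y] are [p + a + i b] and [p + a - i b], with [a] the mean of [x - p] and
    [y - p] and [b] equal to [- i / 2] times [x - y]. This puts them on a plane where real
    parameters give the diagonal. *)
Lemma polar_point1 p : p + 1 *: (2^-1 *: (x - p + (y - p))) +
  i *: ((- i / 2) *: (x - p - (y - p))) = x.
Proof.
have E : i * (- i / 2) = 2^-1 by rewrite mulrA mulrN i2 opprK mul1r.
rewrite scale1r scalerA E -addrA -scalerDr addrACA subrr addr0.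
by rewrite half_double addrC subrK.
Qed.

Lemma polar_point2 p : p + 1 *: (2^-1 *: (x - p + (y - p))) +
  - i *: ((- i / 2) *: (x - p - (y - p))) = y.
Proof.
have E : - i * (- i / 2) = - 2^-1 by rewrite mulrA mulrNN i2 mulN1r.
rewrite scale1r scalerA E scaleNr -addrA -scalerBr opprB [x - p + _]addrC addrACA subrr addr0.
by rewrite half_double addrC subrK.
Qed.

End PolarPoints.

(** * Rigidity and the identity theorem in several variables *)

Section SeveralVariables.
Variable R : realType.
Local Notation C := (R[i]).
Local Notation nm := (@Normc.normc R).

Lemma nm1 : nm (1 : C) = 1. Proof. exact: Normc.normc1. Qed.

(** The l1 norm, real-valued and exactly homogeneous, which suits estimates along complex lines. *)
Definition nv n (v : 'rV[C]_n) : R := \sum_j nm (v 0 j).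

Lemma nv_ge0 n (v : 'rV[C]_n) : 0 <= nv v.
Proof. by apply: sumr_ge0 => j _; exact: nm_ge0. Qed.

Lemma nm_le_nv n (v : 'rV[C]_n) j : nm (v 0 j) <= nv v.
Proof.
rewrite /nv (bigD1 j) //= lerDl; apply: sumr_ge0 => k _; exact: nm_ge0.
Qed.

Lemma nvD n (v w : 'rV[C]_n) : nv (v + w) <= nv v + nv w.
Proof. by rewrite -big_split /=; apply: ler_sum => j _; rewrite mxE nmD. Qed.

Lemma nvZ n (c : C) (v : 'rV[C]_n) : nv (c *: v) = nm c * nv v.
Proof. by rewrite /nv mulr_sumr; apply: eq_bigr => j _; rewrite mxE nmM. Qed.

Lemma nv_near n (p : 'rV[C]_n) (P : 'rV[C]_n -> Prop) :
  (\forall z \near p, P z) -> exists2 d : R, 0 < d & forall z, nv (z - p) < d -> P z.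
Proof.
move/nbhs_ballP => -[e /= /posCP[d d0 ->] dP]; exists d => // z zp.
apply: dP; split=> [|i j]; first by rewrite ltcR.
rewrite (ord1 i) /ball /= -normrN opprB normcE ltcR.
have := nm_le_nv (z - p) j; rewrite !mxE => /le_lt_trans; exact.
Qed.

(** Neighborhoods are coordinatewise; the divisor [n + 1] makes the sum of [n] coordinate bounds
    less than [d] and also covers [n = 0]. *)
Lemma near_nv n (p : 'rV[C]_n) (P : 'rV[C]_n -> Prop) (d : R) : 0 < d ->
  (forall z, nv (z - p) < d -> P z) -> \forall z \near p, P z.
Proof.
move=> d0 dP; have n0 : 0 < n%:R + 1 :> R by rewrite ltr_wpDl.
have e0 : 0 < d / (n%:R + 1) by rewrite divr_gt0.
apply/nbhs_ballP; exists (d / (n%:R + 1))%:C => /=; first by rewrite ltcR.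
move=> z [_ zp]; apply: dP.
apply: le_lt_trans (_ : n%:R * (d / (n%:R + 1)) < d); last first.
  by rewrite mulrA ltr_pdivrMr // mulrC ltr_pM2l // ltrDl.
have -> : n%:R * (d / (n%:R + 1)) = \sum_(j < n) (d / (n%:R + 1)).
  by rewrite sumr_const card_ord mulr_natl.
apply: ler_sum => j _.
have := zp 0 j; rewrite /ball /= -normrN opprB normcE ltcR !mxE.
exact: ltW.
Qed.

Lemma nv0 n : nv (0 : 'rV[C]_n) = 0.
Proof. by rewrite /nv big1 // => j _; rewrite mxE nm0. Qed.

Lemma nvN n (x : 'rV[C]_n) : nv (- x) = nv x.
Proof. by apply: eq_bigr => j _; rewrite mxE nmN. Qed.

Lemma open_nv n (U : set 'rV[C]_n) p : open U -> U p ->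
  exists2 d : R, 0 < d & forall z, nv (z - p) < d -> U z.
Proof. by move=> oU Up; apply: nv_near; exact: open_nbhs_nbhs. Qed.

Lemma is_diff_coord n (M : 'rV[C]_n) j :
  is_diff M (fun M : 'rV[C]_n => M 0 j : C) (fun M : 'rV[C]_n => M 0 j : C).
Proof.
have dc := @differentiable_coord _ 1 n M 0 j.
apply: DiffDef => //.
pose f (M : 'rV[C]_n) : C := M 0 j.
have lf : linear f by move=> a u v; rewrite /f !mxE.
pose fM := GRing.isLinear.Build _ _ _ _ f lf.
pose fL : {linear 'rV[C]_n -> C} := HB.pack f fM.
by rewrite -[LHS]/('d fL M : _ -> _) diff_lin //; exact: (@coord_continuous _ _ _ 0 j).
Qed.

Lemma line_cder n N (phi : 'rV[C]_n -> 'rV[C]_N) p v t j :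
  differentiable phi (p + t *: v) ->
  cder (fun s => phi (p + s *: v) 0 j) t (('d phi (p + t *: v) v) 0 j).
Proof.
move=> dphi; apply: is_derive_cder.
have D1 : is_diff t (fun s : C => p + s *: v) (fun s => s *: v).
  by apply: is_diff_eq; rewrite add0r.
have D2 : is_diff (p + t *: v) phi ('d phi (p + t *: v)) by exact: DiffDef.
have D3 := @is_diff_comp _ _ _ _ _ _ _ _ _ D1 D2.
have D4 := is_diff_coord (phi (p + t *: v)) j.
have D5 := @is_diff_comp _ _ _ _ _ _ _ _ _ D3 D4.
have df := @ex_diff _ _ _ _ _ _ _ D5.
apply: DeriveDef; first by apply/derivable1_diffP; exact: df.
rewrite deriveE //; by rewrite (@diff_val _ _ _ _ _ _ _ D5) /= scale1r.
Qed.

Lemma differentiable_nv n N (phi : 'rV[C]_n -> 'rV[C]_N) p : differentiable phi p ->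
  forall e : R, 0 < e -> exists2 d : R, 0 < d &
    forall z, nv (z - p) < d -> forall j, nm (phi z 0 j - phi p 0 j) < e.
Proof.
move=> /differentiable_continuous cphi e e0.
have eC : 0 < e%:C by rewrite ltcR.
have /cvg_ballP /(_ _ eC) := cphi.
rewrite near_simpl => /nv_near[d d0 dP].
exists d => // z /dP [_ /(_ 0)] h j; have := h j.
by rewrite /ball /= -normrN opprB normcE ltcR.
Qed.

Definition herm N (x y : 'rV[C]_N) : C := \sum_j x 0 j * (y 0 j)^*%C.

Lemma nm_sum N (x : 'I_N -> C) (B : R) : (forall j, nm (x j) <= B) ->
  nm (\sum_j x j) <= N%:R * B.
Proof.
move=> H; apply: le_trans (_ : \sum_(j < N) B <= _); last first.
  by rewrite sumr_const card_ord mulr_natl.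
elim/big_ind2 : _ => [|x1 b1 x2 b2 h1 h2|j _]; [by rewrite nm0| |exact: H].
by apply: le_trans (nmD _ _) _; exact: lerD.
Qed.

(** Stated for two independent points, since after polarization one divides by the kernel off the
    diagonal. *)
Lemma herm_near n N (H : 'rV[C]_n -> 'rV[C]_N) p : differentiable H p ->
  herm (H p) (H p) != 0 -> exists2 d : R, 0 < d &
    forall z w, nv (z - p) < d -> nv (w - p) < d -> herm (H z) (H w) != 0.
Proof.
move=> dH; rewrite -nm_gt0; set e := nm _ => e0.
pose K := 2 * nv (H p) + 1.
have K0 : 0 < K by rewrite ltr_wpDl // mulr_ge0 // nv_ge0.
have N0 : 0 < N%:R + 1 :> R by rewrite ltr_wpDl.
pose c := Num.min 1 (e / ((N%:R + 1) * K)).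
have c0 : 0 < c by rewrite lt_min ltr01 divr_gt0 // mulr_gt0.
have c1 : c <= 1 by rewrite ge_min lexx.
have ce : c * ((N%:R + 1) * K) <= e by rewrite -ler_pdivlMr ?mulr_gt0 // ge_min lexx orbT.
have [d d0 dP] := differentiable_nv dH c0.
exists d => // z w /dP hz /dP hw; apply/eqP => E.
have : e <= N%:R * (c * K).
  rewrite /e -[herm _ _](opprK) nmN -[- _]add0r -E /herm -sumrB.
  apply: nm_sum => j.
  have -> : H z 0 j * (H w 0 j)^*%C - H p 0 j * (H p 0 j)^*%C =
     (H z 0 j - H p 0 j) * (H w 0 j - H p 0 j + H p 0 j)^*%C +
     H p 0 j * (H w 0 j - H p 0 j)^*%C.
    by rewrite subrK conjCB; ring.
  have n1 := ltW (hz j); have n2 := ltW (hw j); have n3 := nm_le_nv (H p) j.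
  apply: le_trans (nmD _ _) _; rewrite !nmM !nm_conj.
  have n4 : nm (H w 0 j - H p 0 j + H p 0 j) <= 1 + nv (H p).
    by apply: le_trans (nmD _ _) _; rewrite lerD // (le_trans n2).
  have -> : c * K = c * (1 + nv (H p)) + nv (H p) * c by rewrite /K; ring.
  by apply: lerD; apply: ler_pM; rewrite ?nm_ge0.
apply/negP; rewrite -ltNge; apply: lt_le_trans ce.
have -> : c * ((N%:R + 1) * K) = N%:R * (c * K) + c * K by ring.
by rewrite ltrDl mulr_gt0.
Qed.

(** The expression [la] for the restriction of [H] to the line through [z] in direction [v]. *)
Definition fsnum n N (H : 'rV[C]_n -> 'rV[C]_N) z v : C :=
  herm (H z) (H z) * herm ('d H z v) ('d H z v)
  - herm ('d H z v) (H z) * herm (H z) ('d H z v).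

Lemma hol1_sum N (f : 'I_N -> C -> C) z : (forall j, hol1 (f j) z) ->
  hol1 (fun x => \sum_j f j x) z.
Proof.
by move=> H; have [f' fP] := choice H; eexists; apply: cder_sum.
Qed.

Section Calabi.
Variables (n N M : nat) (H : 'rV[C]_n -> 'rV[C]_N) (K : 'rV[C]_n -> 'rV[C]_M).
Variables (U : set 'rV[C]_n) (p : 'rV[C]_n).
Hypotheses (oU : open U) (Up : U p).
Hypothesis dH : forall z, U z -> differentiable H z.
Hypothesis dK : forall z, U z -> differentiable K z.
Hypothesis Hp0 : herm (H p) (H p) != 0.
Hypothesis Kp0 : herm (K p) (K p) != 0.
Hypothesis fsHK : forall z v, U z ->
  fsnum H z v * herm (K z) (K z) ^+ 2 = fsnum K z v * herm (H z) (H z) ^+ 2.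

Let A z w := herm (H z) (H w).
Let B z w := herm (K z) (K w).
(** Its vanishing says that [A z w / B z w] is a function of [z] times a function of [w], normalized
    at [p]. *)
Let T z w := A z w * B p w * B z p * A p p - B z w * A p w * A z p * B p p.

Lemma calabi_ball : exists2 d : R, 0 < d & forall z w, nv (z - p) < d -> nv (w - p) < d ->
  [/\ U z, A z w != 0 & B z w != 0].
Proof.
have [d1 d10 h1] := open_nv oU Up.
have [d2 d20 h2] := herm_near (dH Up) Hp0.
have [d3 d30 h3] := herm_near (dK Up) Kp0.
exists (Num.min d1 (Num.min d2 d3)); first by rewrite !lt_min d10 d20.
move=> z w; rewrite !lt_min => /and3P[? ? ?] /and3P[? ? ?].
by split; [exact: h1|exact: h2|exact: h3].
Qed.

Lemma calabi_diag (r : R) : (forall z w, nv (z - p) < r -> nv (w - p) < r ->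
    [/\ U z, A z w != 0 & B z w != 0]) ->
  forall z, nv (z - p) < r / 8 -> T z z = 0.
Proof.
(* On the line [p + t *: v] the point [z] has parameter 1, and [calabi_disc] needs 1 to be less than
   a sixth of the radius; a disc of radius 8 fits because [nv v < r / 8]. *)
move=> hr z zr; pose v := z - p.
have r0 : 0 < r by have := le_lt_trans (nv_ge0 _) zr; rewrite pmulr_lgt0.
have inb t : nm t < 8 -> nv (p + t *: v - p) < r.
  move=> t8; rewrite addrAC subrr add0r nvZ.
  apply: le_lt_trans (_ : 8 * nv v < _).
    by apply: ler_wpM2r; rewrite ?nv_ge0 // ltW.
  by rewrite mulrC -ltr_pdivlMr.
pose u (j : 'I_N) t := H (p + t *: v) 0 j.
pose u' (j : 'I_N) t := 'd H (p + t *: v) v 0 j.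
pose k (j : 'I_M) t := K (p + t *: v) 0 j.
pose k' (j : 'I_M) t := 'd K (p + t *: v) v 0 j.
have hu j t : nm t < 8 -> cder (u j) t (u' j t).
  by move=> /inb tr; apply: line_cder; apply: dH; have [] := hr _ _ tr tr.
have hk j t : nm t < 8 -> cder (k j) t (k' j t).
  by move=> /inb tr; apply: line_cder; apply: dK; have [] := hr _ _ tr tr.
have := @calabi_disc R N M u u' k k' 8 hu hk _ _ _ 1 1.
have one6 : nm (1 : C) < 8 / 6 by rewrite nm1; lra.
have -> : dot u u 1 1 = A z z.
  by rewrite /dot /rev /u conjc1 scale1r /v addrC subrK.
have -> : dot k k 1 1 = B z z.
  by rewrite /dot /rev /k conjc1 scale1r /v addrC subrK.
have -> : dot u u 1 0 = A z p.
  by rewrite /dot /rev /u conjc0 scale1r scale0r addr0 /v addrC subrK.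
have -> : dot k k 1 0 = B z p.
  by rewrite /dot /rev /k conjc0 scale1r scale0r addr0 /v addrC subrK.
have -> : dot u u 0 1 = A p z.
  by rewrite /dot /rev /u conjc1 scale1r scale0r addr0 /v addrC subrK.
have -> : dot k k 0 1 = B p z.
  by rewrite /dot /rev /k conjc1 scale1r scale0r addr0 /v addrC subrK.
have -> : dot u u 0 0 = A p p by rewrite /dot /rev /u conjc0 scale0r addr0.
have -> : dot k k 0 0 = B p p by rewrite /dot /rev /k conjc0 scale0r addr0.
move=> E; apply/eqP; rewrite subr_eq0; apply/eqP; apply: E => //.
- move=> t t8; rewrite /dot /rev conjcK.
  by apply: fsHK; have [] := hr _ _ (inb _ t8) (inb _ t8).
- move=> s t s8 t8; have t8' : nm t^*%C < 8 by rewrite nm_conj.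
  by have [] := hr _ _ (inb _ s8) (inb _ t8').
- move=> s t s8 t8; have t8' : nm t^*%C < 8 by rewrite nm_conj.
  by have [] := hr _ _ (inb _ s8) (inb _ t8').
Qed.

(* T vanishes on the diagonal by the one-variable case on the line through p;
   polarize on the plane spanned by a and b. *)
Lemma calabi_polar (r : R) (a b : 'rV[C]_n) : 0 < r ->
  (forall z w, nv (z - p) < r -> nv (w - p) < r -> [/\ U z, A z w != 0 & B z w != 0]) ->
  nv a < r / 64 -> nv b < r / 64 ->
  T (p + 1 *: a + 'i%C *: b) (p + 1 *: a + - 'i%C *: b) = 0.
Proof.
move=> r0 hr ad bd; have Tr := calabi_diag hr.
(* Parameters of modulus below 4 are allowed, as [polar] divides by 3 and must reach 1 and [i]; with
   [a], [b] below [r / 64] all these points stay within [r / 8] of [p]. *)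
pose pt s t := p + s *: a + t *: b.
have inb s t : nm s < 4 -> nm t < 4 -> nv (pt s t - p) < r / 8.
  move=> s4 t4; rewrite /pt addrAC [p + _]addrC addrK.
  apply: le_lt_trans (nvD _ _) _; rewrite (nvZ s a) (nvZ t b).
  have -> : r / 8 = 4 * (r / 64) + 4 * (r / 64) by field.
  apply: ltrD; (apply: le_lt_trans (ler_wpM2r _ (ltW _)) _; [exact: nv_ge0|eassumption|]);
    by rewrite ltr_pM2l.
have r8 : r / 8 < r by rewrite ltr_pdivrMr // ltr_pMr // ltr1n.
have Upt s t : nm s < 4 -> nm t < 4 -> U (pt s t).
  move=> s4 t4; have x := lt_trans (inb _ _ s4 t4) r8.
  by have [] := hr _ _ x x.
have hs n' (F : 'rV[C]_n -> 'rV[C]_n') j s t : (forall z, U z -> differentiable F z) ->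
    nm s < 4 -> nm t < 4 -> hol1 (fun x => F (pt x t) 0 j) s.
  move=> dF s4 t4.
  have -> : (fun x => F (pt x t) 0 j) = (fun x => F ((p + t *: b) + x *: a) 0 j).
    by apply/funext => x; rewrite /pt addrAC.
  eexists; apply: line_cder; apply: dF.
  by have := Upt _ _ s4 t4; rewrite /pt addrAC.
have ht n' (F : 'rV[C]_n -> 'rV[C]_n') j s t : (forall z, U z -> differentiable F z) ->
    nm s < 4 -> nm t < 4 -> hol1 (fun x => F (pt s x) 0 j) t.
  by move=> dF s4 t4; eexists; apply: line_cder; apply: dF; exact: Upt.
have hrev (f : C -> C) (x : C) : hol1 f x^*%C -> hol1 (rev f) x.
  by move=> [l fl]; exists l^*%C; exact: cder_rev.
pose L n' (F : 'rV[C]_n -> 'rV[C]_n') (y : 'rV[C]_n') s t := \sum_j F (pt s t) 0 j * (y 0 j)^*%C.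
pose Rr n' (F : 'rV[C]_n -> 'rV[C]_n') (y : 'rV[C]_n') s t :=
  \sum_j y 0 j * (F (pt s^*%C t^*%C) 0 j)^*%C.
pose X n' (F : 'rV[C]_n -> 'rV[C]_n') s t :=
  \sum_j F (pt s t) 0 j * (F (pt s^*%C t^*%C) 0 j)^*%C.
have hLs n' (F : 'rV[C]_n -> 'rV[C]_n') y s t : (forall z, U z -> differentiable F z) ->
    nm s < 4 -> nm t < 4 -> hol1 (fun x => L _ F y x t) s.
  move=> dF s4 t4; apply: (@hol1_sum _ (fun j x => F (pt x t) 0 j * (y 0 j)^*%C)) => j.
  by apply: hol1M; [exact: hs|exact: hol1_cst].
have hLt n' (F : 'rV[C]_n -> 'rV[C]_n') y s t : (forall z, U z -> differentiable F z) ->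
    nm s < 4 -> nm t < 4 -> hol1 (fun x => L _ F y s x) t.
  move=> dF s4 t4; apply: (@hol1_sum _ (fun j x => F (pt s x) 0 j * (y 0 j)^*%C)) => j.
  by apply: hol1M; [exact: ht|exact: hol1_cst].
have hsr n' (F : 'rV[C]_n -> 'rV[C]_n') j s t : (forall z, U z -> differentiable F z) ->
    nm s < 4 -> nm t < 4 -> hol1 (fun x => (F (pt x^*%C t^*%C) 0 j)^*%C) s.
  move=> dF s4 t4; apply: (hrev (fun x => F (pt x t^*%C) 0 j)).
  by apply: hs; rewrite ?nm_conj.
have htr n' (F : 'rV[C]_n -> 'rV[C]_n') j s t : (forall z, U z -> differentiable F z) ->
    nm s < 4 -> nm t < 4 -> hol1 (fun x => (F (pt s^*%C x^*%C) 0 j)^*%C) t.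
  move=> dF s4 t4; apply: (hrev (fun x => F (pt s^*%C x) 0 j)).
  by apply: ht; rewrite ?nm_conj.
have hRs n' (F : 'rV[C]_n -> 'rV[C]_n') y s t : (forall z, U z -> differentiable F z) ->
    nm s < 4 -> nm t < 4 -> hol1 (fun x => Rr _ F y x t) s.
  move=> dF s4 t4; apply: (@hol1_sum _ (fun j x => y 0 j * (F (pt x^*%C t^*%C) 0 j)^*%C)) => j.
  by apply: hol1M; [exact: hol1_cst|exact: hsr].
have hRt n' (F : 'rV[C]_n -> 'rV[C]_n') y s t : (forall z, U z -> differentiable F z) ->
    nm s < 4 -> nm t < 4 -> hol1 (fun x => Rr _ F y s x) t.
  move=> dF s4 t4; apply: (@hol1_sum _ (fun j x => y 0 j * (F (pt s^*%C x^*%C) 0 j)^*%C)) => j.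
  by apply: hol1M; [exact: hol1_cst|exact: htr].
have hXs n' (F : 'rV[C]_n -> 'rV[C]_n') s t : (forall z, U z -> differentiable F z) ->
    nm s < 4 -> nm t < 4 -> hol1 (fun x => X _ F x t) s.
  move=> dF s4 t4.
  apply: (@hol1_sum _ (fun j x => F (pt x t) 0 j * (F (pt x^*%C t^*%C) 0 j)^*%C)) => j.
  by apply: hol1M; [exact: hs|exact: hsr].
have hXt n' (F : 'rV[C]_n -> 'rV[C]_n') s t : (forall z, U z -> differentiable F z) ->
    nm s < 4 -> nm t < 4 -> hol1 (fun x => X _ F s x) t.
  move=> dF s4 t4.
  apply: (@hol1_sum _ (fun j x => F (pt s x) 0 j * (F (pt s^*%C x^*%C) 0 j)^*%C)) => j.
  by apply: hol1M; [exact: ht|exact: htr].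
(* [T] at the points of parameters [(s, t)] and of the conjugate parameters, grouped so that each
   factor is visibly holomorphic in [s] and in [t]; real parameters give the diagonal of [T]. *)
pose Q s t := X _ H s t * Rr _ K (K p) s t * L _ K (K p) s t * A p p -
  X _ K s t * Rr _ H (H p) s t * L _ H (H p) s t * B p p.
have QT s t : Q s t = A (pt s t) (pt s^*%C t^*%C) * B p (pt s^*%C t^*%C) * B (pt s t) p * A p p
   - B (pt s t) (pt s^*%C t^*%C) * A p (pt s^*%C t^*%C) * A (pt s t) p * B p p by [].
have := @polar R Q 4 4 _ _ _ _ 1 'i%C.
rewrite nm1 nmi QT conjc1 conjCi; apply.
- by [].
- move=> s t s4 t4; apply: hol1B; (apply: hol1M; last exact: hol1_cst);
    (apply: hol1M; last exact: hLs); (apply: hol1M; last exact: hRs); exact: hXs.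
- move=> s t s4 t4; apply: hol1B; (apply: hol1M; last exact: hol1_cst);
    (apply: hol1M; last exact: hLt); (apply: hol1M; last exact: hRt); exact: hXt.
- move=> x y /andP[x0 x4] /andP[y0 y4]; rewrite QT !conjc_real; apply: Tr.
  by apply: inb; rewrite nmC gtr0_norm.
- by lra.
- by lra.
Qed.

Lemma calabi_local : exists2 d : R, 0 < d & forall z w, nv (z - p) < d -> nv (w - p) < d ->
  [/\ U z, T z w = 0, A z p != 0 & B z p != 0].
Proof.
have [r r0 hr] := calabi_ball.
have p0 : nv (p - p) < r by rewrite subrr nv0.
have dr : r / 64 < r by rewrite ltr_pdivrMr // ltr_pMr // ltr1n.
exists (r / 64); first by rewrite divr_gt0.
move=> z w zd wd.
have zr := lt_trans zd dr; have wr := lt_trans wd dr.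
split; try by have [] := hr _ _ zr p0.
have C2 : nm (2 : C) = 2 by rewrite -[2 : C](rmorph_nat (real_complex R)) nmC normr_nat.
have ad : nv (2^-1 *: ((z - p) + (w - p))) < r / 64.
  rewrite nvZ nmV C2 mulrC ltr_pdivrMr //; apply: le_lt_trans (nvD _ _) _.
  by rewrite mulr_natr mulr2n ltrD.
have bd : nv ((- 'i%C / 2) *: ((z - p) - (w - p))) < r / 64.
  rewrite nvZ nmM nmN nmi mul1r nmV C2 mulrC ltr_pdivrMr //; apply: le_lt_trans (nvD _ _) _.
  by rewrite nvN mulr_natr mulr2n ltrD.
have := calabi_polar r0 hr ad bd.
have i2 : 'i%C * 'i%C = -1 :> C by rewrite -expr2 sqr_i.
by rewrite (polar_point1 z w i2 p) (polar_point2 z w i2 p).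
Qed.

End Calabi.

Lemma scalar_line_cder n (g : 'rV[C]_n -> C) p v t : differentiable g (p + t *: v) ->
  hol1 (fun s => g (p + s *: v)) t.
Proof.
move=> dg.
have D1 : is_diff t (fun s : C => p + s *: v) (fun s => s *: v).
  by apply: is_diff_eq; rewrite add0r.
have D2 : is_diff (p + t *: v) g ('d g (p + t *: v)) by exact: DiffDef.
have D3 := @is_diff_comp _ _ _ _ _ _ _ _ _ D1 D2.
have /derivable1_diffP d1 := @ex_diff _ _ _ _ _ _ _ D3.
by eexists; apply: is_derive_cder; apply: derivableP; exact: d1.
Qed.

(* The zero set has an interior that is relatively closed: near a limit point,
   restrict to complex lines through a point of the interior. *)
Lemma identity_theorem n (g : 'rV[C]_n -> C) (U : set 'rV[C]_n) p (r : R) :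
  open U -> connected U -> (forall z, U z -> differentiable g z) ->
  U p -> 0 < r -> (forall z, nv (z - p) < r -> g z = 0) -> forall z, U z -> g z = 0.
Proof.
move=> oU cU dg Up r0 g0.
pose S := [set z | U z /\ exists2 d : R, 0 < d & forall w, nv (w - z) < d -> g w = 0].
have US z : S z -> g z = 0 by move=> [_ [d d0]]; apply; rewrite subrr nv0.
suff SU : S = U by move=> z; rewrite -SU; exact: US.
apply: cU.
- by exists p; split=> //; exists r.
- exists S; last by apply/seteqP; split=> z; [move=> Sz; split=> //; case: Sz|case].
  rewrite openE => z [Uz [d d0 dP]].
  have [d' d'0 d'P] := open_nv oU Uz.
  have m0 : 0 < Num.min d' (d / 2) by rewrite lt_min d'0 divr_gt0.
  apply: (near_nv m0) => w; rewrite lt_min => /andP[/d'P Uw wd].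
  split=> //; exists (d / 2); first by rewrite divr_gt0.
  move=> x xw; apply: dP; rewrite -(subrK w x) -addrA.
  by apply: le_lt_trans (nvD _ _) _; rewrite [d]splitr ltrD.
exists (closure S); first exact: closed_closure.
apply/seteqP; split=> z; first by move=> Sz; split; [case: Sz|exact: subset_closure].
move=> [Uz cz]; split=> //; have [d d0 dP] := open_nv oU Uz.
have d16 : 0 < d / 16 by rewrite divr_gt0.
have [s [[Us [e e0 eP]] sz]] := cz _ (near_nv d16 (fun w => id)).
exists (d / 16) => // w wz.
have ws : nv (w - s) < d / 8.
  rewrite -(subrK z w) -addrA; apply: le_lt_trans (nvD _ _) _.
  have -> : d / 8 = d / 16 + d / 16 by field.
  by apply: ltrD => //; rewrite -nvN opprB.
(* The line from [s] reaches [w] at parameter 1, and [identity_disc] loses a factor 3, so the line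
   must stay in [U] up to modulus 4. *)
have Ut t : nm t < 4 -> U (s + t *: (w - s)).
  move=> t4; apply: dP; rewrite addrAC; apply: le_lt_trans (nvD _ _) _.
  rewrite nvZ; have -> : d = d / 2 + 4 * (d / 8) by field.
  apply: ltr_leD; last by apply: ler_pM; rewrite ?nv_ge0 ?nm_ge0 // ltW.
  by apply: lt_trans sz _; rewrite ltr_pM2l // ltf_pV2 ?posrE // ltr_nat.
have -> : w = s + 1 *: (w - s) by rewrite scale1r addrC subrK.
have v0 : 0 < nv (w - s) + 1 by rewrite ltr_wpDl ?nv_ge0.
apply: (@identity_disc _ (fun t => g (s + t *: (w - s))) 4 (e / (nv (w - s) + 1))).
- by rewrite divr_gt0.
- by move=> t t4; apply: scalar_line_cder; apply/dg/Ut.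
- move=> t /andP[t0 te]; apply: eP; rewrite addrAC subrr add0r nvZ nmC gtr0_norm //.
  apply: le_lt_trans (_ : t * (nv (w - s) + 1) < e); last by rewrite -ltr_pdivlMr.
  by rewrite ler_pM2l // lerDl.
- by rewrite nm1; lra.
Qed.

End SeveralVariables.

(** * Affine syzygies *)

Section AffineSyzygies.
Variable R : realType.
Local Notation C := (R[i]).
Local Notation nm := (@Normc.normc R).
Variable n : nat.
Implicit Types (x p u : 'rV[C]_n).

Definition affine x : 'rV[C]_(1 + n) := row_mx 1%:M x.

(** A linear relation among the products of the coordinates of [(1, x)] with the [w j] is the
    identical vanishing of this sum; column [j] of [M] is the affine coefficient of [w j]. *)
Definition syz k (w : 'I_k -> 'rV[C]_n -> C) (M : 'M[C]_(1 + n, k)) x : C :=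
  \sum_j (affine x *m M) 0 j * w j x.

Lemma linear_hom (V W : vectType C) (f : V -> W) : linear f ->
  exists g : 'Hom(V, W), forall v, g v = f v.
Proof.
move=> lf; pose fM := GRing.isLinear.Build _ _ _ _ f lf.
pose fL : {linear V -> W} := HB.pack f fM.
by exists (linfun fL) => v; rewrite lfunE.
Qed.

Lemma hol1_punctured (f : C -> C) (d : R) : 0 < d -> hol1 f 0 ->
  (forall t, t != 0 -> nm t < d -> f t = 0) -> f 0 = 0.
Proof.
move=> d0 [l /cder_cont /cont_nm cf] f0; apply/eqP; rewrite -nm_eq0 eq_le nm_ge0 andbT.
apply/ler_addgt0Pl => e /cf[d' d'0 dP]; rewrite addr0.
pose t := Num.min d d' / 2.
have m0 : 0 < Num.min d d' by rewrite lt_min d0.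
have t0 : 0 < t by rewrite divr_gt0.
have tm : t < Num.min d d' by rewrite /t ltr_pdivrMr // ltr_pMr // ltr1n.
have nt : nm t%:C = t by rewrite nmC gtr0_norm.
have /andP[td td'] : (t < d) && (t < d') by rewrite -lt_min.
have := dP t%:C; rewrite subr0 nt => /(_ td'); rewrite f0 ?nt //.
  by rewrite sub0r nmN => /ltW.
by rewrite -nm_gt0 nt.
Qed.

Lemma affine_line p u t : affine (p + t *: u) = affine p + t *: row_mx 0 u.
Proof. by rewrite /affine scale_row_mx scaler0 add_row_mx addr0. Qed.

(* Dividing the syzygy along the line p + t u by t and letting t tend to 0. *)
Lemma syz_at_kernel k (w : 'I_k -> 'rV[C]_n -> C) (U : set 'rV[C]_n) (M : 'M[C]_(1 + n, k)) p :
  (forall u, exists2 d : R, 0 < d & forall t, nm t < d -> U (p + t *: u)) ->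
  (forall u j, hol1 (fun t => w j (p + t *: u)) 0) ->
  (forall x, U x -> syz w M x = 0) ->
  affine p *m M = 0 -> M *m (\col_j w j p) = 0.
Proof.
move=> lU hw sM pM.
pose xi := M *m (\col_j w j p).
have H u : row_mx 0 u *m xi = 0.
  have [d d0 dP] := lU u.
  pose f t := \sum_j (row_mx 0 u *m M) 0 j * w j (p + t *: u).
  have f0 : f 0 = 0.
    apply: (hol1_punctured d0).
      apply: (@hol1_sum _ _ (fun j t => (row_mx 0 u *m M) 0 j * w j (p + t *: u))) => j.
      by apply: hol1M => //; exact: hol1_cst.
    move=> t t0 /dP /sM; rewrite /syz affine_line mulmxDl pM add0r -scalemxAl.
    under eq_bigr do rewrite mxE -mulrA.
    by rewrite -mulr_sumr => /eqP; rewrite mulf_eq0 (negbTE t0) => /eqP.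
  apply/matrixP => i j; rewrite !ord1 mulmxA [RHS]mxE -f0 /f mxE.
  by apply: eq_bigr => l _; rewrite [in RHS]scale0r addr0 [X in _ * X]mxE.
have X : affine p *m xi = 0 by rewrite mulmxA pM mul0mx.
(* The lines through [p] only test the directions [(0, u)]; the missing first coordinate comes from
   the row [(1, p)], which [M] annihilates. *)
have E : (row_mx 1%:M 0 : 'rV[C]_(1 + n)) *m xi = 0.
  have := X; rewrite -[affine p](subrK (row_mx 0 p)) mulmxDl H addr0.
  by rewrite /affine opp_row_mx add_row_mx oppr0 addr0 subrr.
rewrite -/xi -[xi]mul1mx.
have -> : 1%:M = col_mx (row_mx 1%:M 0) (row_mx 0 1%:M) :> 'M[C]_(1 + n).
  by rewrite -block_mxEv -scalar_mx_block.
have E2 : (row_mx 0 1%:M : 'M[C]_(n, 1 + n)) *m xi = 0.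
  by apply/row_matrixP => i; rewrite row_mul row_row_mx !row0 H.
by rewrite mul_col_mx E E2 col_mx0.
Qed.

(* Induction on k. Fix p with w p <> 0. The row (1, p) M is orthogonal to w p, so
   that it takes values in a space of dimension k - 1; when it vanishes, M kills
   w p and is a syzygy of k - 1 functions, the w_i reduced modulo w_j. *)
Lemma syz_dim k (w : 'I_k -> 'rV[C]_n -> C) (U : set 'rV[C]_n) (S : {vspace 'M[C]_(1 + n, k)}) :
  (forall p u, U p -> exists2 d : R, 0 < d & forall t, nm t < d -> U (p + t *: u)) ->
  (forall p u j, U p -> hol1 (fun t => w j (p + t *: u)) 0) ->
  (forall c : 'I_k -> C, (forall x, U x -> \sum_j c j * w j x = 0) -> forall j, c j = 0) ->
  (forall M, M \in S -> forall x, U x -> syz w M x = 0) ->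
  (\dim S <= 'C(k, 2))%N.
Proof.
move=> lU; elim: k w S => [|k IH] w S hw iw sS.
  rewrite bin0n /=; apply: leq_trans (dimvS (subvf S)) _.
  by rewrite dimvf /dim /= muln0.
have [p [Up [j wp]]] : exists p, U p /\ exists j, w j p != 0.
  apply: contrapT => N.
  suff E : (1 : C) = 0 by move/eqP: E; rewrite oner_eq0.
  apply: (iw (fun=> 1) _ ord0) => x Ux; apply: big1 => j _; rewrite mul1r.
  by apply: contrapT => /eqP wx; apply: N; exists x; split=> //; exists j.
pose a (i : 'I_k) := w (lift j i) p / w j p.
pose w' (i : 'I_k) x := w (lift j i) x - a i * w j x.
(* The row [(1, p) M] is orthogonal to [w p] and [w j p] is nonzero, so its other [k] entries
   determine it and column [j] may be dropped. *)
have [|eta etaE] := @linear_hom 'M[C]_(1 + n, k.+1) 'rV[C]_k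
    (fun M => col' j (affine p *m M)).
  by move=> c M N; apply/rowP => i; rewrite mulmxDr -scalemxAr !mxE.
have [|del delE] := @linear_hom 'M[C]_(1 + n, k.+1) 'M[C]_(1 + n, k) (fun M => col' j M).
  by move=> c M N; apply/matrixP => i i'; rewrite !mxE.
pose S0 := (S :&: lker eta)%VS.
have S0P M : M \in S0 -> M \in S /\ M *m (\col_i w i p) = 0.
  rewrite memv_cap memv_ker etaE => /andP[MS /eqP eM]; split=> //.
  apply: (@syz_at_kernel _ _ U) => //; [by move=> u; apply: lU|by move=> u i; apply: hw|exact: sS|].
  have c0 i : i != j -> (affine p *m M) 0 i = 0.
    case: (unliftP j i) => [i' -> _|->]; last by rewrite eqxx.
    by have /rowP/(_ i') := eM; rewrite mxE [RHS]mxE.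
  have := sS _ MS _ Up; rewrite /syz (bigD1 j) //= big1 ?addr0; last first.
    by move=> i /c0 ->; rewrite mul0r.
  move/eqP; rewrite mulf_eq0 (negbTE wp) orbF => /eqP cj.
  apply/rowP => i; rewrite [RHS]mxE.
  by have [->|/c0 //] := eqVneq i j.
have sum_lift (F : 'I_k.+1 -> C) : \sum_i F i = F j + \sum_(i < k) F (lift j i).
  by rewrite (bigD1_ord j).
have wpM M i : M *m (\col_i w i p) = 0 -> M i j = - \sum_(l < k) M i (lift j l) * a l.
  move=> /colP/(_ i); rewrite !mxE sum_lift mxE => E.
  apply: (mulIf wp); apply/eqP; rewrite -subr_eq0 mulNr opprK mulr_suml -[X in _ == X]E.
  apply/eqP; congr (_ + _); apply: eq_bigr => l _.
  by rewrite mxE -mulrA divfK.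
have dS : (\dim S <= \dim S0 + k)%N.
  rewrite -(limg_ker_dim eta S) leq_add2l; apply: leq_trans (dimvS (subvf _)) _.
  by rewrite dimvf /dim /= mul1n.
(* On [S0] the relation [M *m w p = 0] recovers column [j] from the others, so deleting it is
   injective. *)
have dS0 : \dim (del @: S0)%VS = \dim S0.
  apply: limg_dim_eq; apply/eqP; rewrite -subv0; apply/subvP => M.
  rewrite memv_cap memv_ker delE memv0 => /andP[/S0P[_ /wpM Mj] /eqP dM].
  have Ml i l : M i (lift j l) = 0 by have /matrixP/(_ i l) := dM; rewrite !mxE.
  apply/eqP/matrixP => i l; rewrite [RHS]mxE.
  case: (unliftP j l) => [l' ->|->]; first exact: Ml.
  by rewrite Mj big1 ?oppr0 // => l' _; rewrite Ml mul0r.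
rewrite binS bin1; apply: leq_trans dS _; rewrite leq_add2r -dS0.
apply: (IH w') => [q u i Uq|c c0 i|M].
- by apply: hol1B; [exact: hw|apply: hol1M; [exact: hol1_cst|exact: hw]].
- pose c' l := if unlift j l is Some l' then c l' else - \sum_(l < k) c l * a l.
  have := iw c' _ (lift j i); rewrite /c' liftK; apply => x Ux.
  rewrite -[RHS](c0 x Ux) sum_lift unlift_none mulNr mulr_suml addrC -sumrB.
  apply: eq_bigr => l _; rewrite liftK /w'; ring.
- move=> /memv_imgP[N /S0P[NS /wpM Nj] ->] x Ux; rewrite delE.
  rewrite -[RHS](sS _ NS _ Ux) /syz sum_lift addrC.
  have -> : (affine x *m N) 0 j = - \sum_(l < k) (affine x *m N) 0 (lift j l) * a l.
    rewrite mxE; under eq_bigr do rewrite Nj mulrN mulr_sumr.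
    rewrite sumrN exchange_big /=; congr (- _); apply: eq_bigr => l _.
    by rewrite mxE mulr_suml; apply: eq_bigr => i _; rewrite mulrA.
  rewrite mulNr mulr_suml -sumrB; apply: eq_bigr => l _.
  have -> : (affine x *m col' j N) 0 l = (affine x *m N) 0 (lift j l).
    by rewrite mxE [RHS]mxE; apply: eq_bigr => i _; rewrite [X in _ * X]mxE.
  by rewrite /w'; ring.
Qed.

End AffineSyzygies.

(** * The Fubini-Study form and the Segre map *)

Section FubiniStudyFormula.
Variable R : realType.
Local Notation C := (R[i]).
Variable N : nat.
Implicit Types (z u v w : 'rV[C]_N) (t : R).

(** The real inner product of the underlying real vectors, half the first-order variation of
    [sqnorm]. *)
Definition redot z v : R := \sum_(i < N)
  (complex.Re (z 0 i) * complex.Re (v 0 i) + complex.Im (z 0 i) * complex.Im (v 0 i)).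

Lemma Re_line z v t i :
  complex.Re ((z + t%:C *: v) 0 i) = complex.Re (z 0 i) + t * complex.Re (v 0 i).
Proof. by rewrite !mxE; case: (z 0 i) (v 0 i) => a b [c d] /=; rewrite mul0r subr0. Qed.

Lemma Im_line z v t i :
  complex.Im ((z + t%:C *: v) 0 i) = complex.Im (z 0 i) + t * complex.Im (v 0 i).
Proof. by rewrite !mxE; case: (z 0 i) (v 0 i) => a b [c d] /=; rewrite mul0r addr0. Qed.

Lemma sqnorm_line z v t :
  sqnorm (z + t%:C *: v) = sqnorm z + t * (2 * redot z v) + t ^+ 2 * sqnorm v.
Proof.
rewrite /sqnorm /redot !mulr_sumr -!big_split /=; apply: eq_bigr => i _.
by rewrite Re_line Im_line; ring.
Qed.

Lemma sqnorm_ge0 z : 0 <= sqnorm z.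
Proof. by apply: sumr_ge0 => i _; rewrite addr_ge0 ?sqr_ge0. Qed.

Lemma sqnorm1_gt0 z : 0 < 1 + sqnorm z.
Proof. by rewrite ltr_wpDr ?sqnorm_ge0. Qed.

Lemma is_derive_quadratic (a b c : R) :
  is_derive (0 : R) (1 : R) (fun t => a + t * b + t ^+ 2 * c) b.
Proof.
have -> : (fun t => a + t * b + t ^+ 2 * c) = horner (a%:P + b *: 'X + c *: 'X^2).
  by apply/funext => t; rewrite !hornerD hornerC !hornerZ hornerX hornerXn; ring.
apply: is_derive_eq.
rewrite derivD derivD derivC derivZ derivX derivZ derivXn add0r.
by rewrite hornerD !hornerZ hornerC hornerMn hornerXn; ring.
Qed.

Lemma is_derive_sqnorm z v :
  is_derive (0 : R) (1 : R) (fun t => 1 + sqnorm (z + t%:C *: v)) (2 * redot z v).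
Proof.
have -> : (fun t => 1 + sqnorm (z + t%:C *: v)) =
    (fun t => (1 + sqnorm z) + t * (2 * redot z v) + t ^+ 2 * sqnorm v).
  by apply/funext => t; rewrite sqnorm_line; ring.
exact: is_derive_quadratic.
Qed.

Definition lnsq z : C := (ln (1 + sqnorm z))%:C.

Lemma rderive_lnsq z v : rderive lnsq v z = (2 * redot z v / (1 + sqnorm z))%:C.
Proof.
have z0 : z + 0%:C *: v = z by rewrite scale0r addr0.
rewrite /rderive /lnsq /= derive1_cst; congr (_ +i* _).
have H1 := is_derive_sqnorm z v.
have H2 : is_derive (1 + sqnorm (z + 0%:C *: v)) (1 : R) (@ln R) (1 + sqnorm (z + 0%:C *: v))^-1.
  exact: (is_derive1_ln (sqnorm1_gt0 _)).
have H3 := @is_derive1_comp _ _ (fun t => 1 + sqnorm (z + t%:C *: v)) _ _ _ H2 H1.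
by rewrite derive1E (@derive_val _ _ _ _ _ _ _ H3) z0 mulrC.
Qed.

Lemma redot_e z k : redot z (delta_mx 0 k) = complex.Re (z 0 k).
Proof.
rewrite /redot (bigD1 k) //= big1 ?addr0 => [|i ik]; rewrite !mxE eqxx ?eqxx /=.
  by rewrite mulr1 mulr0 addr0.
by rewrite (negbTE ik) /= !mulr0 addr0.
Qed.

Lemma redot_ie z k : redot z ('i%C *: delta_mx 0 k) = complex.Im (z 0 k).
Proof.
rewrite /redot (bigD1 k) //= big1 ?addr0 => [|i ik]; rewrite !mxE eqxx ?eqxx /=.
  by ring.
by rewrite (negbTE ik) mulr0 /= !mulr0 addr0.
Qed.

Definition sq z : C := (1 + sqnorm z)%:C.

Lemma sq_neq0 z : sq z != 0.
Proof. by rewrite -nm_gt0 nmC normr_gt0 gt_eqF // sqnorm1_gt0. Qed.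

Lemma dzbar_lnsq k : dzbar k lnsq = fun z => z 0 k / sq z.
Proof.
apply/funext => z; rewrite /dzbar !rderive_lnsq redot_e redot_ie.
have E (x : R) : (2 * x / (1 + sqnorm z))%:C = 2 * x%:C / sq z :> C.
  by rewrite rmorphM rmorphM fmorphV rmorph_nat.
rewrite !E [X in _ = X / _]complexE.
have := sq_neq0 z; move: (sq z) (_%:C) (_%:C) => s a b s0.
by field.
Qed.

Lemma rderive_quot k z v : rderive (fun x => x 0 k / sq x) v z =
  (v 0 k * sq z - z 0 k * (2 * redot z v)%:C) / sq z ^+ 2.
Proof.
have z0 : z + 0%:C *: v = z by rewrite scale0r addr0.
have ReM (x : C) (r : R) : complex.Re (x / r%:C) = complex.Re x / r.
  by rewrite -fmorphV; case: x => a b /=; rewrite mulr0 subr0.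
have ImM (x : C) (r : R) : complex.Im (x / r%:C) = complex.Im x / r.
  by rewrite -fmorphV; case: x => a b /=; rewrite mulr0 add0r.
have H1 := is_derive_sqnorm z v.
have s0 : 1 + sqnorm (z + 0%:C *: v) != 0 by rewrite gt_eqF // sqnorm1_gt0.
have H2 := @is_deriveV _ (fun t => 1 + sqnorm (z + t%:C *: v)) _ _ _ s0 H1.
have D (a b : R) : derive1 (fun t => (a + t * b) / (1 + sqnorm (z + t%:C *: v))) 0 =
    (b * (1 + sqnorm z) - a * (2 * redot z v)) / (1 + sqnorm z) ^+ 2.
  have H3 : is_derive (0 : R) (1 : R) (fun t => a + t * b) b.
    have := is_derive_quadratic a b 0; congr is_derive; apply/funext => t.
    by rewrite mulr0 addr0.
  have H4 := @is_deriveM _ _ _ _ _ _ _ _ H3 H2.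
  rewrite derive1E (@derive_val _ _ _ _ _ _ _ H4).
  rewrite z0 /GRing.scale /=; have := gt_eqF (sqnorm1_gt0 z).
  by move: (1 + sqnorm z) => s /negbT s1; field.
have ReMr (x : C) (r : R) : complex.Re (x * r%:C) = complex.Re x * r.
  by case: x => a b /=; rewrite mulr0 subr0.
have ImMr (x : C) (r : R) : complex.Im (x * r%:C) = complex.Im x * r.
  by case: x => a b /=; rewrite mulr0 add0r.
have sq2 : sq z ^+ 2 = ((1 + sqnorm z) ^+ 2)%:C by rewrite rmorphXn.
apply/eqP; rewrite eq_complex; apply/andP; split; apply/eqP.
  rewrite sq2 ReM ReB !ReMr -D /=; congr (derive1 _ 0); apply/funext => t.
  by rewrite ReM Re_line.
rewrite sq2 ImM ImB !ImMr -D /=; congr (derive1 _ 0); apply/funext => t.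
by rewrite ImM Im_line.
Qed.

Lemma dz_dzbar_lnsq j k z : dz j (dzbar k lnsq) z =
  ((j == k)%:R * sq z - (z 0 j)^*%C * z 0 k) / sq z ^+ 2.
Proof.
rewrite dzbar_lnsq /dz !rderive_quot redot_e redot_ie !mxE eqxx /=.
have -> : (z 0 j)^*%C = (complex.Re (z 0 j))%:C - 'i%C * (complex.Im (z 0 j))%:C.
  rewrite [in LHS](complexE (z 0 j)) conjCD conjCM !conjc_real conjCi.
  by rewrite mulNr.
have E (x : R) : (2 * x)%:C = 2 * x%:C :> C by rewrite rmorphM rmorph_nat.
rewrite !E [k == j]eq_sym; have := sq_neq0 z.
move: (sq z) (complex.Re _)%:C (complex.Im _)%:C (z 0 k) (_%:R) => s a b x e s0.
have i2 : 'i%C * 'i%C = -1 :> C by rewrite -expr2 sqr_i.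
have -> : ((e * s - x * (2 * a)) / s ^+ 2 - 'i%C * (('i%C * e * s - x * (2 * b)) / s ^+ 2)) / 2 =
  ((e * s - x * (2 * a)) - (('i%C * 'i%C) * e * s - 'i%C * x * (2 * b))) / s ^+ 2 / 2 by ring.
by rewrite i2; field.
Qed.

Definition tangent (z : 'rV[C]_N) : 'rV[C]_(1 + N) := row_mx 0 z.

Lemma herm_row m (a b : 'rV[C]_1) (x y : 'rV[C]_m) :
  herm (row_mx a x) (row_mx b y) = a 0 0 * (b 0 0)^*%C + herm x y.
Proof.
rewrite /herm big_split_ord /= big_ord1 !row_mxEl; congr (_ + _).
by apply: eq_bigr => i _; rewrite !row_mxEr.
Qed.

Lemma herm_sqnorm z : herm z z = (sqnorm z)%:C.
Proof.
rewrite /herm /sqnorm rmorph_sum; apply: eq_bigr => i _ /=.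
exact: (etrans (esym (sqr_normc _)) (esym (add_Re2_Im2 _))).
Qed.

(* The Fubini-Study hermitian form in homogeneous coordinates W. *)
Definition fsQ m (W U V : 'rV[C]_m) : C :=
  (herm W W * herm U V - herm U W * herm W V) / herm W W ^+ 2.

Lemma herm_affine z w : herm (affine z) (affine w) = 1 + herm z w.
Proof. by rewrite herm_row !mxE eqxx conjc1 mulr1. Qed.

Lemma herm_tangent v w : herm (tangent v) (tangent w) = herm v w.
Proof. by rewrite herm_row !mxE mul0r add0r. Qed.

Lemma herm_affine_tangent z v : herm (affine z) (tangent v) = herm z v.
Proof. by rewrite herm_row !mxE conjc0 mulr0 add0r. Qed.

Lemma herm_tangent_affine v z : herm (tangent v) (affine z) = herm v z.
Proof. by rewrite herm_row !mxE mul0r add0r. Qed.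

Lemma herm_affine_sq z : herm (affine z) (affine z) = sq z.
Proof. by rewrite herm_affine herm_sqnorm /sq rmorphD rmorph1. Qed.

Lemma levi_sum w u v : \sum_(j < N) \sum_(k < N)
    dz j (dzbar k lnsq) w * (u 0 j * (v 0 k)^*%C) = fsQ (affine w) (tangent u) (tangent v).
Proof.
rewrite /fsQ herm_affine_sq herm_tangent herm_tangent_affine herm_affine_tangent.
under eq_bigr => j _ do under eq_bigr => k _ do rewrite dz_dzbar_lnsq.
have E : \sum_(j < N) \sum_(k < N) (j == k)%:R * (u 0 j * (v 0 k)^*%C) = herm u v.
  apply: eq_bigr => j _; rewrite (bigD1 j) //= eqxx mul1r big1 ?addr0 // => k kj.
  by rewrite eq_sym (negbTE kj) mul0r.
rewrite -E /herm big_distrlr /= mulr_sumr -sumrB mulr_suml; apply: eq_bigr => j _.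
rewrite mulr_sumr -sumrB mulr_suml; apply: eq_bigr => k _.
by have := sq_neq0 w; move: (sq w) => s s0; field.
Qed.

Lemma fubini_fsQ w u v : fubini_study R N w u v = 'i%C / (2 * pi)%:C *
  (fsQ (affine w) (tangent u) (tangent v) - fsQ (affine w) (tangent v) (tangent u)).
Proof.
rewrite /fubini_study -!levi_sum -sumrB; congr (_ * _); apply: eq_bigr => j _.
by rewrite -sumrB; apply: eq_bigr => k _; rewrite mulrBr.
Qed.

End FubiniStudyFormula.

(** * Differentials in homogeneous coordinates and the Segre map *)

Section Differentials.
Variable R : realType.
Local Notation C := (R[i]).

Lemma differentiable_comp_coord n N (F : 'rV[C]_n -> 'rV[C]_N) p j : differentiable F p ->
  differentiable (fun z => F z 0 j : C) p.
Proof.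
move=> dF; exact: (@differentiable_comp _ _ _ _ F (fun M : 'rV[C]_N => M 0 j : C) p dF
  (@differentiable_coord _ 1 N (F p) 0 j)).
Qed.

Lemma differentiable_rV n N (F : 'rV[C]_n -> 'rV[C]_N) p :
  (forall j, differentiable (fun z => F z 0 j : C) p) -> differentiable F p.
Proof.
move=> dF.
have -> : F = \sum_(j < N) (fun z => F z 0 j *: (delta_mx 0 j : 'rV[C]_N)).
  by apply/funext => z; rewrite fct_sumE {1}[F z]row_sum_delta.
by apply: differentiable_sum => j; apply: differentiableZl.
Qed.

Lemma d_coord n N (F : 'rV[C]_n -> 'rV[C]_N) p v j : differentiable F p ->
  cder (fun t => F (p + t *: v) 0 j) 0 (('d F p v) 0 j).
Proof.
move=> dF; have := @line_cder _ _ _ F p v 0 j.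
by rewrite scale0r addr0; apply.
Qed.

Lemma d_coord_unique n N (F : 'rV[C]_n -> 'rV[C]_N) p v j l : differentiable F p ->
  cder (fun t => F (p + t *: v) 0 j) 0 l -> ('d F p v) 0 j = l.
Proof. by move=> /(d_coord v j); exact: cder_unique. Qed.

Lemma differentiable_affine n m (h : 'rV[C]_n -> 'rV[C]_m) p : differentiable h p ->
  differentiable (fun z => affine (h z)) p.
Proof.
move=> dh; apply: differentiable_rV => j; rewrite /affine.
case: (splitP j) => k jk; last first.
  have -> : j = rshift 1 k by apply/val_inj; rewrite /= jk.
  have -> : (fun z => row_mx 1%:M (h z) 0 (rshift 1 k)) = (fun z => h z 0 k : C).
    by apply/funext => z; rewrite row_mxEr.
  exact: differentiable_comp_coord.
have -> : j = lshift m k by apply/val_inj; rewrite /= jk.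
have -> : (fun z => row_mx 1%:M (h z) 0 (lshift m k)) = (fun=> (1%:M : 'M[C]_1) 0 k).
  by apply/funext => z; rewrite row_mxEl.
exact: differentiable_cst.
Qed.

Lemma d_affine n m (h : 'rV[C]_n -> 'rV[C]_m) p v : differentiable h p ->
  'd (fun z => affine (h z)) p v = tangent ('d h p v).
Proof.
move=> dh; apply/rowP => j; apply: d_coord_unique; first exact: differentiable_affine.
rewrite /affine /tangent; case: (splitP j) => k jk; last first.
  have -> : j = rshift 1 k by apply/val_inj; rewrite /= jk.
  rewrite row_mxEr.
  have -> : (fun t : C => row_mx 1%:M (h (p + t *: v)) 0 (rshift 1 k)) =
      (fun t => h (p + t *: v) 0 k) by apply/funext => t; rewrite row_mxEr.
  exact: d_coord.
have -> : j = lshift m k by apply/val_inj; rewrite /= jk.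
rewrite row_mxEl [X in cder _ _ X]mxE.
have -> : (fun t : C => row_mx 1%:M (h (p + t *: v)) 0 (lshift m k)) =
    (fun=> (1%:M : 'M[C]_1) 0 k) by apply/funext => t; rewrite row_mxEl.
exact: cder_cst.
Qed.

Lemma d_id n (p v : 'rV[C]_n) : 'd (fun z : 'rV[C]_n => z) p v = v.
Proof.
by have E := is_diff_id p; rewrite (@diff_val _ _ _ _ _ _ _ E).
Qed.

Definition segre a b (x : 'rV[C]_a) (y : 'rV[C]_b) : 'rV[C]_(a * b) := mxvec (x^T *m y).

Lemma segreE a b (x : 'rV[C]_a) (y : 'rV[C]_b) i j :
  segre x y 0 (mxvec_index i j) = x 0 i * y 0 j.
Proof. by rewrite mxvecE mxE big_ord1 mxE. Qed.

Lemma sum_mxvec a b (F : 'I_(a * b) -> C) : \sum_c F c = \sum_i \sum_j F (mxvec_index i j).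
Proof.
rewrite (reindex _ (curry_mxvec_bij a b)) /= pair_bigA /=.
by apply: eq_bigr => -[i j] _.
Qed.

Lemma herm_segre a b (x x' : 'rV[C]_a) (y y' : 'rV[C]_b) :
  herm (segre x y) (segre x' y') = herm x x' * herm y y'.
Proof.
rewrite /herm sum_mxvec big_distrlr /=; apply: eq_bigr => i _; apply: eq_bigr => j _.
by rewrite !segreE conjCM mulrACA.
Qed.

Lemma differentiable_segre n a b (X : 'rV[C]_n -> 'rV[C]_a) (Y : 'rV[C]_n -> 'rV[C]_b) p :
  differentiable X p -> differentiable Y p ->
  differentiable (fun z => segre (X z) (Y z)) p.
Proof.
move=> dX dY; apply: differentiable_rV => c.
case/mxvec_indexP: c => i j.
have -> : (fun z => segre (X z) (Y z) 0 (mxvec_index i j)) = (fun z => X z 0 i * Y z 0 j).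
  by apply/funext => z; rewrite segreE.
apply: (differentiableM (f := fun z => X z 0 i) (g := fun z => Y z 0 j));
  exact: differentiable_comp_coord.
Qed.

Lemma d_segre n a b (X : 'rV[C]_n -> 'rV[C]_a) (Y : 'rV[C]_n -> 'rV[C]_b) p v :
  differentiable X p -> differentiable Y p ->
  'd (fun z => segre (X z) (Y z)) p v = segre ('d X p v) (Y p) + segre (X p) ('d Y p v).
Proof.
move=> dX dY; apply/rowP => c; apply: d_coord_unique; first exact: differentiable_segre.
case/mxvec_indexP: c => i j; rewrite mxE !segreE.
have -> : (fun t : C => segre (X (p + t *: v)) (Y (p + t *: v)) 0 (mxvec_index i j)) =
    (fun t => X (p + t *: v) 0 i * Y (p + t *: v) 0 j) by apply/funext => t; rewrite segreE.
by have := cderM (d_coord v i dX) (d_coord v j dY); rewrite scale0r addr0.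
Qed.

Lemma hermDl N (x y z : 'rV[C]_N) : herm (x + y) z = herm x z + herm y z.
Proof. by rewrite -big_split; apply: eq_bigr => j _; rewrite mxE mulrDl. Qed.

Lemma hermDr N (x y z : 'rV[C]_N) : herm z (x + y) = herm z x + herm z y.
Proof. by rewrite -big_split; apply: eq_bigr => j _; rewrite mxE conjCD mulrDr. Qed.

Lemma hermZl N c (x z : 'rV[C]_N) : herm (c *: x) z = c * herm x z.
Proof. by rewrite /herm mulr_sumr; apply: eq_bigr => j _; rewrite mxE mulrA. Qed.

Lemma hermZr N c (x z : 'rV[C]_N) : herm z (c *: x) = c^*%C * herm z x.
Proof. by rewrite /herm mulr_sumr; apply: eq_bigr => j _; rewrite mxE conjCM mulrCA. Qed.

(** By [herm_segre] the log of the squared norm of a Segre product is a sum of two logs, and the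
    tangent vectors are those of the Leibniz rule; hence the hermitian forms add. *)
Lemma fsQ_segre a b (X U1 V1 : 'rV[C]_a) (Y U2 V2 : 'rV[C]_b) :
  herm X X != 0 -> herm Y Y != 0 ->
  fsQ (segre X Y) (segre U1 Y + segre X U2) (segre V1 Y + segre X V2) =
  fsQ X U1 V1 + fsQ Y U2 V2.
Proof.
rewrite /fsQ !hermDl !hermDr !herm_segre; move: (herm X X) (herm Y Y) => x y x0 y0.
by field; rewrite x0 y0.
Qed.

Lemma fsQZr m (W U V : 'rV[C]_m) c : fsQ W U (c *: V) = c^*%C * fsQ W U V.
Proof. by rewrite /fsQ !hermZr; ring. Qed.

Lemma fsQZl m (W U V : 'rV[C]_m) c : fsQ W (c *: U) V = c * fsQ W U V.
Proof. by rewrite /fsQ !hermZl; ring. Qed.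

End Differentials.

(** * Gram matrices and spans *)

Section Gram.
Variable R : realType.
Local Notation C := (R[i]).
Local Notation "M ^*t" := (map_mx (@conjc R) M^T) (at level 30).

(** A maximal free family among the values of [G]. The points [zs] are retained, not only a basis,
    because rigidity compares two maps at the same points. *)
Lemma span_family (T : Type) (U : set T) N (G : T -> 'rV[C]_N) :
  exists r (zs : 'I_r -> T), [/\ forall i, U (zs i), row_free (\matrix_i G (zs i)) &
    forall z, U z -> (G z <= \matrix_i G (zs i))%MS].
Proof.
(* Greedy extension: [k] counts the rank still available, and a value outside the current span
   raises the rank by one. *)
suff H k : forall r (zs : 'I_r -> T), (r + k = N)%N -> (forall i, U (zs i)) ->
    row_free (\matrix_i G (zs i)) -> exists r (zs : 'I_r -> T), [/\ forall i, U (zs i),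
      row_free (\matrix_i G (zs i)) & forall z, U z -> (G z <= \matrix_i G (zs i))%MS].
  apply: (H N 0%N (fun i => False_rect _ (notF (valP i)))) => //.
  - by move=> [].
  - by rewrite /row_free eqn_leq rank_leq_row.
elim: k => [|k IH] r zs rk Uzs fzs.
  exists r, zs; split=> // z _; apply: submx_full.
  by rewrite /row_full (eqP fzs) -rk addn0.
have [|/existsNP[z /not_implyP[Uz /negP Nz]]] :=
  pselect (forall z, U z -> (G z <= \matrix_i G (zs i))%MS); first by exists r, zs.
pose zs' (i : 'I_(r + 1)) := match fintype.split i with inl a => zs a | inr _ => z end.
have E : \matrix_i G (zs' i) = col_mx (\matrix_i G (zs i)) (G z).
  apply/row_matrixP => i; rewrite rowK /zs'; case: (splitP i) => j ij.
    have -> : i = lshift 1 j by apply/val_inj.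
    by rewrite rowKu rowK.
  have -> : i = rshift r j by apply/val_inj.
  by rewrite rowKd (ord1 j) row_id.
apply: (IH _ zs'); first by rewrite addn1 addSnnS.
  by move=> i; rewrite /zs'; case: fintype.split.
rewrite E /row_free eqn_leq rank_leq_row /=.
apply: (@leq_trans (\rank (\matrix_i G (zs i))).+1); first by rewrite (eqP fzs) addn1.
apply: rank_ltmx; rewrite ltmxE -addsmxE addsmxSl /=.
by rewrite col_mx_sub negb_and Nz orbT.
Qed.

Lemma hermE N (x y : 'rV[C]_N) : herm x y = (x *m y ^*t) 0 0.
Proof. by rewrite mxE; apply: eq_bigr => j _; rewrite !mxE. Qed.

Lemma herm_eq0 N (x : 'rV[C]_N) : herm x x = 0 -> x = 0.
Proof.
rewrite herm_sqnorm => /(congr1 (@complex.Re R)) /= /eqP.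
rewrite psumr_eq0 => [/allP H|i _]; last by rewrite addr_ge0 ?sqr_ge0.
apply/rowP => j; have := H j (mem_index_enum _); rewrite mxE /=.
rewrite paddr_eq0 ?sqr_ge0 // !sqrf_eq0 => /andP[/eqP a /eqP b].
by rewrite [LHS]complexE a b mulr0 addr0.
Qed.

Lemma herm_conj N (x y : 'rV[C]_N) : herm y x = (herm x y)^*%C.
Proof.
rewrite /herm rmorph_sum; apply: eq_bigr => j _ /=.
by rewrite conjCM conjcK mulrC.
Qed.

Definition gram N (T : Type) (G : T -> 'rV[C]_N) r (zs : 'I_r -> T) : 'M[C]_r :=
  \matrix_(i, j) herm (G (zs i)) (G (zs j)).

Lemma gramE N (T : Type) (G : T -> 'rV[C]_N) r (zs : 'I_r -> T) :
  gram G zs = (\matrix_i G (zs i)) *m (\matrix_i G (zs i)) ^*t.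
Proof.
apply/matrixP => i j; rewrite !mxE hermE mxE; apply: eq_bigr => k _.
by rewrite !mxE.
Qed.

(** If [x] kills the Gram matrix, then the row [x A] has norm 0. This turns independence of values
    into a property of the hermitian kernel alone, which is what rigidity controls. *)
Lemma gram_unit N (T : Type) (G : T -> 'rV[C]_N) r (zs : 'I_r -> T) :
  (gram G zs \in unitmx) = row_free (\matrix_i G (zs i)).
Proof.
set A := \matrix_i _; rewrite gramE -/A -row_free_unit; apply/idP/idP => [|fA].
  rewrite /row_free => /eqP rA; rewrite eqn_leq rank_leq_row /= -[X in (X <= _)%N]rA.
  exact: mxrankM_maxl.
apply/inj_row_free => x xA; apply/(row_free_inj fA); rewrite mul0mx.
apply: herm_eq0; rewrite hermE trmx_mul map_mxM /= mulmxA -[x *m A *m _]mulmxA xA.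
by rewrite mul0mx mxE.
Qed.

End Gram.

(** * Comparing the 2-forms through their hermitian forms *)

Section LeviForms.
Variable R : realType.
Local Notation C := (R[i]).

Definition levi n N (F : 'rV[C]_n -> 'rV[C]_N) z u v : C := fsQ (F z) ('d F z u) ('d F z v).

(** A 2-form only records the antisymmetric part of the hermitian form; at [v = i u] that part is
    [- 2 i] times the diagonal value. *)
Lemma levi_polarization n N M (F : 'rV[C]_n -> 'rV[C]_N) (G : 'rV[C]_n -> 'rV[C]_M) z :
  (forall u v, levi F z u v - levi F z v u = levi G z u v - levi G z v u) ->
  forall u, levi F z u u = levi G z u u.
Proof.
have dZ K (E : 'rV[C]_n -> 'rV[C]_K) u : 'd E z ('i%C *: u) = 'i%C *: 'd E z u.
  by rewrite linearZ.
move=> H u; have := H u ('i%C *: u); rewrite /levi !dZ.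
rewrite !(fsQZr _ _ _ 'i%C) !(fsQZl _ _ _ 'i%C) conjCi.
set a := fsQ _ _ _; set b := fsQ _ _ _.
have E (x : C) : - 'i%C * x - 'i%C * x = - (2 * 'i%C) * x by ring.
rewrite !E; apply: mulfI; rewrite oppr_eq0 mulf_neq0 ?pnatr_eq0 //.
by rewrite -nm_gt0 nmi.
Qed.

Lemma herm_affine_neq0 m (z : 'rV[C]_m) : herm (affine z) (affine z) != 0.
Proof. by rewrite herm_affine_sq sq_neq0. Qed.

Lemma levi_fsnum n N M (F : 'rV[C]_n -> 'rV[C]_N) (G : 'rV[C]_n -> 'rV[C]_M) z u :
  herm (F z) (F z) != 0 -> herm (G z) (G z) != 0 -> levi F z u u = levi G z u u ->
  fsnum F z u * herm (G z) (G z) ^+ 2 = fsnum G z u * herm (F z) (F z) ^+ 2.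
Proof.
rewrite /levi /fsQ -/(fsnum F z u) -/(fsnum G z u) => f0 g0 /eqP.
by rewrite eqr_div ?expf_neq0 // => /eqP.
Qed.

Lemma pullback_levi n m (h : 'rV[C]_n -> 'rV[C]_m) z u v : differentiable h z ->
  pullback h (fubini_study R m) z u v = 'i%C / (2 * pi)%:C *
    (levi (fun z => affine (h z)) z u v - levi (fun z => affine (h z)) z v u).
Proof. by move=> dh; rewrite /pullback fubini_fsQ /levi !d_affine. Qed.

(* The Segre map turns the sum omega_n + f^* omega_d into the pullback of one
   Fubini-Study form. *)
Definition graph n d (f : 'rV[C]_n -> 'rV[C]_d) (z : 'rV[C]_n) : 'rV[C]_((1 + n) * (1 + d)) :=
  segre (affine z) (affine (f z)).

Lemma differentiable_graph n d (f : 'rV[C]_n -> 'rV[C]_d) z :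
  differentiable f z -> differentiable (graph f) z.
Proof.
move=> df; apply: differentiable_segre; last exact: differentiable_affine.
by apply: (@differentiable_affine _ n n (fun z => z)); exact: ex_diff.
Qed.

Lemma levi_graph n d (f : 'rV[C]_n -> 'rV[C]_d) z u v : differentiable f z ->
  levi (graph f) z u v = fsQ (affine z) (tangent u) (tangent v) +
    levi (fun z => affine (f z)) z u v.
Proof.
move=> df; have di : differentiable (fun z : 'rV[C]_n => z) z by exact: ex_diff.
rewrite /levi /graph !(@d_segre _ n _ _ (fun z => affine z) (fun z => affine (f z))) //;
  try exact: differentiable_affine; try exact: (differentiable_affine di).
by rewrite fsQ_segre ?herm_affine_neq0 // !(d_affine _ di) !d_id.
Qed.

Lemma modification_levi n d (f : 'rV[C]_n -> 'rV[C]_d) z u v : differentiable f z ->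
  modification f z u v = 'i%C / (2 * pi)%:C *
    (levi (graph f) z u v - levi (graph f) z v u).
Proof.
move=> df; rewrite /modification /add_form pullback_levi // fubini_fsQ !levi_graph //.
by rewrite -mulrDr; congr (_ * _); ring.
Qed.

Lemma fs_factor_neq0 : 'i%C / (2 * pi)%:C != 0 :> C.
Proof.
rewrite mulf_neq0 //; first by rewrite -nm_gt0 nmi.
by rewrite invr_eq0 -nm_gt0 nmC normr_gt0 mulf_neq0 // gt_eqF // pi_gt0.
Qed.

Lemma herm_graph_neq0 n d (f : 'rV[C]_n -> 'rV[C]_d) z : herm (graph f z) (graph f z) != 0.
Proof. by rewrite herm_segre mulf_neq0 // herm_affine_neq0. Qed.

Section Induced.
Variables (n d m : nat) (Omega : set 'rV[C]_n).
Variables (f : 'rV[C]_n -> 'rV[C]_d) (h : 'rV[C]_n -> 'rV[C]_m).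
Hypothesis hf : holomorphic Omega f.
Hypothesis hh : holomorphic Omega h.

Lemma eq_form_levi z : Omega z ->
  (forall u v, modification f z u v = pullback h (fubini_study R m) z u v) ->
  forall u, levi (graph f) z u u = levi (fun z => affine (h z)) z u u.
Proof.
move=> Oz H; apply: levi_polarization => u v.
have := H u v; rewrite modification_levi ?pullback_levi //; try exact: hf; try exact: hh.
by move/(mulfI fs_factor_neq0).
Qed.

Lemma levi_eq_form :
  (forall z, Omega z -> forall u v, levi (graph f) z u v = levi (fun z => affine (h z)) z u v) ->
  eq_form_on Omega (modification f) (pullback h (fubini_study R m)).
Proof.
move=> H z Oz u v; rewrite modification_levi ?pullback_levi ?H //; try exact: hf.
exact: hh.
Qed.

End Induced.

End LeviForms.

(** * Linear images and a similarity on the span *)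

Section LinearImages.
Variable R : realType.
Local Notation C := (R[i]).
Local Notation nm := (@Normc.normc R).
Local Notation "M ^*t" := (map_mx (@conjc R) M^T) (at level 30).

Lemma differentiable_mulmx n N M (F : 'rV[C]_n -> 'rV[C]_N) (A : 'M[C]_(N, M)) p :
  differentiable F p -> differentiable (fun z => F z *m A) p.
Proof.
move=> dF; apply: differentiable_rV => j.
have -> : (fun z => (F z *m A) 0 j) = \sum_(c < N) (fun z => F z 0 c * A c j : C).
  by apply/funext => z; rewrite fct_sumE mxE.
apply: differentiable_sum => c.
apply: (differentiableM (f := fun z => F z 0 c : C) (g := fun=> A c j)).
  exact: differentiable_comp_coord.
exact: differentiable_cst.
Qed.

Lemma cder_mulmx n N M (F : 'rV[C]_n -> 'rV[C]_N) (A : 'M[C]_(N, M)) p v j :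
  differentiable F p -> cder (fun t => (F (p + t *: v) *m A) 0 j) 0 (('d F p v *m A) 0 j).
Proof.
move=> dF.
have -> : (fun t : C => (F (p + t *: v) *m A) 0 j) =
    (fun t => \sum_(c < N) F (p + t *: v) 0 c * A c j).
  by apply/funext => t; rewrite mxE.
rewrite mxE; apply: (@cder_sum _ _ (fun c t => F (p + t *: v) 0 c * A c j)) => c.
by have := cderM (d_coord v c dF) (cder_cst (A c j) 0); rewrite mulr0 addr0.
Qed.

Lemma d_mulmx n N M (F : 'rV[C]_n -> 'rV[C]_N) (A : 'M[C]_(N, M)) p v :
  differentiable F p -> 'd (fun z => F z *m A) p v = 'd F p v *m A.
Proof.
move=> dF; apply/rowP => j; apply: d_coord_unique; first exact: differentiable_mulmx.
exact: cder_mulmx.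
Qed.

(** Linear equations satisfied by the values pass to the tangent vectors; used for membership in the
    span and for the constant coordinate. *)
Lemma d_constant n N M (F : 'rV[C]_n -> 'rV[C]_N) (A : 'M[C]_(N, M)) (U : set 'rV[C]_n) k p v :
  open U -> U p -> differentiable F p -> (forall z, U z -> F z *m A = k) -> 'd F p v *m A = 0.
Proof.
move=> oU Up dF Fk; apply/rowP => j; rewrite [RHS]mxE.
apply: (cder_unique (cder_mulmx A v j dF)).
apply: cder_near (cder_cst (k 0 j) 0).
have [d d0 dP] := open_nv oU Up.
have v0 : 0 < nv v + 1 by rewrite ltr_wpDl ?nv_ge0.
exists (d / (nv v + 1)); first by rewrite divr_gt0.
move=> t; rewrite subr0 => td; rewrite Fk //; apply: dP.
rewrite addrAC subrr add0r nvZ; apply: le_lt_trans (_ : nm t * (nv v + 1) < d).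
  by apply: ler_wpM2l; rewrite ?nm_ge0 // lerDl.
by rewrite -ltr_pdivlMr.
Qed.

Lemma herm_mulmx N M (x y : 'rV[C]_N) (A : 'M[C]_(N, M)) (B : 'M[C]_(N, M)) :
  herm (x *m A) (y *m B) = (x *m (A *m B ^*t) *m y ^*t) 0 0.
Proof. by rewrite hermE trmx_mul map_mxM /= !mulmxA. Qed.

(** [fsQ] is homogeneous of degree 0 in the hermitian product, so a similarity preserves it. *)
Lemma fsQ_scale N M (X U V : 'rV[C]_N) (X' U' V' : 'rV[C]_M) (c : C) : c != 0 ->
  herm X' X' = c * herm X X -> herm U' V' = c * herm U V ->
  herm U' X' = c * herm U X -> herm X' V' = c * herm X V -> fsQ X' U' V' = fsQ X U V.
Proof.
rewrite /fsQ => c0 -> -> -> ->; rewrite exprMn.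
have -> : c * herm X X * (c * herm U V) - c * herm U X * (c * herm X V) =
  c ^+ 2 * (herm X X * herm U V - herm U X * herm X V) by ring.
by rewrite -mulf_div divff ?expf_neq0 // mul1r.
Qed.

(* A spans the values of G; passing to an orthonormal basis B of the row space
   of A is isometric, and a further unitary map makes the first coordinate
   constant because the coordinate [idx] of G is identically 1. *)
Lemma isometric_reduction D r (A : 'M[C]_(r, D)) (idx : 'I_D) :
  row_free A -> (exists2 x : 'rV[C]_D, (x <= A)%MS & x 0 idx != 0) ->
  exists m (M : 'M[C]_(D, 1 + m)) (c : C),
  [/\ r = (1 + m)%N, c != 0,
    forall x : 'rV[C]_D, (x <= A)%MS -> (x *m M) 0 0 = x 0 idx,
    forall x y : 'rV[C]_D, (x <= A)%MS -> (y <= A)%MS -> herm (x *m M) (y *m M) = c * herm x y &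
    exists k, (delta_mx 0 idx : 'rV[C]_D) *m M = k *: (delta_mx 0 0 : 'rV[C]_(1 + m))].
Proof.
case: r A => [|m] A fA [x0 x0A x01].
  by move: x01; case/submxP: x0A => y ->; rewrite (thinmx0 y) mul0mx mxE eqxx.
have rD : (m.+1 <= D)%N by move: (rank_leq_col A); rewrite (eqP fA).
pose B := schmidt A.
have uB : B *m B ^*t = 1%:M by apply/unitarymxP; exact: schmidt_unitarymx.
have BA : (B :=: A)%MS by apply: eqmx_schmidt_free.
have proj (x : 'rV[C]_D) : (x <= A)%MS -> x *m B ^*t *m B = x.
  by rewrite -BA => /submxP[y ->]; rewrite -!mulmxA (mulmxA B) uB mul1mx.
(* In the orthonormal basis [B], the functional reading coordinate [idx] is the product with the
   column [b]. *)
pose b := B *m delta_mx idx 0 : 'cV[C]_m.+1.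
have xb (x : 'rV[C]_D) : (x <= A)%MS -> (x *m B ^*t *m b) 0 0 = x 0 idx.
  by move=> xA; rewrite /b mulmxA proj // -colE mxE.
(* Every row is the conjugate of [b], so Gram-Schmidt returns a unitary matrix whose first row is
   proportional to it. *)
pose A' : 'M[C]_m.+1 := \matrix_(i, j) (b j 0)^*%C.
pose S := schmidt A'.
have uS : S *m S ^*t = 1%:M by apply/unitarymxP; exact: schmidt_unitarymx.
have uS' : S ^*t *m S = 1%:M by apply: mulmx1C.
have [l lE] : exists l, b ^*t = l *: row 0 S.
  have := row_schmidt_sub A' 0.
  rewrite (big_pred1 0) => [|i]; last by rewrite leqn0.
  rewrite genmxE => /sub_rVP[l E]; exists l; rewrite -E.
  by apply/rowP => j; rewrite !mxE.
have b0 : b != 0.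
  by apply/eqP => E; move: x01; rewrite -(xb _ x0A) E mulmx0 mxE eqxx.
have l0 : l != 0.
  apply/eqP => E; move: b0; rewrite -subr_eq0 subr0; apply/negP/negPn/eqP.
  have bE : b ^*t = 0 by rewrite lE E scale0r.
  by apply/colP => j; have /rowP/(_ j) := bE; rewrite !mxE => /eqP; rewrite conjc_eq0 => /eqP.
have bS j : b j 0 = l^*%C * (S 0 j)^*%C.
  have /rowP/(_ j) := lE; rewrite !mxE => /(congr1 (@conjc R)).
  by rewrite conjcK conjCM.
(* The conjugate of [l] makes the first coordinate of [x *m M] exactly [x 0 idx], at the price of
   multiplying hermitian products by the squared modulus of [l]. *)
exists m, (l^*%C *: (B ^*t *m S ^*t)), (l^*%C * l); split.
- by [].
- by rewrite mulf_neq0 // conjc_eq0.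
- move=> x xA; rewrite -(xb x xA) -scalemxAr mulmxA mxE !mxE mulr_sumr.
  by apply: eq_bigr => j _; rewrite bS !mxE mulrCA.
- move=> x y xA yA; rewrite herm_mulmx.
  have -> : l^*%C *: (B ^*t *m S ^*t) *m (l^*%C *: (B ^*t *m S ^*t)) ^*t =
      (l^*%C * l) *: (B ^*t *m B).
    have -> : (l^*%C *: (B ^*t *m S ^*t)) ^*t = l *: (S *m B).
      rewrite linearZ /= map_mxZ /= conjcK trmx_mul map_mxM /=.
      by congr (_ *: (_ *m _)); apply/matrixP => i j; rewrite !mxE conjcK.
    rewrite -scalemxAl -scalemxAr scalerA mulmxA -[B ^*t *m _ *m S]mulmxA uS' mulmx1.
    by [].
  by rewrite -scalemxAr -scalemxAl mulmxA proj // mxE -hermE.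
(* When [f 0 = 0], [graph f 0] is this basis vector, so this clause gives [h 0 = 0]. *)
- exists (l^*%C * l); rewrite -scalemxAr mulmxA.
  have -> : delta_mx 0 idx *m B ^*t = b ^*t.
    by rewrite /b trmx_mul map_mxM trmx_delta map_delta_mx.
  by rewrite lE -scalemxAl -row_mul uS scalerA row1.
Qed.

End LinearImages.

(** * Existence, uniqueness and the dimension bounds *)

Section Existence.
Variable R : realType.
Local Notation C := (R[i]).

Lemma affineE N (x : 'rV[C]_N) : row_mx (const_mx 1) x = affine x.
Proof. by congr row_mx; apply/rowP => j; rewrite !mxE !ord1. Qed.

Lemma affine0 N (x : 'rV[C]_N) : affine x 0 0 = 1.
Proof.
have -> : 0 = lshift N 0 :> 'I_(1 + N) by apply/val_inj.
by rewrite row_mxEl mxE eqxx.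
Qed.

Lemma affine_at0 N : affine 0 = delta_mx 0 0 :> 'rV[C]_(1 + N).
Proof.
apply/rowP => j; rewrite /affine [RHS]mxE eqxx andTb; case: (splitP j) => k jk.
  have -> : j = lshift N k by apply/val_inj.
  by rewrite row_mxEl !ord1 mxE.
have -> : j = rshift 1 k by apply/val_inj; rewrite /= jk.
by rewrite row_mxEr mxE.
Qed.

Lemma free_rows_fullv N (B : 'M[C]_N) (V : {vspace 'rV[C]_N}) :
  row_free B -> (forall i, row i B \in V) -> V = fullv.
Proof.
rewrite row_free_unit => uB BV; apply/eqP; rewrite eqEsubv subvf /=; apply/subvP => x _.
rewrite -[x](mulmxKV uB) mulmx_sum_row; apply: memv_suml => i _.
exact: memvZ.
Qed.

Lemma existence n d (Omega : set 'rV[C]_n) (f : 'rV[C]_n -> 'rV[C]_d) :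
  Omega !=set0 -> open Omega -> holomorphic Omega f ->
  exists m (h : 'rV[C]_n -> 'rV[C]_m),
    induces_modification Omega f h /\ (f 0 = 0 -> h 0 = 0).
Proof.
move=> [z0 Oz0] oO hf; pose idx : 'I_((1 + n) * (1 + d)) := mxvec_index 0 0.
have G1 z : graph f z 0 idx = 1 by rewrite segreE !affine0 mulr1.
have [r [zs [Ozs fA sA]]] := span_family Omega (graph f).
set A := \matrix_i _ in fA sA.
have [|m [M [c [rm c0 M1 Mh [k Mk]]]]] := @isometric_reduction _ _ _ _ idx fA.
  by exists (graph f z0); rewrite ?G1 ?oner_neq0 //; exact: sA.
subst r.
have E0 : 0 = lshift m 0 :> 'I_(1 + m) by apply/val_inj.
have rowE (x : 'rV[C]_((1 + n) * (1 + d))) a : (x *m M) 0 0 = a ->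
    x *m M = row_mx a%:M (x *m rsubmx M).
  move=> xa; rewrite -[in LHS](hsubmxK M) mul_mx_row; congr row_mx.
  apply/rowP => j; rewrite [j]ord1 [RHS]mxE eqxx mulr1n -xa -{2}(hsubmxK M) mul_mx_row.
  by rewrite E0 row_mxEl.
pose h z := graph f z *m rsubmx M.
have hE z : Omega z -> affine (h z) = graph f z *m M.
  by move=> Oz; rewrite (@rowE _ 1) // M1 ?G1 //; exact: sA.
have dG z : Omega z -> differentiable (graph f) z.
  by move=> Oz; apply: differentiable_graph; exact: hf.
have hh : holomorphic Omega h by move=> z Oz; apply: differentiable_mulmx; exact: dG.
(* The similarity only holds on the row space of [A], so the tangent vectors must be placed there as
   well. *)
have dGA z v : Omega z -> ('d (graph f) z v <= A)%MS.
  move=> Oz; rewrite submxE; apply/eqP; apply: (d_constant v oO Oz (k := 0) (dG z Oz)).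
  by move=> w Ow; apply/eqP; rewrite -submxE; exact: sA.
have dG1 z v : Omega z -> ('d (graph f) z v) 0 idx = 0.
  move=> Oz.
  have D0 : 'd (graph f) z v *m delta_mx idx (0 : 'I_1) = 0.
    apply: (d_constant v oO Oz (k := 1%:M) (dG z Oz)) => w Ow.
    by rewrite -colE; apply/rowP => j; rewrite [j]ord1 !mxE G1 eqxx.
  by move/rowP/(_ 0): D0; rewrite -colE mxE [RHS]mxE.
have dhE z v : Omega z -> tangent ('d h z v) = 'd (graph f) z v *m M.
  move=> Oz; rewrite (@rowE _ 0); last by rewrite M1 ?dG1 //; exact: dGA.
  by rewrite /h (d_mulmx _ _ (dG z Oz)) /tangent raddf0.
exists m, h; split; first split=> //.
(* The Gram matrix of [(1, h)] at the points [zs] is [c] times that of [graph f], hence invertible: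
   these [1 + m] values already span. *)
- move=> V hV.
  apply: (@free_rows_fullv _ (\matrix_i affine (h (zs i)))); last first.
    by move=> i; rewrite rowK -affineE; apply: hV.
  rewrite -(@gram_unit _ _ _ (fun z => affine (h z))).
  have -> : gram (fun z => affine (h z)) zs = c *: gram (graph f) zs.
    apply/matrixP => i j; rewrite mxE [RHS]mxE [in RHS]mxE !hE //.
    by apply: Mh; exact: sA.
  by rewrite unitmxZ ?gram_unit // unitfE.
- apply: levi_eq_form => // z Oz u v; rewrite /levi.
  rewrite !(d_affine _ (hh z Oz)) !dhE // hE //.
  by symmetry; apply: (fsQ_scale c0); apply: Mh; rewrite ?sA ?dGA.
- move=> f0; rewrite /h /graph f0 !affine_at0 /segre trmx_delta mul_delta_mx mxvec_delta.
  apply/rowP => j; rewrite -[M]hsubmxK in Mk.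
  move: Mk; rewrite mul_mx_row => /rowP/(_ (rshift 1 j)).
  by rewrite row_mxEr => ->; rewrite !mxE mulr0.
Qed.

End Existence.

(** * Uniqueness of the dimension and of the map *)

Section Uniqueness.
Variable R : realType.
Local Notation C := (R[i]).
Local Notation "M ^*t" := (map_mx (@conjc R) M^T) (at level 30).

Lemma unitmx_rescale k (P Q : 'M[C]_k) (a b : 'I_k -> C) :
  (forall i, a i != 0) -> (forall i, b i != 0) ->
  (forall i j, Q i j = a i * P i j * b j) -> (Q \in unitmx) = (P \in unitmx).
Proof.
move=> a0 b0 QP.
have -> : Q = diag_mx (\row_i a i) *m P *m diag_mx (\row_j b j).
  by apply/matrixP => i j; rewrite mul_diag_mx mul_mx_diag !mxE.
have D (c : 'I_k -> C) : (forall i, c i != 0) -> diag_mx (\row_i c i) \in unitmx.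
  move=> c0; rewrite unitmxE det_diag unitfE.
  by apply/prodf_neq0 => i _; rewrite mxE.
by rewrite !unitmx_mul !D // andbT.
Qed.

(* The kernels <H z, H w> and <K z, K w> agree up to invertible factors in z
   and in w, so that the Gram matrices have the same rank. *)
Lemma calabi_free n N M (H : 'rV[C]_n -> 'rV[C]_N) (K : 'rV[C]_n -> 'rV[C]_M)
    (U : set 'rV[C]_n) (p : 'rV[C]_n) : open U -> U p ->
  (forall z, U z -> differentiable H z) -> (forall z, U z -> differentiable K z) ->
  (forall z, herm (H z) (H z) != 0) -> (forall z, herm (K z) (K z) != 0) ->
  (forall z, U z -> forall v, levi H z v v = levi K z v v) ->
  exists2 d : R, 0 < d & forall k (zs : 'I_k -> 'rV[C]_n), (forall i, nv (zs i - p) < d) ->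
    row_free (\matrix_i H (zs i)) = row_free (\matrix_i K (zs i)).
Proof.
move=> oU Up dH dK H0 K0 HK.
have [|d d0 dP] := calabi_local oU Up dH dK (H0 p) (K0 p).
  by move=> z v Uz; apply: levi_fsnum; rewrite ?HK.
exists d => // k zs zd; rewrite -!gram_unit.
have Hp i : herm (H (zs i)) (H p) != 0 by have [] := dP _ _ (zd i) (zd i).
have Kp i : herm (K (zs i)) (K p) != 0 by have [] := dP _ _ (zd i) (zd i).
have pH i : herm (H p) (H (zs i)) != 0 by rewrite herm_conj conjc_eq0.
have pK i : herm (K p) (K (zs i)) != 0 by rewrite herm_conj conjc_eq0.
(* These factors solve [T = 0] for the kernel of [H] in terms of that of [K]. *)
apply: (@unitmx_rescale _ (gram K zs) (gram H zs)
  (fun i => herm (H (zs i)) (H p) / herm (K (zs i)) (K p))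
  (fun j => herm (H p) (H (zs j)) / herm (K p) (K (zs j)) *
    (herm (K p) (K p) / herm (H p) (H p)))).
- by move=> i; rewrite mulf_neq0 // invr_eq0.
- by move=> j; rewrite !mulf_neq0 // invr_eq0.
move=> i j; rewrite !mxE.
have [_ E _ _] := dP _ _ (zd i) (zd j).
move: E (H0 p) (Hp i) (Kp i) (pH j) (pK j).
move: (herm (H (zs i)) (H (zs j))) (herm (K (zs i)) (K (zs j))) (herm (H p) (H p))
  (herm (K p) (K p)) (herm (H (zs i)) (H p)) (herm (K (zs i)) (K p))
  (herm (H p) (H (zs j))) (herm (K p) (K (zs j))) => a b pp qq s t u v E pp0 s0 t0 u0 v0.
have {}E : a * (v * t * pp) = b * (u * s * qq).
  by apply/eqP; rewrite -subr_eq0; apply/eqP; rewrite -E; ring.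
apply: (@mulIf _ (v * t * pp)); first by rewrite !mulf_neq0.
by rewrite E; field; rewrite v0 t0 pp0.
Qed.

Lemma row_free_le r s N (A : 'M[C]_(r, N)) (B : 'M[C]_(s, N)) :
  row_free B -> (forall i, row i B <= A)%MS -> (s <= r)%N.
Proof.
move=> fB BA; rewrite -(eqP fB); apply: leq_trans (rank_leq_row A).
by apply: mxrankS; apply/row_subP.
Qed.

Lemma trivial_cokernel_full r N (A : 'M[C]_(r, N)) :
  (forall a : 'cV[C]_N, A *m a = 0 -> a = 0) -> row_full A.
Proof.
move=> A0; rewrite -cokermx_eq0; apply/eqP/matrixP => i j.
have /colP/(_ i) : col j (cokermx A) = 0.
  by apply: A0; rewrite colE mulmxA mulmx_coker mul0mx.
by rewrite mxE => ->; rewrite !mxE.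
Qed.

Lemma submx_annihilated r s N (A : 'M[C]_(r, N)) (x : 'M[C]_(s, N)) (a : 'cV[C]_N) :
  (x <= A)%MS -> A *m a = 0 -> x *m a = 0.
Proof. by case/submxP => y -> Aa; rewrite -mulmxA Aa mulmx0. Qed.

Section Embedded.
Variables (n N : nat) (Omega : set 'rV[C]_n) (phi : 'rV[C]_n -> 'rV[C]_N).
Hypothesis oO : open Omega.
Hypothesis cO : connected Omega.
Hypothesis hphi : holomorphic Omega phi.
Hypothesis mphi : minimally_embedded Omega phi.
Variables (p : 'rV[C]_n) (d : R).
Hypothesis Op : Omega p.
Hypothesis d0 : 0 < d.

(** The relation spreads from the ball to [Omega] by the identity theorem; its kernel is then a
    subspace containing the image, hence everything. *)
Lemma embedded_independent (a : 'cV[C]_(1 + N)) :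
  (forall z, nv (z - p) < d -> affine (phi z) *m a = 0) -> a = 0.
Proof.
move=> za.
have Oa z : Omega z -> affine (phi z) *m a = 0.
  move=> Oz; apply/rowP => j; rewrite [j]ord1 [RHS]mxE.
  apply: (@identity_theorem R n (fun z => (affine (phi z) *m a) 0 0) Omega p d) => //.
    move=> w Ow; apply: (differentiable_comp_coord (F := fun z => affine (phi z) *m a)).
    by apply: differentiable_mulmx; apply: differentiable_affine; exact: hphi.
  by move=> w /za ->; rewrite mxE.
have [|g gE] := @linear_hom R 'rV[C]_(1 + N) 'rV[C]_1 (fun x => x *m a).
  by move=> c x y; rewrite mulmxDl -scalemxAl.
have ker (x : 'rV[C]_(1 + N)) : x *m a = 0.
  have : x \in lker g.
    rewrite (mphi (V := lker g)) ?memvf // => z Oz.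
    by rewrite memv_ker gE affineE Oa.
  by rewrite memv_ker gE => /eqP.
by apply/row_matrixP => i; rewrite rowE ker row0.
Qed.

Lemma embedded_free : exists zs : 'I_(1 + N) -> 'rV[C]_n,
  (forall i, nv (zs i - p) < d) /\ row_free (\matrix_i affine (phi (zs i))).
Proof.
have [r [zs [zd fA sA]]] :=
  span_family [set z | nv (z - p) < d] (fun z => affine (phi z)).
set A := \matrix_i _ in fA sA.
have fl : row_full A.
  apply: trivial_cokernel_full => a Aa; apply: embedded_independent => z /sA zA.
  exact: submx_annihilated Aa.
have rN : r = (1 + N)%N.
  by apply/eqP; rewrite -(eqP fA) -[X in _ == X](eqP fl).
by subst r; exists zs.
Qed.

End Embedded.

Section Induced.
Variables (n d : nat) (Omega : set 'rV[C]_n) (f : 'rV[C]_n -> 'rV[C]_d).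
Hypothesis oO : open Omega.
Hypothesis cO : connected Omega.
Hypothesis hf : holomorphic Omega f.

Lemma induced_levi m (h : 'rV[C]_n -> 'rV[C]_m) : induces_modification Omega f h ->
  forall z, Omega z -> forall u, levi (graph f) z u u = levi (fun z => affine (h z)) z u u.
Proof.
move=> [hh _ hE] z Oz; apply: (eq_form_levi hf hh) => // u v; exact: hE.
Qed.

(** Some [1 + m] independent values of [(1, h)] near [p] remain independent for [(1, h')], in a
    space of dimension [1 + m']. *)
Lemma induced_dim_le m m' (h : 'rV[C]_n -> 'rV[C]_m) (h' : 'rV[C]_n -> 'rV[C]_m') :
  Omega !=set0 -> induces_modification Omega f h -> induces_modification Omega f h' ->
  (m <= m')%N.
Proof.
move=> [p Op] ih ih'; have [hh mh _] := ih; have [hh' _ _] := ih'.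
have [|||||d0 d00 dP] := @calabi_free _ _ _
  (fun z => affine (h z)) (fun z => affine (h' z)) _ p oO Op.
- by move=> z Oz; apply: differentiable_affine; exact: hh.
- by move=> z Oz; apply: differentiable_affine; exact: hh'.
- by move=> z; exact: herm_affine_neq0.
- by move=> z; exact: herm_affine_neq0.
- by move=> z Oz v; rewrite -(induced_levi ih) // -(induced_levi ih').
have [zs [zd fz]] := embedded_free oO cO hh mh Op d00.
by rewrite -(leq_add2l 1); move: fz; rewrite dP // => /eqP <-; exact: rank_leq_col.
Qed.

Lemma induced_unitary m (h h' : 'rV[C]_n -> 'rV[C]_m) : Omega 0 ->
  induces_modification Omega f h -> h 0 = 0 -> induces_modification Omega f h' -> h' 0 = 0 ->
  exists U : 'M[C]_m, U \is unitarymx /\ (forall z, Omega z -> h' z = h z *m U).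
Proof.
move=> O0 ih h0 ih' h'0; have [hh mh _] := ih; have [hh' _ _] := ih'.
have [|||||e e0 eP] := @calabi_local _ _ _ _
  (fun z => affine (h z)) (fun z => affine (h' z)) _ 0 oO O0.
- by move=> z Oz; apply: differentiable_affine; exact: hh.
- by move=> z Oz; apply: differentiable_affine; exact: hh'.
- exact: herm_affine_neq0.
- exact: herm_affine_neq0.
- move=> z v Oz; apply: levi_fsnum; rewrite ?herm_affine_neq0 //.
  by rewrite -(induced_levi ih) // -(induced_levi ih').
have herm0l N (x : 'rV[C]_N) : herm 0 x = 0 by rewrite hermE mul0mx mxE.
have herm0r N (x : 'rV[C]_N) : herm x 0 = 0 by rewrite herm_conj herm0l conjc0.
(* At [p = 0] the factors of [T] involving the base point are all 1, so the two kernels coincide. *)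
have hE z w : nv z < e -> nv w < e -> herm (h z) (h w) = herm (h' z) (h' w).
  move=> ze we; have := eP z w; rewrite !subr0 => /(_ ze we)[_ + _ _].
  rewrite !herm_affine h0 h'0 !herm0l !herm0r !addr0 !mulr1 => /eqP.
  by rewrite subr_eq0 => /eqP /addrI.
have [r [zs [zd fB sB]]] := span_family [set z | nv z < e] h.
have rm : r = m.
  suff fl : row_full (\matrix_i h (zs i)) by apply/eqP; rewrite -(eqP fB) -[X in _ == X](eqP fl).
  apply: trivial_cokernel_full => a Ba.
  suff: col_mx (0 : 'M[C]_1) a = 0.
    by rewrite -[0 in RHS]vsubmxK => /eq_col_mx[_ ->]; rewrite linear0.
  apply: (embedded_independent oO cO hh mh O0 e0) => z; rewrite subr0 => /sB zB.
  by rewrite /affine mul_row_col mulmx0 add0r (submx_annihilated zB Ba).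
subst r; set B := \matrix_i _ in fB sB.
pose B' := \matrix_i h' (zs i).
have BB : B *m B ^*t = B' *m B' ^*t.
  rewrite -!gramE; apply/matrixP => i j; rewrite mxE [RHS]mxE; exact: hE (zd i) (zd j).
have uB : B \in unitmx by rewrite -row_free_unit.
have uB' : B' \in unitmx.
  by rewrite -row_free_unit -gram_unit gramE -BB -gramE gram_unit.
have uB't : B' ^*t \in unitmx by rewrite map_unitmx unitmx_tr.
have uBt : B ^*t \in unitmx by rewrite map_unitmx unitmx_tr.
(* The equality of Gram matrices gives a second formula for [U]. Combined with the first it shows
   unitarity; alone it expresses [h' z] through its products with the [h' (zs i)]. *)
have UE : invmx B *m B' = B ^*t *m invmx (B' ^*t).
  apply: (canLR (mulKmx uB)); rewrite mulmxA BB.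
  by rewrite mulmxK.
pose U := invmx B *m B'.
exists U; split.
  apply/unitarymxP.
  have -> : map_mx Num.conj U^T = U ^*t by [].
  have -> : U ^*t = B' ^*t *m (invmx B) ^*t by rewrite trmx_mul map_mxM.
  rewrite /U UE mulmxA (mulmxKV uB't) -map_mxM -trmx_mul (mulVmx uB) trmx1.
  exact: map_mx1.
have hU z : nv z < e -> h' z = h z *m U.
  move=> ze; rewrite /U UE mulmxA; apply: (canRL (mulmxK uB't)).
  have rowE (x : 'rV[C]_m) (g : 'I_m -> 'rV[C]_m) i : (x *m (\matrix_i g i) ^*t) 0 i = herm x (g i).
    by rewrite mxE; apply: eq_bigr => j _; rewrite !mxE.
  by apply/rowP => i; rewrite !rowE hE //; exact: zd.
move=> z Oz; apply/rowP => j; apply/eqP; rewrite -subr_eq0; apply/eqP.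
apply: (@identity_theorem R n (fun z => h' z 0 j - (h z *m U) 0 j) Omega 0 e) => //.
  move=> w Ow;
  apply: (@differentiableB _ _ _ (fun z => h' z 0 j : C) (fun z => (h z *m U) 0 j : C)).
    by apply: differentiable_comp_coord; exact: hh'.
  apply: (differentiable_comp_coord (F := fun z => h z *m U)).
  by apply: differentiable_mulmx; exact: hh.
by move=> w; rewrite subr0 => /hU ->; rewrite subrr.
Qed.

End Induced.
End Uniqueness.

(** * Dimension bounds *)

Lemma bin2_double k : ('C(k, 2) * 2 = k * (k - 1))%N.
Proof.
elim: k => [|k IH] //; rewrite binS bin1 mulnDl IH subn1 /=.
case: k {IH} => [|k] //; rewrite subn1 /=; lia.
Qed.

Lemma sum_decreasing n d : (d <= n)%N -> (\sum_(0 <= l < d) (n - l) + 'C(d, 2) = n * d)%N.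
Proof.
elim: d => [|d IH] dn; first by rewrite big_geq // muln0.
rewrite big_nat_recr //= binS bin1 mulnS -(IH (ltnW dn)); lia.
Qed.

Section Bounds.
Variable R : realType.
Local Notation C := (R[i]).

Variables (n d m : nat) (Omega : set 'rV[C]_n).
Variables (f : 'rV[C]_n -> 'rV[C]_d) (h : 'rV[C]_n -> 'rV[C]_m).
Hypothesis O0 : Omega !=set0.
Hypothesis oO : open Omega.
Hypothesis cO : connected Omega.
Hypothesis hf : holomorphic Omega f.
Hypothesis mf : minimally_embedded Omega f.
Hypothesis ih : induces_modification Omega f h.

(** [calabi_free] used in both directions transfers [1 + m] from [(1, h)] to the span of [graph f],
    so that the bounds only concern [graph f]. *)
Lemma graph_span : exists (p : 'rV[C]_n) (e : R) (zs : 'I_(1 + m) -> 'rV[C]_n),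
  [/\ Omega p, 0 < e, forall z, nv (z - p) < e -> Omega z,
    row_free (\matrix_i graph f (zs i)) &
    forall z, nv (z - p) < e -> (graph f z <= \matrix_i graph f (zs i))%MS].
Proof.
have [p Op] := O0; have [hh mh _] := ih.
have [|||||e e0 eP] := @calabi_free _ _ _ _ (graph f) (fun z => affine (h z)) _ p oO Op.
- by move=> z Oz; apply: differentiable_graph; exact: hf.
- by move=> z Oz; apply: differentiable_affine; exact: hh.
- by move=> z; exact: herm_graph_neq0.
- by move=> z; exact: herm_affine_neq0.
- by move=> z Oz v; exact: (induced_levi hf ih).
have [e' e'0 e'P] := open_nv oO Op.
have m0 : 0 < Num.min e e' by rewrite lt_min e0.
have me z : nv (z - p) < Num.min e e' -> nv (z - p) < e /\ nv (z - p) < e'.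
  by rewrite lt_min => /andP.
have [zs [zm fz]] := embedded_free oO cO hh mh Op m0.
have [r [ys [ym fy sy]]] := span_family [set z | nv (z - p) < Num.min e e'] (graph f).
have rm : r = (1 + m)%N.
  apply/eqP; rewrite eqn_leq; apply/andP; split.
    by move: fy; rewrite eP => [/eqP <-|i]; [exact: rank_leq_col|case: (me _ (ym i))].
  move: fz; rewrite -eP => [fz|i]; last by case: (me _ (zm i)).
  by apply: (row_free_le fz) => i; rewrite rowK; apply: sy; exact: zm.
subst r; exists p, (Num.min e e'), ys; split=> // z /me[_ ze]; exact: e'P.
Qed.

Lemma dim_upper : (1 + m <= (1 + n) * (1 + d))%N.
Proof.
by have [p [e [zs [_ _ _ fz _]]]] := graph_span; rewrite -(eqP fz) rank_leq_col.
Qed.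

(** The coordinates of [(1, f)] occur among those of [graph f], as products with the constant
    coordinate of [(1, z)]. *)
Lemma dim_target : (d <= m)%N.
Proof.
have [p [e [zs [Op e0 _ fz sz]]]] := graph_span.
have [ys [ye fy]] := embedded_free oO cO hf mf Op e0.
rewrite -(leq_add2l 1) -(eqP fy).
have -> : \matrix_i affine (f (ys i)) =
    (\matrix_i graph f (ys i)) *m colsub (fun j => mxvec_index 0 j) 1%:M.
  by rewrite mulmx_colsub mulmx1; apply/matrixP => i j;
    rewrite mxE [RHS]mxE [RHS]mxE segreE affine0 mul1r.
apply: leq_trans (mxrankM_maxl _ _) _; rewrite -(eqP fz).
by apply: mxrankS; apply/row_subP => i; rewrite rowK; exact: sz.
Qed.

(* Among the (1 + n) k products of the coordinates of (1, z) with k of the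
   coordinates of (1, f), all relations are syzygies. *)
Lemma dim_lower k : (k <= 1 + d)%N -> ((1 + n) * k <= 1 + m + 'C(k, 2))%N.
Proof.
move=> kd; have [p [e [zs [Op e0 eO fz sz]]]] := graph_span.
pose w (l : 'I_k) z : C := affine (f z) 0 (widen_ord kd l).
pose a (M : 'M[C]_(1 + n, k)) : 'cV[C]_((1 + n) * (1 + d)) :=
  \sum_l \sum_i M i l *: delta_mx (mxvec_index i (widen_ord kd l)) 0.
have syzE M z : syz w M z = (graph f z *m a M) 0 0.
  rewrite /a mulmx_sumr summxE; apply: eq_bigr => l _.
  rewrite mulmx_sumr summxE mxE mulr_suml; apply: eq_bigr => i _.
  rewrite -scalemxAr -colE [RHS]mxE [X in _ = _ * X]mxE segreE.
  by rewrite /w; ring.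
(* Evaluation at the [1 + m] points whose graph values span: its rank is at most [1 + m], and its
   kernel consists of syzygies valid on the whole ball. *)
have [|L LE] := @linear_hom R 'M[C]_(1 + n, k) 'rV[C]_(1 + m) (fun M => \row_i syz w M (zs i)).
  move=> c M N; apply/rowP => i; rewrite !mxE /syz mulr_sumr -big_split.
  by apply: eq_bigr => l _; rewrite mulmxDr -scalemxAr !mxE mulrDl mulrA.
have dL : ((1 + n) * k <= \dim (fullv :&: lker L)%VS + (1 + m))%N.
  have -> : ((1 + n) * k)%N = \dim (fullv : {vspace 'M[C]_(1 + n, k)}) by rewrite dimvf.
  rewrite -(limg_ker_dim L fullv) leq_add2l; apply: leq_trans (dimvS (subvf _)) _.
  by rewrite dimvf /dim /= mul1n.
apply: leq_trans dL _; rewrite addnC leq_add2l.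
apply: (@syz_dim _ _ _ w [set z | nv (z - p) < e]) => /=.
- move=> q u qe; have v0 : 0 < nv u + 1 by rewrite ltr_wpDl ?nv_ge0.
  exists ((e - nv (q - p)) / (nv u + 1)); first by rewrite divr_gt0 ?subr_gt0.
  move=> t; rewrite ltr_pdivlMr // => te.
  rewrite addrAC; apply: le_lt_trans (nvD _ _) _; rewrite nvZ -ltrBrDl.
  by apply: le_lt_trans te; apply: ler_wpM2l; rewrite ?nm_ge0 // lerDl.
- move=> q u j qe; exists (('d (fun z => affine (f z)) q u) 0 (widen_ord kd j)).
  apply: (@d_coord _ _ _ (fun z => affine (f z))); apply: differentiable_affine.
  by apply: hf; exact: eO.
- move=> c c0 j.
  pose b : 'cV[C]_(1 + d) := \sum_l c l *: delta_mx (widen_ord kd l) 0.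
  have b0 : b = 0.
    apply: (embedded_independent oO cO hf mf Op e0) => z /c0 cz.
    apply/rowP => j'; rewrite (ord1 j') [RHS]mxE -[RHS]cz mulmx_sumr summxE.
    by apply: eq_bigr => l _; rewrite -scalemxAr -colE mxE [X in _ * X = _]mxE.
  have /colP/(_ (widen_ord kd j)) := b0; rewrite [RHS]mxE summxE (bigD1 j) //=.
  rewrite big1 ?addr0 => [|l lj]; rewrite !mxE ?eqxx ?mulr1 // andbT.
  by rewrite -val_eqE /= eq_sym val_eqE (negbTE lj) mulr0.
- move=> M; rewrite memv_cap memvf memv_ker LE /= => /eqP ML z ze.
  rewrite syzE (submx_annihilated (sz z ze)) ?mxE //; apply/row_matrixP => i.
  rewrite row_mul rowK row0; apply/rowP => j; rewrite [j]ord1 -syzE [RHS]mxE.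
  by have /rowP/(_ i) := ML; rewrite mxE [RHS]mxE.
Qed.

Lemma dim_bounds :
  ((d <= n)%N ->
     [/\ (n + \sum_(0 <= l < d) (n - l) = n * d.+1 - (d * (d - 1)) %/ 2)%N,
         (n * d.+1 - (d * (d - 1)) %/ 2 <= m)%N,
         (m <= d * n + n + d)%N &
         (d * n + n + d = n * d.+1 + d)%N]) /\
  ((n <= d)%N -> (maxn ((n * (n + 3)) %/ 2) d <= m)%N).
Proof.
split=> [dn|nd].
  (* With [k = 1 + d], [(1 + n) * (1 + d) - 1] minus [d * (d + 1) / 2] is
     [n * (d + 1) - d * (d - 1) / 2]. *)
  have := dim_lower (leqnn _); rewrite add1n binS bin1 -add1n => lo.
  have up := dim_upper; have S := sum_decreasing dn.
  rewrite -bin2_double mulnK //; split; nia.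
(* With [k = 1 + n], the square of [1 + n] minus [n * (n + 1) / 2] minus 1 is [n * (n + 3) / 2]. *)
have := dim_lower (leq_add (leqnn 1) nd); rewrite add1n binS bin1 -add1n => lo.
rewrite geq_max dim_target andbT.
have E := bin2_double n.
have -> : (n * (n + 3) = (n * n + n - 'C(n, 2)) * 2)%N by nia.
rewrite mulnK //; nia.
Qed.

End Bounds.

Theorem theorem1p1 (R : realType) (n d : nat) (Omega : set 'rV[R[i]]_n)
    (f : 'rV[R[i]]_n -> 'rV[R[i]]_d) :
  (0 < n)%N -> (0 < d)%N ->
  Omega !=set0 -> open Omega -> connected Omega ->
  holomorphic Omega f -> minimally_embedded Omega f ->
  [/\ exists (m : nat) (h : 'rV[R[i]]_n -> 'rV[R[i]]_m),
        induces_modification Omega f h,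
      forall (m : nat) (h : 'rV[R[i]]_n -> 'rV[R[i]]_m),
        eq_form_on Omega (modification f) (pullback h (fubini_study R m)) <->
        eq_form_on Omega (fubini_study R n)
          (sub_form (pullback h (fubini_study R m))
                    (pullback f (fubini_study R d))),
      Omega 0 -> f 0 = 0 ->
        [/\ exists (m : nat) (h : 'rV[R[i]]_n -> 'rV[R[i]]_m),
              induces_modification Omega f h /\ h 0 = 0,
            forall (m m' : nat) (h : 'rV[R[i]]_n -> 'rV[R[i]]_m)
                (h' : 'rV[R[i]]_n -> 'rV[R[i]]_m'),
              induces_modification Omega f h -> h 0 = 0 ->
              induces_modification Omega f h' -> h' 0 = 0 ->
              m = m' &
            forall (m : nat) (h h' : 'rV[R[i]]_n -> 'rV[R[i]]_m),
              induces_modification Omega f h -> h 0 = 0 ->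
              induces_modification Omega f h' -> h' 0 = 0 ->
              exists U : 'M[R[i]]_m, U \is unitarymx /\
                (forall z, Omega z -> h' z = h z *m U)] &
      forall (m : nat) (h : 'rV[R[i]]_n -> 'rV[R[i]]_m),
        induces_modification Omega f h ->
        ((d <= n)%N ->
           [/\ (n + \sum_(0 <= l < d) (n - l) =
                  n * d.+1 - (d * (d - 1)) %/ 2)%N,
               (n * d.+1 - (d * (d - 1)) %/ 2 <= m)%N,
               (m <= d * n + n + d)%N &
               (d * n + n + d = n * d.+1 + d)%N]) /\
        ((n <= d)%N -> (maxn ((n * (n + 3)) %/ 2) d <= m)%N)].
Proof.
move=> n0 d0 O0 oO cO hf mf; split.
- by have [m [h [ih _]]] := existence O0 oO hf; exists m, h.
- move=> m h; split=> E z Oz u v; have := E z Oz u v;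
    rewrite /modification /add_form /sub_form.
    by move=> <-; rewrite addrK.
  by move=> ->; rewrite subrK.
- move=> Omega0 f0; split.
  + have [m [h [ih h0]]] := existence O0 oO hf.
    by exists m, h; split; [|exact: h0].
  + move=> m m' h h' ih _ ih' _; apply/eqP; rewrite eqn_leq.
    by rewrite (induced_dim_le oO cO hf O0 ih ih') (induced_dim_le oO cO hf O0 ih' ih).
  + by move=> m h h' ih h0 ih' h'0; exact: (induced_unitary oO cO hf Omega0 ih h0 ih' h'0).
- by move=> m h ih; exact: (dim_bounds O0 oO cO hf mf ih).
Qed.
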